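(* Let $h$ be a strictly increasing potential shape, let $\delta>0$, $x_0,x_\delta\in\mathbb{R}^d$, and let $\gamma$ be a local minimizer of $I^{\delta}_{f_K,x_0,x_\delta}$. Then: (i) The set $NDS(\gamma)$ of nondegenerate shock times of $\gamma$ is finite; that is, there are finitely many times $0\le t_1<\dots<t_\ell\le\delta$ such that $t\mapsto\eta(\gamma(t))$ is constant on each connected component of $[0,\delta]\setminus\{t_1,\dots,t_\ell\}$. (ii) Setting $t_0=0$ and $t_{\ell+1}=\delta$, $\gamma$ is of class $C^{1,1}$ on $[t_i,t_{i+1}]$ for every $i\in\{0,\dots,\ell\}$. Moreover, if $\eta_i\in\mathcal{E}$ is such that $\gamma((t_i,t_{i+1}))\subseteq Q_{\eta_i}$, then \[|\ddot\gamma(r)|\le h'(|\gamma(r)-\eta_i|^2)\,|\gamma(r)-\eta_i|\quad\text{for a.e. } r\in(t_i,t_{i+1}).\]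
   Context: Let $K=\{p_1,\dots,p_N\}\subset\mathbb{R}^d$ be a finite set of $N$ distinct points. Define $f_K(x):=-\tfrac12\operatorname{dist}_K(x)^2=-\min_{y\in K}\tfrac12|x-y|^2$ and the convex function $g_K(x):=\max_{y\in K}\big(x\cdot y-\tfrac12|y|^2\big)=f_K(x)+\tfrac12|x|^2$. The optimality class of $x\in\mathbb{R}^d$ is $\operatorname{opt}(x):=\{y\in K:|x-y|=\operatorname{dist}_K(x)\}$, and $\eta(x)$ denotes the orthogonal projection of $x$ onto $\operatorname{conv}(\operatorname{opt}(x))$. The subdifferential of $f_K$ is $\partial f_K(x):=\{\xi\in\mathbb{R}^d: f_K(y)\ge f_K(x)+\xi\cdot(y-x)-\tfrac12|y-x|^2\ \forall y\}$, and the extended gradient $\nabla f_K(x)$ is the element of minimal norm of $\partial f_K(x)$; it equals $\eta(x)-x$. A potential shape is a $C^1$ function $h:[0,\infty)\to[0,\infty)$. For $\delta>0$ and $x_0,x_\delta\in\mathbb{R}^d$, $I^{\delta}_{f_K,x_0,x_\delta}:C([0,\delta],\mathbb{R}^d)\to[0,+\infty]$ is $I(\gamma)=\int_0^\delta|\dot\gamma|^2+h(|\nabla f_K(\gamma)|^2)\,dt$ if $\gamma$ is absolutely continuous with $\gamma(0)=x_0,\gamma(\delta)=x_\delta$, and $+\infty$ otherwise. A local minimizer is a $\gamma$ with $I(\gamma)<\infty$ such that for some $\rho>0$, $I(\gamma)\le I(\sigma)$ for every $\sigma$ with $\sup_{[0,\delta]}|\sigma-\gamma|<\rho$. Let $\mathcal{E}$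 be the (finite) range of $\eta$ and, for $\eta\in\mathcal{E}$, let the potential zone be $Q_\eta:=\{x:\eta(x)=\eta\}$. A time $t\in[0,\delta]$ is a nondegenerate shock of $\gamma$ if $s\mapsto\eta(\gamma(s))$ is not constant on $I$ for every neighborhood $I$ of $t$ in $[0,\delta]$; $NDS(\gamma)$ is the set of such times. *)

(* Defs.v *)
From HB Require Import structures.
From mathcomp Require Import all_boot all_order all_algebra.
From mathcomp Require Import all_classical all_reals all_analysis.
Set Implicit Arguments. Unset Strict Implicit. Unset Printing Implicit Defensive.
Import Order.TTheory GRing.Theory Num.Theory.
Import numFieldNormedType.Exports.
Local Open Scope classical_set_scope.
Local Open Scope ring_scope.

Section Defs.
Variables (R : realType) (d : nat).
Notation V := 'rV[R]_d.

Definition dotp (u v : V) : R := \sum_(i < d) u ord0 i * v ord0 i.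
Definition sqn (v : V) : R := dotp v v.
Definition enorm (v : V) : R := Num.sqrt (sqn v).

(* K is given as a (duplicate-free, nonempty) list of points *)
Definition distK (K : seq V) (x : V) : R :=
  \big[Num.min/enorm (x - head 0 K)]_(y <- K) enorm (x - y).

Definition fK (K : seq V) (x : V) : R := - (distK K x ^+ 2) / 2.

Definition opt (K : seq V) (x : V) : seq V :=
  [seq y <- K | enorm (x - y) == distK K x].

Definition conv (S : seq V) : set V :=
  [set z | exists lam : V -> R,
      (forall y, y \in S -> 0 <= lam y) /\
      \sum_(y <- S) lam y = 1 /\ z = \sum_(y <- S) lam y *: y].

Definition etaK (K : seq V) (x : V) : V :=
  xget 0 [set p | conv (opt K x) p /\
                  forall z, conv (opt K x) z -> enorm (x - p) <= enorm (x - z)].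

Definition subdiff (K : seq V) (x : V) : set V :=
  [set xi | forall y, fK K x + dotp xi (y - x) - sqn (y - x) / 2 <= fK K y].

Definition extgrad (K : seq V) (x : V) : V :=
  xget 0 [set xi | subdiff K x xi /\
                   forall zeta, subdiff K x zeta -> enorm xi <= enorm zeta].

Definition Qzone (K : seq V) (e : V) : set V := [set x | etaK K x = e].

Definition abs_cont (a b : R) (g : R -> V) : Prop :=
  forall e : R, 0 < e -> exists2 eta : R, 0 < eta &
    forall s : seq (R * R),
      all (fun p => (a <= p.1) && (p.1 <= p.2) && (p.2 <= b)) s ->
      sorted (fun p q => p.2 <= q.1) s ->
      \sum_(p <- s) (p.2 - p.1) < eta ->
      \sum_(p <- s) enorm (g p.2 - g p.1) < e.

Definition potential_shape (h h' : R -> R) : Prop :=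
  (forall t, 0 <= t -> 0 <= h t) /\
  {within `[0, +oo[, continuous h'} /\
  (forall t, 0 <= t ->
     (fun s => s^-1 * (h (t + s) - h t))
       @ within (fun s => s != 0 /\ 0 <= t + s) (nbhs 0) --> h' t).

Definition cinterval (a b : R) : set R := `[a, b].

Definition action (h : R -> R) (K : seq V) (delta : R) (x0 xd : V)
  (g : R -> V) : \bar R :=
  if `[< abs_cont 0 delta g /\ g 0 = x0 /\ g delta = xd >] then
    (\int[@lebesgue_measure R]_(t in cinterval 0 delta)
       (sqn ('D_1 g t) + h (sqn (extgrad K (g t))))%:E)%E
  else +oo%E.

Definition local_minimizer (h : R -> R) (K : seq V) (delta : R) (x0 xd : V)
  (g : R -> V) : Prop :=
  (action h K delta x0 xd g < +oo)%E /\
  exists2 rho : R, 0 < rho & forall sigma : R -> V,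
    (forall t, 0 <= t <= delta -> enorm (sigma t - g t) < rho) ->
    (action h K delta x0 xd g <= action h K delta x0 xd sigma)%E.

Definition nds (K : seq V) (delta : R) (g : R -> V) (t : R) : Prop :=
  0 <= t <= delta /\
  forall eps : R, 0 < eps -> exists s1 s2 : R,
    [/\ 0 <= s1 <= delta, 0 <= s2 <= delta, `|s1 - t| < eps, `|s2 - t| < eps
      & etaK K (g s1) != etaK K (g s2)].

Definition C11_on (a b : R) (g : R -> V) : Prop :=
  exists (g' : R -> V) (L : R),
    (forall s t, a <= s <= b -> a <= t <= b ->
       enorm (g' s - g' t) <= L * `|s - t|) /\
    (forall t, a <= t <= b ->
       (fun s => (s - t)^-1 *: (g s - g t))
         @ within (fun s => s != t /\ a <= s <= b) (nbhs t) --> g' t).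

End Defs.

(* Main.v *)
Require Import Defs.
From HB Require Import structures.
From mathcomp Require Import all_boot all_order all_algebra.
From mathcomp Require Import all_classical all_reals all_analysis.
From mathcomp Require Import measurable_realfun ring lra.
Set Implicit Arguments. Unset Strict Implicit. Unset Printing Implicit Defensive.
Import Order.TTheory GRing.Theory Num.Theory.
Import numFieldNormedType.Exports.
(* [conv] is also a constant of mathcomp-analysis. *)
Import Defs.
Local Open Scope classical_set_scope.
Local Open Scope ring_scope.

(** A local minimizer is compared with three kinds of competitors.

Near a time [t0], let [x := gamma t0] and let [m] be the least distance from [x] to a value of
[eta] that [gamma] visits arbitrarily close to [t0] on a given side. Straight segments from [x]
to the points of [gamma] of level [m] show that the mean velocities from [t0] converge. Were two
values of level [m] visited, their midpoint would be strictly closer to [x] and its cell would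
contain a ray in the limiting direction; following that ray first and then joining [gamma] in
a straight line saves energy. So one value [e1] of level [m] is visited, and
replacing [gamma] between two such visits by its projection on the convex cell
[{y | e1 \in conv (opt y)}] shows that [eta] is equal to [e1] on that side of [t0]. Finiteness
follows by compactness.

Between two shocks [gamma] stays in a closed convex cell. Translating it along a trapezoidal
profile and projecting back on the cell bounds its second differences, with a constant that
tends to the announced one as the profile shrinks to a point. *)

(** * Euclidean geometry *)

(** The argument rests on a separation of scales. The range of [eta] is finite, so distances from
    the fixed point x to visited values are either m or at least m + c. Each unit of time above
    level m costs at least h((m+c)^2) - h(m^2), up to small errors; this is positive because h is
    strictly increasing. Replacing gamma(t) by x changes the potential only by a multiple of the
    square root of |t - t0|, the Hölder bound of a path of finite energy. Visits to level m
    therefore recur in every window [T/64, T/16], and the errors on the mean velocities form a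
    geometric series. Levels can be taken from x because optimality classes only shrink near x:
    [eta] of a nearby y is the projection of x as well as of y onto conv(opt(y)). The other obstacle
    is analytic: the action integrates ['D_1] as it stands, so a competitor is never integrated
    directly. Only an integrable majorant of its Lagrangian is used, built from a density of gamma',
    and the energy of gamma is kept as two functions of intervals with few properties, all invariant
    under time reversal; both sides of t0 are then one case. *)

Section Euclid.
Variables (R : realType) (d : nat).
Notation V := 'rV[R]_d.
Implicit Types (u v w : V) (a : R).

Lemma dotpC u v : dotp u v = dotp v u.
Proof. by apply: eq_bigr => i _; rewrite mulrC. Qed.

Lemma dotpDl u v w : dotp (u + v) w = dotp u w + dotp v w.
Proof. by rewrite -big_split; apply: eq_bigr => i _; rewrite mxE mulrDl. Qed.

Lemma dotpDr u v w : dotp w (u + v) = dotp w u + dotp w v.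
Proof. by rewrite dotpC dotpDl !(dotpC _ w). Qed.

Lemma dotpZl a u v : dotp (a *: u) v = a * dotp u v.
Proof. by rewrite mulr_sumr; apply: eq_bigr => i _; rewrite mxE mulrA. Qed.

Lemma dotpZr a u v : dotp u (a *: v) = a * dotp u v.
Proof. by rewrite dotpC dotpZl dotpC. Qed.

Lemma dotpNl u v : dotp (- u) v = - dotp u v.
Proof. by rewrite -scaleN1r dotpZl mulN1r. Qed.

Lemma dotpNr u v : dotp u (- v) = - dotp u v.
Proof. by rewrite dotpC dotpNl dotpC. Qed.

Lemma dotp0l u : dotp 0 u = 0.
Proof. by rewrite -(scale0r 0) dotpZl mul0r. Qed.

Lemma dotp0r u : dotp u 0 = 0.
Proof. by rewrite dotpC dotp0l. Qed.

Definition dotpE := (dotpDl, dotpDr, dotpNl, dotpNr, dotpZl, dotpZr, dotp0l, dotp0r).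

Lemma dotp_suml (I : Type) (s : seq I) (F : I -> V) v :
  dotp (\sum_(i <- s) F i) v = \sum_(i <- s) dotp (F i) v.
Proof.
elim: s => [|i s IHs]; first by rewrite !big_nil dotp0l.
by rewrite !big_cons dotpDl IHs.
Qed.

Lemma sqn_ge0 u : 0 <= sqn u.
Proof. by apply: sumr_ge0 => i _; rewrite -expr2 sqr_ge0. Qed.

Lemma sqnN u : sqn (- u) = sqn u.
Proof. by rewrite /sqn !dotpE opprK. Qed.

Lemma sqnZ a u : sqn (a *: u) = a ^+ 2 * sqn u.
Proof. by rewrite /sqn !dotpE mulrA expr2. Qed.

Lemma sqnD u v : sqn (u + v) = sqn u + 2 * dotp u v + sqn v.
Proof. by rewrite /sqn !dotpE (dotpC v u); ring. Qed.

Lemma sqnB u v : sqn (u - v) = sqn u - 2 * dotp u v + sqn v.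
Proof. by rewrite sqnD sqnN dotpNr mulrN. Qed.

Lemma sqnBC u v : sqn (u - v) = sqn (v - u).
Proof. by rewrite -sqnN opprB. Qed.

Lemma sqn_eq0 u : sqn u = 0 -> u = 0.
Proof.
move=> u0; apply/rowP => i; rewrite mxE.
have /(_ i isT)/eqP : forall j, true -> u ord0 j * u ord0 j = 0.
  by apply/psumr_eq0P => // j _; rewrite -expr2 sqr_ge0.
by rewrite mulf_eq0 orbb => /eqP.
Qed.

Lemma coord_sqn u i : (u ord0 i) ^+ 2 <= sqn u.
Proof.
rewrite /sqn /dotp (bigD1 i)//= -expr2 lerDl sumr_ge0// => j _.
by rewrite -expr2 sqr_ge0.
Qed.

Lemma cauchy_schwarz_sqn u v : dotp u v ^+ 2 <= sqn u * sqn v.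
Proof.
have [/sqn_eq0 -> |v0] := eqVneq (sqn v) 0; first by rewrite !dotpE /sqn !dotpE; lra.
have vp : 0 < sqn v by rewrite lt_def v0 sqn_ge0.
have := sqn_ge0 (sqn v *: u - dotp u v *: v).
rewrite sqnB !sqnZ !dotpE => h.
have {h} : 0 <= sqn v * (sqn u * sqn v - dotp u v ^+ 2) by nra.
by rewrite pmulr_rge0// subr_ge0.
Qed.

Lemma enorm_ge0 u : 0 <= enorm u. Proof. exact: sqrtr_ge0. Qed.

Lemma enorm_sqr u : enorm u ^+ 2 = sqn u.
Proof. by rewrite sqr_sqrtr// sqn_ge0. Qed.

Lemma enorm0 : enorm (0 : V) = 0.
Proof. by rewrite /enorm /sqn dotp0l sqrtr0. Qed.

Lemma enormN u : enorm (- u) = enorm u.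
Proof. by rewrite /enorm sqnN. Qed.

Lemma enormB u v : enorm (u - v) = enorm (v - u).
Proof. by rewrite -enormN opprB. Qed.

Lemma enormZ a u : enorm (a *: u) = `|a| * enorm u.
Proof. by rewrite /enorm sqnZ sqrtrM ?sqr_ge0// sqrtr_sqr. Qed.

Lemma enorm_le_sqn u v : (enorm u <= enorm v) = (sqn u <= sqn v).
Proof. by rewrite ler_sqrt// sqn_ge0. Qed.

Lemma enorm_lt_sqn u v : (enorm u < enorm v) = (sqn u < sqn v).
Proof. by rewrite !ltNge enorm_le_sqn. Qed.

Lemma enorm_le u a : 0 <= a -> (enorm u <= a) = (sqn u <= a ^+ 2).
Proof. by move=> a0; rewrite -enorm_sqr ler_sqr// nnegrE enorm_ge0. Qed.

Lemma cauchy_schwarz u v : dotp u v <= enorm u * enorm v.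
Proof.
rewrite -sqrtrM ?sqn_ge0// (le_trans (ler_norm _))// -sqrtr_sqr ler_sqrt ?cauchy_schwarz_sqn//.
by rewrite mulr_ge0 ?sqn_ge0.
Qed.

Lemma normr_dotp u v : `|dotp u v| <= enorm u * enorm v.
Proof.
rewrite ler_norml cauchy_schwarz andbT -(enormN v).
by have := cauchy_schwarz u (- v); rewrite dotpNr; lra.
Qed.

Lemma ler_enormD u v : enorm (u + v) <= enorm u + enorm v.
Proof.
rewrite enorm_le ?addr_ge0 ?enorm_ge0// sqnD -!enorm_sqr.
by have := cauchy_schwarz u v; nra.
Qed.

Lemma ler_enormB u v w : enorm (u - w) <= enorm (u - v) + enorm (v - w).
Proof. by rewrite (le_trans _ (ler_enormD _ _))// addrA subrK. Qed.

Lemma ler_enorm_dist u v : `|enorm u - enorm v| <= enorm (u - v).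
Proof.
have := ler_enormD (u - v) v; have := ler_enormD (v - u) u.
by rewrite !subrK (enormB v u) ler_norml => h1 h2; apply/andP; split; lra.
Qed.

Lemma coord_enorm u i : `|u ord0 i| <= enorm u.
Proof. by rewrite -sqrtr_sqr ler_sqrt ?coord_sqn// sqn_ge0. Qed.

Lemma norm_le_enorm u : `|u| <= enorm u.
Proof.
rewrite [`|u|]mx_normrE bigmax_le ?enorm_ge0// => -[i j] _ /=.
by rewrite ord1 coord_enorm.
Qed.

Lemma coord_norm u i : `|u ord0 i| <= `|u|.
Proof.
rewrite [`|u|]mx_normrE.
by apply: (le_bigmax _ (fun ij : 'I_1 * 'I_d => `|u ij.1 ij.2|) (ord0, i)).
Qed.

Lemma enorm_le_sum u : enorm u <= \sum_(i < d) `|u ord0 i|.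
Proof.
rewrite enorm_le ?sumr_ge0// expr2 mulr_sumr; apply: ler_sum => i _.
rewrite -expr2 -real_normK ?num_real// expr2 ler_wpM2r//.
by rewrite (bigD1 i)//= lerDl sumr_ge0.
Qed.

Lemma enorm_le_norm u : enorm u <= d%:R * `|u|.
Proof.
rewrite (le_trans (enorm_le_sum u))// (le_trans (ler_sum _ (fun i _ => coord_norm u i)))//.
by rewrite sumr_const card_ord mulr_natl.
Qed.

Lemma nbhs_enormP (x : V) (A : set V) :
  nbhs x A <-> exists2 e, 0 < e & forall y, enorm (y - x) < e -> A y.
Proof.
split.
  move=> /nbhs_ballP[e e0 eA]; exists e => // y ye; apply: eA.
  rewrite -ball_normE /= (le_lt_trans (norm_le_enorm _))// -enormN opprB//.
move=> [e e0 eA]; apply/nbhs_ballP; exists (e / d.+1%:R); first by rewrite /= divr_gt0.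
move=> y; rewrite -ball_normE /= => xy; apply: eA.
rewrite -enormN opprB (le_lt_trans (enorm_le_norm _))//.
rewrite (@le_lt_trans _ _ (d.+1%:R * `|x - y|))// ?ler_wpM2r// ?ler_nat//.
by rewrite mulrC -ltr_pdivlMr.
Qed.

Lemma lip1_continuous (f : V -> R) :
  (forall x y, `|f x - f y| <= enorm (x - y)) -> continuous f.
Proof.
move=> lip x; apply/(@cvgrPdist_lt _ R _ _ (nbhs_filter x)) => e e0.
apply/nbhs_enormP; exists e => // y ye.
by rewrite (le_lt_trans (lip _ _))// enormB.
Qed.

Lemma enorm_continuous : continuous (@enorm R d).
Proof. exact: lip1_continuous ler_enorm_dist. Qed.

End Euclid.

(** * Optimality classes and their cells *)

(** The smallest of finitely many radii works. Through this lemma the finiteness of [K] and of the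
    range of [eta] turns pointwise smallness into uniform smallness. *)
Lemma unif_radius (R : realType) (T : eqType) (s : seq T) (P : T -> R -> Prop) :
  (forall k r r', P k r -> 0 < r' -> r' <= r -> P k r') ->
  (forall k, k \in s -> exists2 r, 0 < r & P k r) ->
  exists2 r, 0 < r & forall k, k \in s -> P k r.
Proof.
move=> mono; elim: s => [|k s IHs] Ps; first by exists 1.
have [|r r0 rP] := IHs; first by move=> j js; apply: Ps; rewrite inE js orbT.
have [|r' r'0 r'P] := Ps k; first by rewrite inE eqxx.
exists (Num.min r r') => [|j]; first by rewrite lt_min r0.
rewrite inE => /orP[/eqP ->|/rP h].
  by apply: mono r'P _ _; rewrite ?lt_min ?r0// ge_min lexx orbT.
by apply: mono h _ _; rewrite ?lt_min ?r0// ge_min lexx.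
Qed.

(** * Projections onto closed convex sets *)

Section Projection.
Variables (R : realType) (d : nat).
Notation V := 'rV[R]_d.
Implicit Types (A : set V) (x y z p q : V).

Definition convex_in A := forall x y (t : R), A x -> A y -> 0 <= t <= 1 -> A (x + t *: (y - x)).

(** Encoded by the obtuse-angle inequality rather than by least distance: uniqueness, Pythagoras and
    nonexpansiveness follow from it by expansion. *)
Definition is_proj A x p := A p /\ forall z, A z -> dotp (z - p) (x - p) <= 0.

Lemma is_proj_pythagoras A x p z : is_proj A x p -> A z ->
  sqn (x - p) + sqn (z - p) <= sqn (x - z).
Proof.
move=> [_ pP] /pP h; rewrite [leRHS](_ : _ = sqn ((x - p) - (z - p))); last by congr sqn; rewrite opprB addrA subrK.
by rewrite [leRHS]sqnB dotpC; lra.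
Qed.

Lemma is_proj_unique A x p q : is_proj A x p -> is_proj A x q -> p = q.
Proof.
move=> pP qP; apply/esym/eqP; rewrite -subr_eq0; apply/eqP/sqn_eq0.
have := is_proj_pythagoras pP (proj1 qP); have := is_proj_pythagoras qP (proj1 pP).
by rewrite (sqnBC p q); have := sqn_ge0 (q - p); lra.
Qed.

Lemma is_proj_id A x : A x -> is_proj A x x.
Proof. by move=> Ax; split=> // z _; rewrite subrr dotp0r. Qed.

Lemma nearest_is_proj A x p : convex_in A -> A p ->
  (forall z, A z -> enorm (x - p) <= enorm (x - z)) -> is_proj A x p.
Proof.
move=> cA Ap pmin; split=> // z Az; rewrite leNgt; apply/negP => h.
set c := dotp _ _ in h; set s := sqn (z - p).
have s0 : 0 <= s by exact: sqn_ge0.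
(* With this step length [t * s < c], so the first-order decrease [2 * t * c] of the squared
   distance beats the second-order term [t ^+ 2 * s]. *)
pose t := Num.min 1 (c / (s + 1)).
have t0 : 0 < t by rewrite lt_min ltr01 divr_gt0//; lra.
have t1 : t <= 1 by rewrite ge_min lexx.
have tc : t * (s + 1) <= c by rewrite -ler_pdivlMr ?ge_min ?lexx ?orbT//; lra.
have := pmin _ (cA _ _ t Ap Az _); rewrite ltW// t1 => /(_ isT).
rewrite enorm_le_sqn opprD addrA [leRHS]sqnB dotpZr sqnZ -/s (dotpC (x - p)) -/c.
by nra.
Qed.

(** Adding the two obtuse-angle inequalities bounds [sqn (p - q)] by [dotp (p - q) (x - y)]. This is
    why projecting a path on a convex cell never raises its kinetic energy. *)
Lemma is_proj_dist A x y p q : is_proj A x p -> is_proj A y q ->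
  enorm (p - q) <= enorm (x - y).
Proof.
move=> [Ap pP] [Aq qP]; rewrite enorm_le_sqn.
have h1 := pP _ Aq; have h2 := qP _ Ap.
have : sqn (p - q) <= dotp (p - q) (x - y).
  suff -> : dotp (p - q) (x - y) = sqn (p - q) - dotp (q - p) (x - p) - dotp (p - q) (y - q) by lra.
  by rewrite /sqn !dotpE (dotpC q p); ring.
have := cauchy_schwarz_sqn (p - q) (x - y).
have := sqn_ge0 (p - q); have := sqn_ge0 (x - y).
set a := sqn (p - q); set b := sqn (x - y); set c := dotp _ _ => b0 a0 cab ac.
rewrite leNgt; apply/negP => ba.
have : a * a <= a * b by rewrite (le_trans _ cab)// expr2 ler_pM.
by nra.
Qed.

Lemma closed_enormP A : (forall x, (forall e, 0 < e -> exists2 y, A y & enorm (y - x) < e) -> A x) ->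
  closed A.
Proof.
move=> AP x clx; apply: AP => e e0.
have [|y [Ay ye]] := clx [set y | enorm (y - x) < e].
  by apply/nbhs_enormP; exists e.
by exists y.
Qed.

Lemma is_proj_exists A x : closed A -> convex_in A -> A !=set0 -> exists p, is_proj A x p.
Proof.
move=> clA cA [a Aa].
(* Cutting [A] by the ball through [a] makes it compact; the points cut off are farther from [x]
   than [a], so the minimum over [B] is global. *)
pose B := A `&` [set y | enorm (x - y) <= enorm (x - a)].
have cB : compact B.
  apply: bounded_closed_compact.
    exists (enorm x + enorm (x - a)); split; first exact: num_real.
    move=> M hM y [_ /= yB]; rewrite (le_trans (norm_le_enorm y))// (le_trans _ (ltW hM))//.
    by rewrite -[y](subKr x) (le_trans (ler_enormD _ _))// enormN lerD2l.
  apply: closedI => //; apply: closed_enormP => y hy /=.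
  apply/ler_addgt0Pr => e e0; have [z /= zB ze] := hy e e0.
  by rewrite (le_trans (ler_enormB x z y))// lerD// ltW.
have B0 : B !=set0 by exists a; split => /=.
have cont : {within B, continuous (fun y => enorm (x - y))}.
  apply: continuous_subspaceT; apply: lip1_continuous => y z.
  rewrite (le_trans (ler_enorm_dist _ _))//.
  by rewrite opprB addrC addrA subrK enormB.
have [p /set_mem[Ap pB] pmin] := EVT_min_rV B0 cB cont.
exists p; apply: nearest_is_proj => // z Az.
have [za|/ltW za] := leP (enorm (x - z)) (enorm (x - a)).
  by apply: pmin; rewrite inE; split.
by rewrite (le_trans _ za).
Qed.

End Projection.

(** * The convex function [gK], its subgradients and the map [eta] *)

Section Opt.
Variables (R : realType) (d : nat) (K : seq 'rV[R]_d).
Hypotheses (K0 : K != [::]) (Ku : uniq K).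
Notation V := 'rV[R]_d.
Implicit Types (x y z k e : V).

Definition qK k x : R := dotp k x - sqn k / 2.
(** Written through the distance; [qK_le] and [opt_nonempty] identify it with the maximum over [K]
    of the affine functions [qK k]. *)
Definition gK x : R := (sqn x - distK K x ^+ 2) / 2.

Lemma sqn_qK x k : sqn (x - k) = sqn x - 2 * qK k x.
Proof. by rewrite sqnB /qK (dotpC x); field. Qed.

Lemma qKD k x y : qK k y = qK k x + dotp k (y - x).
Proof. by rewrite /qK !dotpE; ring. Qed.

Lemma distK_le x k : k \in K -> distK K x <= enorm (x - k).
Proof.
rewrite /distK; move: (enorm (x - head 0 K)) => m.
elim: K => // j s IHs; rewrite inE big_cons ge_min => /orP[/eqP <-|/IHs ->]; last by rewrite orbT.
by rewrite lexx.
Qed.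

Lemma distK_attained x : exists2 k, k \in K & distK K x = enorm (x - k).
Proof.
rewrite /distK.
have : head 0 K \in K by case: (K) K0 => // a s _; rewrite inE eqxx.
move: (head 0 K) => m mK.
suff : \big[Num.min/enorm (x - m)]_(y <- K) enorm (x - y) \in [seq enorm (x - k) | k <- K].
  by move=> /mapP[k kK ->]; exists k.
suff : forall s, {subset s <= K} -> \big[Num.min/enorm (x - m)]_(y <- s) enorm (x - y) \in
    [seq enorm (x - k) | k <- K] by exact.
elim => [_|j s IHs sK]; first by rewrite big_nil; apply/mapP; exists m.
rewrite big_cons; case: leP => _; last by apply: IHs => i si; apply: sK; rewrite inE si orbT.
by apply/mapP; exists j => //; rewrite sK// inE eqxx.
Qed.

Lemma distK_ge0 x : 0 <= distK K x.
Proof. by have [k _ ->] := distK_attained x; exact: enorm_ge0. Qed.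

Lemma qK_le k x : k \in K -> qK k x <= gK x.
Proof.
move=> /(distK_le x) h; rewrite /gK ler_pdivlMr//.
have : distK K x ^+ 2 <= sqn (x - k) by rewrite -enorm_sqr ler_sqr ?nnegrE ?enorm_ge0 ?distK_ge0.
by rewrite sqn_qK; lra.
Qed.

Lemma mem_opt k x : (k \in opt K x) = (k \in K) && (qK k x == gK x).
Proof.
rewrite mem_filter andbC; congr (_ && _).
rewrite -(@eqrXn2 _ 2) ?distK_ge0 ?enorm_ge0// enorm_sqr sqn_qK.
by apply/eqP/eqP; rewrite /gK; lra.
Qed.

Lemma opt_sub k x : k \in opt K x -> k \in K.
Proof. by rewrite mem_opt => /andP[]. Qed.

Lemma opt_qK k x : k \in opt K x -> qK k x = gK x.
Proof. by rewrite mem_opt => /andP[_ /eqP]. Qed.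

Lemma opt_nonempty x : exists k, k \in opt K x.
Proof.
have [k kK e] := distK_attained x; exists k; rewrite mem_opt kK/=.
by rewrite /gK e enorm_sqr sqn_qK; apply/eqP; field.
Qed.

(** A point [k] that is not optimal at [x] has a positive deficit [gK x - qK k x], which affine
    functions keep on a small ball. *)
Lemma opt_near x : exists2 r, 0 < r &
  forall y, enorm (y - x) < r -> {subset opt K y <= opt K x}.
Proof.
have [k0 k0x] := opt_nonempty x.
have [|k|r r0 rP] := @unif_radius R _ K (fun k r => forall y,
  enorm (y - x) < r -> k \in opt K y -> k \in opt K x).
- by move=> k r r' h r'0 r'r y yr; apply: h; exact: lt_le_trans r'r.
- move=> kK; have [kx|kx] := eqVneq (qK k x) (gK x).
  + by exists 1 => // y _ _; rewrite mem_opt kK kx eqxx.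
  + have {}kx : qK k x < gK x by rewrite lt_neqAle kx qK_le.
    exists ((gK x - qK k x) / (enorm (k0 - k) + 1)).
      by rewrite divr_gt0 ?subr_gt0// ltr_wpDl ?enorm_ge0.
    move=> y; rewrite ltr_pdivlMr; last by rewrite ltr_wpDl ?enorm_ge0.
    move=> h /opt_qK kopt; exfalso.
    have := qK_le y (opt_sub k0x); rewrite -kopt (qKD k x) (qKD k0 x) (opt_qK k0x).
    have := normr_dotp (k0 - k) (y - x); rewrite ler_norml dotpDl dotpNl => /andP[].
    by have := enorm_ge0 (y - x); nra.
- by exists r => // y yr k ky; apply: (rP _ (opt_sub ky) y).
Qed.

(** Weights are extended by zero to all of [K]: the index set no longer depends on [x], so weights
    can be carried from one class to another and placed in a simplex of fixed dimension. *)
Lemma convP x z : conv (opt K x) z <-> exists lam : V -> R,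
  [/\ forall k, k \in K -> 0 <= lam k, forall k, k \in K -> k \notin opt K x -> lam k = 0,
      \sum_(k <- K) lam k = 1 & z = \sum_(k <- K) lam k *: k].
Proof.
split=> [[lam [lam0 [lam1 ->]]]|[lam [lam0 lamN lam1 ->]]].
  exists (fun k => if k \in opt K x then lam k else 0); split.
  - by move=> k _; case: ifPn => // /lam0.
  - by move=> k _ /negPf ->.
  - rewrite -lam1 big_filter [RHS]big_mkcond/= big_seq_cond [RHS]big_seq_cond.
    apply: eq_bigr => k /andP[kK _]; rewrite mem_filter kK andbT.
    by case: ifP.
  - rewrite big_filter big_mkcond/= big_seq_cond [RHS]big_seq_cond.
    apply: eq_bigr => k /andP[kK _]; rewrite mem_filter kK andbT.
    by case: ifP => // _; rewrite scale0r.
exists lam; split; first by move=> k kx; apply: lam0; exact: opt_sub kx.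
split; first rewrite -lam1; last apply/esym.
  rewrite big_filter big_mkcond/= big_seq [RHS]big_seq; apply: eq_bigr => k kK.
  by case: ifPn => // kx; rewrite lamN// mem_filter (negPf kx).
rewrite big_filter big_mkcond/= big_seq [RHS]big_seq; apply: eq_bigr => k kK.
by case: ifPn => // kx; rewrite lamN ?scale0r// mem_filter (negPf kx).
Qed.

Lemma conv_opt k x : k \in opt K x -> conv (opt K x) k.
Proof.
move=> kx; exists (fun j => (j == k)%:R); split; first by move=> j _; rewrite ler0n.
have ux : uniq (opt K x) by rewrite filter_uniq.
split; first by rewrite (bigD1_seq k)//= eqxx big1 ?addr0// => j /negPf ->.
rewrite (bigD1_seq k)//= eqxx scale1r big1 ?addr0// => j /negPf ->.
by rewrite scale0r.
Qed.

Lemma conv_mono x y : {subset opt K x <= opt K y} -> conv (opt K x) `<=` conv (opt K y).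
Proof.
move=> xy z /convP[lam [l0 lN l1 lz]]; apply/convP; exists lam; split => // k kK ky.
by apply: lN => //; apply: contra ky; exact: xy.
Qed.

Lemma conv_convex x : convex_in (conv (opt K x)).
Proof.
move=> y z t [l [l0 [l1 ->]]] [m [m0 [m1 ->]]] /andP[t0 t1].
exists (fun k => l k + t * (m k - l k)); split.
  by move=> k kx; have := l0 _ kx; have := m0 _ kx; nra.
split; first by rewrite big_split/= -mulr_sumr sumrB l1 m1 subrr mulr0 addr0.
rewrite -sumrB scaler_sumr -big_split/=; apply: eq_bigr => k _.
by rewrite -scalerBl scalerA -scalerDl.
Qed.

Lemma conv_dotp_le x z v c : (forall k, k \in opt K x -> dotp k v <= c) ->
  conv (opt K x) z -> dotp z v <= c.
Proof.
move=> h [l [l0 [l1 ->]]]; rewrite dotp_suml -[c]mul1r -l1 mulr_suml.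
rewrite big_seq [leRHS]big_seq; apply: ler_sum => k kx.
by rewrite dotpZl ler_wpM2l ?l0 ?h.
Qed.

Lemma conv_dotp_ge x z v c : (forall k, k \in opt K x -> c <= dotp k v) ->
  conv (opt K x) z -> c <= dotp z v.
Proof.
move=> h /conv_dotp_le h'; have := h' (- v) (- c).
by rewrite dotpNr lerN2; apply => k /h; rewrite dotpNr lerN2.
Qed.

Lemma conv_subgradient x y e : conv (opt K x) e -> gK x + dotp e (y - x) <= gK y.
Proof.
move=> h; rewrite -lerBrDl; apply: conv_dotp_le h => k kx.
by rewrite lerBrDl -(opt_qK kx) -qKD qK_le// (opt_sub kx).
Qed.

(** [e] is a subgradient of [gK] at [x]; the inequality says that its affine minorant touches [gK]
    at [y]. The weighted sum of the nonnegative deficits [gK y - qK k y] then vanishes, so every [k]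
    of positive weight is optimal at [y]. *)
Lemma conv_optP x y e : conv (opt K x) e ->
  (conv (opt K y) e <-> gK y <= gK x + dotp e (y - x)).
Proof.
move=> ex; split=> [ey|].
  have := conv_subgradient x ey; rewrite !dotpE; lra.
have /convP[l [l0 lN l1 le]] := ex => h; apply/convP; exists l; split => // k kK ky.
have : \sum_(k <- K) l k * (gK y - qK k y) <= 0.
  rewrite (_ : \sum_(k <- K) _ = gK y - (gK x + dotp e (y - x))); first by lra.
  rewrite le dotp_suml -[X in X - _]mul1r -[X in _ - (X + _)]mul1r -l1 !mulr_suml -big_split/= -sumrB.
  rewrite big_seq [RHS]big_seq; apply: eq_bigr => j jK.
  rewrite (qKD j x) dotpZl; have [jx|jx] := boolP (j \in opt K x).
    by rewrite (opt_qK jx); ring.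
  by rewrite lN//; ring.
have tm j : j \in K -> 0 <= l j * (gK y - qK j y).
  by move=> jK; rewrite mulr_ge0 ?l0// subr_ge0 qK_le.
rewrite big_seq => s0.
have /eqP : \sum_(j <- K | j \in K) l j * (gK y - qK j y) == 0.
  by rewrite eq_le s0 sumr_ge0.
rewrite -big_seq => /eqP; rewrite (bigD1_seq k)//= paddr_eq0 ?tm//; last first.
  by rewrite big_seq_cond sumr_ge0// => j /andP[/tm].
rewrite mulf_eq0 subr_eq0 => /andP[/orP[/eqP//|/eqP gy] _].
by move: ky; rewrite mem_opt kK gy eqxx.
Qed.

Lemma conv_optKP x y e : conv (opt K x) e ->
  (conv (opt K y) e <-> forall k, k \in K -> qK k y <= gK x + dotp e (y - x)).
Proof.
move=> ex; rewrite (conv_optP y ex); split=> [h k kK|h].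
  by rewrite (le_trans (qK_le _ kK)).
by have [k ky] := opt_nonempty y; rewrite -(opt_qK ky) h// (opt_sub ky).
Qed.

(** Contains the potential zone of [e] and, unlike the zone, is closed and convex; competitors are
    projected on it. On it the potential is at most h(|y - e|^2). *)
Definition cell e : set V := [set x | conv (opt K x) e].

(** Once a point [x] of the cell is known, [conv_optKP] describes the cell by one affine inequality
    in [y] for each point of [K]. *)
Lemma cell_closed_convex x e : cell e x -> closed (cell e) /\ convex_in (cell e).
Proof.
move=> ex; split; last first.
  move=> y z t /(conv_optKP _ ex) hy /(conv_optKP _ ex) hz /andP[t0 t1].
  apply/(conv_optKP _ ex) => k kK; rewrite (qKD k x).
  have := hy k kK; have := hz k kK; rewrite (qKD k x y) (qKD k x z) !dotpE.
  by nra.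
apply: closed_enormP => y hy; apply/(conv_optKP _ ex) => k kK.
apply/ler_addgt0Pr => r r0.
have n0 : 0 < enorm (k - e) + 1 by rewrite ltr_wpDl ?enorm_ge0.
have [|z /(conv_optKP _ ex)/(_ k kK) hz zy] := hy (r / (enorm (k - e) + 1)).
  by rewrite divr_gt0.
move: zy; rewrite ltr_pdivlMr// => zy.
have := normr_dotp (k - e) (y - z); rewrite ler_norml => /andP[_].
move: hz zy; rewrite (enormB y) (qKD k x y) (qKD k x z) !dotpE.
by have := enorm_ge0 (z - y); nra.
Qed.

Let lsum (l : 'rV[R]_(size K)) : V := \sum_(i < size K) l ord0 i *: K`_i.

Let lsimplex x := [set l : 'rV[R]_(size K) | [/\ forall i, 0 <= l ord0 i,
  forall i : 'I_(size K), K`_i \notin opt K x -> l ord0 i = 0 & \sum_i l ord0 i = 1]].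

Let lsum_conv x l : lsimplex x l -> conv (opt K x) (lsum l).
Proof.
move=> [l0 lN l1]; apply/convP; exists (fun k => \sum_(i < size K | K`_i == k) l ord0 i).
have one (i : 'I_(size K)) : \sum_(j < size K | K`_j == K`_i) l ord0 j = l ord0 i :> R.
  by rewrite (big_pred1 i)// => j /=; rewrite nth_uniq.
split.
- by move=> k _; rewrite sumr_ge0.
- by move=> k _ kx; rewrite big1// => i /eqP ki; rewrite lN// ki.
- by rewrite (big_nth 0) big_mkord -l1; apply: eq_bigr => i _; rewrite one.
- by rewrite (big_nth 0) big_mkord; apply: eq_bigr => i _; rewrite one.
Qed.

Let conv_lsum x z : conv (opt K x) z -> exists2 l, lsimplex x l & z = lsum l.
Proof.
move=> /convP[l [l0 lN l1 ->]]; exists (\row_i l K`_i); last first.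
  by rewrite (big_nth 0) big_mkord; apply: eq_bigr => i _; rewrite mxE.
split=> [i|i|].
- by rewrite mxE l0// mem_nth.
- by rewrite mxE => /lN -> //; rewrite mem_nth.
- by rewrite -l1 [RHS](big_nth 0) big_mkord; apply: eq_bigr => i _; rewrite mxE.
Qed.

Let lsimplex_compact x : compact (lsimplex x).
Proof.
have coord (l m : 'rV[R]_(size K)) i : `|l ord0 i - m ord0 i| <= enorm (l - m).
  by have := coord_enorm (l - m) i; rewrite !mxE.
apply: bounded_closed_compact.
  exists 1; split; first exact: num_real.
  move=> M hM l [l0 lN l1] /=; rewrite (le_trans _ (ltW hM))//.
  rewrite [`|l|]mx_normrE bigmax_le// => -[i j] _ /=.
  rewrite ord1 ger0_norm// -l1 (bigD1 j)//= lerDl sumr_ge0//.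
apply: closed_enormP => l hl; split.
- move=> i; rewrite leNgt; apply/negP => li.
  have [|m [m0 _ _]] := hl (- l ord0 i); first by rewrite oppr_gt0.
  have := coord m l i; have := m0 i; have := ler_norm (m ord0 i - l ord0 i); lra.
- move=> i ix; apply/eqP; rewrite -normr_le0; apply/ler_addgt0Pr => e e0.
  have [m [_ mN _] ml] := hl e e0.
  have := coord m l i; rewrite mN// sub0r normrN add0r; lra.
- apply/eqP; rewrite -subr_eq0 -normr_le0; apply/ler_addgt0Pr => e e0; rewrite add0r.
  have n0 : 0 < (size K).+1%:R :> R by rewrite ltr0n.
  have [|m [_ _ m1]] := hl (e / (size K).+1%:R); first by rewrite divr_gt0.
  rewrite ltr_pdivlMr// => ml; rewrite -m1 -sumrB (le_trans (ler_norm_sum _ _ _))//.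
  rewrite (@le_trans _ _ (\sum_(i < size K) enorm (m - l)))//.
    by apply: ler_sum => i _; rewrite distrC coord.
  rewrite sumr_const card_ord -[_ *+ _]mulr_natr (le_trans _ (ltW ml))//.
  by rewrite ler_wpM2l ?enorm_ge0// ler_nat.
Qed.

(** The hull is the continuous image of a compact simplex of weights, and the distance is minimized
    over the weights. *)
Lemma is_proj_conv x y : exists p, is_proj (conv (opt K x)) y p.
Proof.
have s0 : lsimplex x !=set0.
  have [k /conv_opt/conv_lsum[l lx _]] := opt_nonempty x.
  by exists l.
have cont : {within lsimplex x, continuous (fun l => enorm (y - lsum l))}.
  apply: continuous_subspaceT => l.
  apply/(@cvgrPdist_lt _ R _ _ (nbhs_filter l)) => e e0; apply/nbhs_enormP.
  have n0 : 0 < \sum_(i < size K) enorm K`_i + 1.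
    by rewrite ltr_wpDl// sumr_ge0// => i _; exact: enorm_ge0.
  exists (e / (\sum_(i < size K) enorm K`_i + 1)); first by rewrite divr_gt0.
  move=> m; rewrite ltr_pdivlMr// => ml.
  rewrite (le_lt_trans (ler_enorm_dist _ _))// (le_lt_trans _ ml)//.
  have -> : y - lsum l - (y - lsum m) = \sum_(i < size K) (m - l) ord0 i *: K`_i.
    rewrite opprB addrC addrA subrK -sumrB; apply: eq_bigr => i _.
    by rewrite -scalerBl !mxE.
  rewrite mulrDr mulr1 (le_trans (y := \sum_(i < size K) enorm (m - l) * enorm K`_i))//; last first.
    by rewrite -mulr_sumr lerDl enorm_ge0.
  apply: (big_ind2 (fun u v => enorm u <= v)); first by rewrite enorm0.
  - by move=> u a v b ua vb; rewrite (le_trans (ler_enormD _ _))// lerD.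
  - by move=> i _; rewrite enormZ ler_wpM2r ?enorm_ge0 ?coord_enorm.
have [l /set_mem lx lmin] := EVT_min_rV s0 (@lsimplex_compact x) cont.
exists (lsum l); apply: nearest_is_proj; [exact: conv_convex|exact: lsum_conv|].
by move=> z /conv_lsum[m mx ->]; apply: lmin; rewrite inE.
Qed.

Lemma etaK_proj x : is_proj (conv (opt K x)) x (etaK K x).
Proof.
have [p pP] := is_proj_conv x x.
rewrite /etaK; case: xgetP => [q _ [qx qmin]|/(_ p)[]].
  by apply: nearest_is_proj => //; exact: conv_convex.
split; first by case: pP.
move=> z zx; rewrite enorm_le_sqn.
by have := is_proj_pythagoras pP zx; have := sqn_ge0 (z - p); lra.
Qed.

Lemma etaK_conv x : conv (opt K x) (etaK K x).
Proof. by have [] := etaK_proj x. Qed.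

Lemma subdiffE x xi : subdiff K x xi <-> forall y, gK x + dotp (xi + x) (y - x) <= gK y.
Proof.
have e y : fK K x + dotp xi (y - x) - sqn (y - x) / 2 - fK K y =
    gK x + dotp (xi + x) (y - x) - gK y.
  by rewrite /fK /gK sqnB /sqn !dotpE (dotpC y x); field.
by split=> h y; have := h y; have := e y; lra.
Qed.

Lemma extgradE x : extgrad K x = etaK K x - x.
Proof.
have [ex eP] := etaK_proj x; set e := etaK K x in ex eP *.
have sub : subdiff K x (e - x).
  by apply/subdiffE => y; rewrite subrK; exact: conv_subgradient.
have key zeta : subdiff K x zeta -> sqn (zeta - (e - x)) + sqn (e - x) <= sqn zeta.
  move=> /subdiffE h; suff : sqn (e - x) <= dotp zeta (e - x).
    by have := sqnB zeta (e - x); lra.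
  have [r r0 rP] := opt_near x.
  pose s := r / (enorm (e - x) + 1) / 2.
  have n0 : 0 < enorm (e - x) + 1 by rewrite ltr_wpDl ?enorm_ge0.
  have s0 : 0 < s by rewrite !divr_gt0.
  (* The subgradient inequality is tested on a short step away from [e]. A point [k] optimal there
     is optimal at [x] too, and the obtuse angle at the projection [e] then gives
     [sqn (e - x) <= dotp zeta (e - x)]. *)
  have [k ky] := opt_nonempty (x - s *: (e - x)).
  have kx : k \in opt K x.
    apply: (rP _ _ _ ky); rewrite addrAC subrr add0r enormN enormZ ger0_norm ?ltW//.
    have := mulfVK (lt0r_neq0 n0) r; rewrite -/(r / _) => rE.
    have -> : s = (r / (enorm (e - x) + 1)) / 2 by [].
    by have := enorm_ge0 (e - x); nra.
  have := h (x - s *: (e - x)); rewrite -(opt_qK ky) (qKD k x) (opt_qK kx).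
  rewrite addrAC subrr add0r !dotpNr !dotpZr lerD2l lerN2 ler_pM2l//.
  have := eP _ (conv_opt kx); rewrite /sqn !dotpE (dotpC x e); lra.
rewrite /extgrad; case: xgetP => [xi _ [xis ximin]|/(_ (e - x))[]].
  have := ximin _ sub; rewrite enorm_le_sqn => h; have := key _ xis => h'.
  apply/eqP; rewrite -subr_eq0; apply/eqP/sqn_eq0/eqP; rewrite eq_le sqn_ge0 andbT; lra.
split=> // zeta /key; rewrite enorm_le_sqn.
by have := sqn_ge0 (zeta - (e - x)); lra.
Qed.

(** Every [k] in [opt K y] is optimal at both points, so [dotp k (x - y)] has the common value
    [gK x - gK y]. *)
Lemma conv_orthogonal x y z z' : {subset opt K y <= opt K x} ->
  conv (opt K y) z -> conv (opt K y) z' -> dotp (z - z') (x - y) = 0.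
Proof.
move=> yx.
have key w : conv (opt K y) w -> dotp w (x - y) = gK x - gK y.
  have h k : k \in opt K y -> dotp k (x - y) = gK x - gK y.
    move=> ky; have := qKD k y x; rewrite (opt_qK ky) (opt_qK (yx _ ky)); lra.
  move=> wy; apply/eqP; rewrite eq_le; apply/andP; split.
    by apply: conv_dotp_le wy => k /h ->.
  by apply: conv_dotp_ge wy => k /h ->.
by move=> /key zE /key zE'; rewrite dotpDl dotpNl zE zE' subrr.
Qed.

(** By orthogonality, moving the base point from [y] to [x] does not move the projection onto
    conv(opt(y)). *)
Lemma etaK_sub x y : {subset opt K y <= opt K x} -> is_proj (conv (opt K y)) x (etaK K y).
Proof.
move=> yx; split=> [|z zy]; first exact: etaK_conv.
have [ey eP] := etaK_proj y; have := eP _ zy.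
have := conv_orthogonal yx zy ey; rewrite !dotpE; lra.
Qed.

Lemma etaK_opt x y : opt K x = opt K y -> etaK K x = etaK K y.
Proof.
move=> xy; apply: (@is_proj_unique _ _ (conv (opt K x)) y); first by apply: etaK_sub; rewrite xy.
by rewrite xy; exact: etaK_proj.
Qed.

(** [eta] depends only on the optimality class, hence on one of finitely many Boolean masks of
    [K]. *)
Lemma etaK_range : exists E : seq V, forall x, etaK K x \in E.
Proof.
pose f (m : (size K).-tuple bool) : V := xget 0 [set e | exists2 x, opt K x = mask m K & e = etaK K x].
exists [seq f m | m : (size K).-tuple bool] => x.
apply/mapP; have st : size [seq enorm (x - k) == distK K x | k <- K] == size K by rewrite size_map.
exists (Tuple st); rewrite ?mem_enum// /f; case: xgetP => [e _ [y yE ->]|/(_ (etaK K x))[]]; last first.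
  by exists x => //; rewrite -filter_mask.
by apply: etaK_opt; rewrite yE -filter_mask.
Qed.

Lemma sqn_etaK_le x z : conv (opt K x) z -> sqn (x - etaK K x) <= sqn (x - z).
Proof.
move=> zx; have := is_proj_pythagoras (etaK_proj x) zx.
by have := sqn_ge0 (z - etaK K x); lra.
Qed.

Lemma sqn_etaK_le_pt x k : k \in K -> sqn (x - etaK K x) <= sqn (x - k).
Proof.
move=> kK; have [j jx] := opt_nonempty x.
rewrite (le_trans (sqn_etaK_le (conv_opt jx)))//.
by rewrite !sqn_qK (opt_qK jx); have := qK_le x kK; lra.
Qed.

End Opt.

(** * Absolutely continuous functions *)

Section Chains.
Variable R : realType.
Implicit Types (s t : seq (R * R)) (F : R -> R) (a b c : R).

(** Recursive form of the ordered families in [abs_cont], with [a] the last endpoint reached;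
    refinement and clamping become inductions. *)
Fixpoint chain a b s : bool :=
  if s is p :: s' then [&& a <= p.1, p.1 <= p.2 & chain p.2 b s'] else a <= b.

Lemma chain_le a b s : chain a b s -> a <= b.
Proof.
elim: s a => //= p s IHs a /and3P[ap pp /IHs pb].
by rewrite (le_trans ap)// (le_trans pp).
Qed.

Lemma chain_all a b s :
  chain a b s -> all (fun p => (a <= p.1) && (p.1 <= p.2) && (p.2 <= b)) s.
Proof.
suff h c : a <= c -> chain c b s -> all (fun p => (a <= p.1) && (p.1 <= p.2) && (p.2 <= b)) s by exact: h.
elim: s c => //= p s IHs c ac /and3P[cp pp ch].
rewrite (le_trans ac cp) pp (chain_le ch)/= (IHs p.2)//.
by rewrite (le_trans _ pp)// (le_trans ac).
Qed.

Lemma chain_sorted a b s : chain a b s -> sorted (fun p q => p.2 <= q.1) s.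
Proof.
case: s => //= p s /and3P[_ _]; elim: s p => //= q s IHs p /and3P[pq qq /IHs ->].
by rewrite pq.
Qed.

Lemma chain_pairwise a b s : a <= b ->
  all (fun p => (a <= p.1) && (p.1 <= p.2) && (p.2 <= b)) s ->
  pairwise (fun p q => p.2 <= q.1) s -> chain a b s.
Proof.
elim: s a => //= p s IHs a ab /andP[/andP[/andP[ap pp] pb] sa] /andP[ps pws].
rewrite ap pp/= IHs//; apply/allP => q qs.
by move/allP: sa => /(_ q qs)/andP[/andP[_ ->] ->]; rewrite !andbT; move/allP: ps => /(_ q qs).
Qed.

Lemma chain_disjoint a b s : a <= b -> uniq s ->
  all (fun p => (a <= p.1) && (p.1 < p.2) && (p.2 <= b)) s ->
  (forall p q, p \in s -> q \in s -> p != q -> p.2 <= q.1 \/ q.2 <= p.1) ->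
  exists2 t, perm_eq t s & chain a b t.
Proof.
move=> ab us sa dis.
pose leT (p q : R * R) := p.1 <= q.1.
exists (sort leT s); first by rewrite perm_sort.
have ms : sort leT s =i s by exact: mem_sort.
apply: chain_pairwise => //.
  apply/allP => p; rewrite ms => ps; move/allP: sa => /(_ p ps)/andP[/andP[-> /ltW ->] ->] //.
have lt_tr : transitive leT by move=> y x z; exact: le_trans.
have h1 : pairwise leT (sort leT s).
  by rewrite -sorted_pairwise// sort_sorted// => x y; exact: le_total.
have h2 : pairwise (fun p q => p != q) (sort leT s) by rewrite -uniq_pairwise sort_uniq.
apply: (sub_in_pairwise (P := mem s) (r := fun p q => leT p q && (p != q))).
- move=> p q ps qs /andP[pq nq].
  have [//|h] := dis p q ps qs nq.
  move/allP: sa => sa; have /andP[/andP[_ p2] _] := sa _ ps; have /andP[/andP[_ q2] _] := sa _ qs.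
  by move: pq; rewrite /leT; lra.
- by apply/allP => p; rewrite ms.
- by rewrite pairwise_relI h1.
Qed.

Definition steps a (l : seq R) := zip (a :: l) l.

Lemma variation_steps a b F l : itv_partition a b l ->
  variation a b F l = \sum_(p <- steps a l) `|F p.2 - F p.1|.
Proof.
move=> /variation_zip ->; rewrite /steps.
elim: l a => [|h t IHt] a; first by rewrite /= !big_nil.
by rewrite /= !big_cons/= -IHt.
Qed.

Lemma chain_steps a b c l s : itv_partition a b l -> chain b c s -> chain a c (steps a l ++ s).
Proof.
move=> [al /eqP lb]; elim: l a al lb => [a _ /= -> //|h t IHt a /= /andP[ah ht] lb ch].
by rewrite lexx (ltW ah)/= IHt.
Qed.

Lemma chain_subst a b t s s' (p : R * R) :
  (forall c, chain c b (p :: s) -> chain c b s') ->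
  chain a b (t ++ p :: s) -> chain a b (t ++ s').
Proof.
move=> h; elim: t a => [|q t IHt] a; first exact: h.
by rewrite /= => /and3P[-> -> /IHt ->].
Qed.

Lemma chain_widen a a' b s : a' <= a -> chain a b s -> chain a' b s.
Proof.
by case: s => [|p s] /= aa; [exact: le_trans|move=> /and3P[/(le_trans aa) -> -> ->]].
Qed.

Lemma steps_length a b l : itv_partition a b l ->
  \sum_(p <- steps a l) (p.2 - p.1) = b - a.
Proof.
move=> [al /eqP lb]; elim: l a al lb => [a _ /= ->|h t IHt a /= /andP[ah ht] lb].
  by rewrite big_nil subrr.
by rewrite /steps/= big_cons/= -/(steps h t) IHt//; ring.
Qed.

Definition abs_contR a b F := forall e : R, 0 < e -> exists2 eta : R, 0 < eta &
  forall s, chain a b s -> \sum_(p <- s) (p.2 - p.1) < eta ->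
    \sum_(p <- s) `|F p.2 - F p.1| < e.

Local Notation TV := total_variation.

(** Intervals of [s] are replaced one at a time by arbitrary partitions of themselves, and [t]
    collects the pieces. The total length does not change, so the bound survives and the supremum
    over partitions may be taken. *)
Lemma variation_bound_TV a b F (e eta : R) :
  (forall s, chain a b s -> \sum_(p <- s) (p.2 - p.1) < eta ->
    \sum_(p <- s) `|F p.2 - F p.1| < e) ->
  forall s t, chain a b (t ++ s) -> \sum_(p <- t ++ s) (p.2 - p.1) < eta ->
   ((\sum_(p <- t) `|F p.2 - F p.1|)%:E + \sum_(p <- s) TV p.1 p.2 F <= e%:E)%E.
Proof.
move=> h; elim=> [|p s IHs] t.
  by rewrite cats0 big_nil adde0 lee_fin => ct /(h _ ct)/ltW.
move=> ch len; rewrite big_cons.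
have ps : p.1 <= p.2 by move/chain_all/allP: ch => /(_ p); rewrite mem_cat inE eqxx orbT => /(_ isT)/andP[/andP[]].
have B0 : (0 <= \sum_(q <- s) TV q.1 q.2 F)%E.
  rewrite big_seq; apply: sume_ge0 => q qs; apply: total_variation_ge0.
  move/chain_all/allP: ch => /(_ q); rewrite mem_cat inE qs !orbT => /(_ isT).
  by move=> /andP[/andP[]].
set A := \sum_(q <- t) _; set B := (\sum_(q <- s) _)%E in B0 *.
have Bfin : B \is a fin_num.
  have := IHs (t ++ [:: p]); rewrite -catA => /(_ ch len) hB.
  rewrite ge0_fin_numE//; apply: le_lt_trans (ltry e); apply: le_trans hB.
  by rewrite leeDr// lee_fin sumr_ge0.
suff : (TV p.1 p.2 F <= (e - A - fine B)%:E)%E.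
  move=> hT; rewrite -(fineK Bfin).
  apply: (@le_trans _ _ (A%:E + ((e - A - fine B)%:E + (fine B)%:E))%E).
    by rewrite leeD2l// leeD2r.
  by rewrite -!EFinD lee_fin; lra.
apply: ge_ereal_sup => _ [_ [l lp <-] <-]; rewrite lee_fin (variation_steps _ lp).
have := IHs (t ++ steps p.1 l); rewrite -catA.
have -> : \sum_(i <- t ++ steps p.1 l ++ s) (i.2 - i.1) = \sum_(i <- t ++ p :: s) (i.2 - i.1).
  by rewrite !big_cat/= big_cons (steps_length lp).
have cl c : chain c b (p :: s) -> chain c b (steps p.1 l ++ s).
  move=> /= /and3P[cp _ hs]; apply: (chain_widen cp); exact: chain_steps lp hs.
move=> /(_ (chain_subst cl ch) len).
by rewrite big_cat/= -/A -/B -(fineK Bfin) -EFinD lee_fin; lra.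
Qed.

Lemma abs_contR_TV_fin a b F x : a < b -> abs_contR a b F -> a <= x <= b ->
  TV a x F \is a fin_num.
Proof.
move=> ab /(_ _ ltr01)[eta eta0 h] /andP[ax xb].
(* Steps of length [eta / 2] stay strictly below [eta], and on each of them the total variation is
   at most 1. *)
have key n y : a <= y <= b -> y <= a + n%:R * (eta / 2) -> TV a y F \is a fin_num.
  elim: n y => [|n IHn] y /andP[ay yb] yn.
    have -> : y = a by apply/eqP; rewrite eq_le ay andbT; move: yn; rewrite mul0r addr0.
    by rewrite total_variationxx.
  pose z := Num.max a (y - eta / 2).
  have az : a <= z by rewrite le_max lexx.
  have zy : z <= y by rewrite ge_max ay gerBl divr_ge0// ltW.
  rewrite (total_variationD F az zy) fin_numD IHn; last first.
  - rewrite ge_max; apply/andP; split; first by rewrite lerDl mulr_ge0 ?ler0n// divr_ge0// ltW.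
    by move: yn; rewrite -natr1; lra.
  - by rewrite az (le_trans zy).
  rewrite /= ge0_fin_numE ?total_variation_ge0//.
  have := @variation_bound_TV a b F 1 eta h [:: (z, y)] [::].
  rewrite /= az zy yb !big_seq1/= => /(_ isT).
  have zy2 : y - z < eta by rewrite /z; case: (leP a (y - eta / 2)) => ?; lra.
  by rewrite big_nil add0e => /(_ zy2)/le_lt_trans; apply; rewrite ltry.
have [n nP] : exists n : nat, (x - a) / (eta / 2) <= n%:R.
  exists (Num.bound ((x - a) / (eta / 2))).
  by rewrite ltW// archi_boundP// divr_ge0 ?subr_ge0// divr_ge0// ltW.
apply: (key n); first by rewrite ax.
by move: nP; rewrite ler_pdivrMr ?divr_gt0//; lra.
Qed.

(** Jordan decomposition with [G] the total variation from [a]; [variation_bound_TV] makes [G]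
    absolutely continuous. *)
Lemma abs_contR_decomp a b F : a < b -> abs_contR a b F -> exists G : R -> R,
  [/\ abs_contR a b G, {in `[a, b] &, {homo G : x y / x <= y}},
      abs_contR a b (G \- F) & {in `[a, b] &, {homo (G \- F) : x y / x <= y}}].
Proof.
move=> ab F_ac; pose G x := fine (TV a x F).
have Gfin x : x \in `[a, b] -> TV a x F \is a fin_num.
  by rewrite in_itv/=; exact: abs_contR_TV_fin.
have GD x y : x \in `[a, b] -> y \in `[a, b] -> x <= y -> TV x y F \is a fin_num /\
    G y - G x = fine (TV x y F).
  move=> xab yab xy; have := Gfin _ yab; have xf := Gfin _ xab.
  move: xab yab; rewrite !in_itv/= => /andP[ax xb] /andP[ay yb].
  rewrite /G (total_variationD F ax xy) fin_numD xf/= => yf; split => //.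
  by rewrite fineD//; ring.
have GF x y : x \in `[a, b] -> y \in `[a, b] -> x <= y -> `|F y - F x| <= G y - G x.
  move=> xab yab xy; have [f ->] := GD x y xab yab xy.
  by rewrite -lee_fin fineK// total_variation_ge.
have in_chain s p : chain a b s -> p \in s -> [/\ p.1 \in `[a, b], p.2 \in `[a, b] & p.1 <= p.2].
  move=> /chain_all/allP/[apply] /andP[/andP[ap pp] pb].
  by rewrite !in_itv/= ap pb (le_trans pp pb) (le_trans ap pp).
have Gac : abs_contR a b G.
  move=> e e0; have [|eta eta0 h] := F_ac (e / 2); first by rewrite divr_gt0.
  exists eta => // s cs len.
  have := @variation_bound_TV a b F _ eta h s [::] cs len.
  rewrite big_nil add0e => hs.
  suff : \sum_(p <- s) `|G p.2 - G p.1| <= e / 2 by lra.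
  rewrite -lee_fin (le_trans _ hs)// -sumEFin big_seq [leRHS]big_seq.
  apply: lee_sum => p ps; have [p1 p2 pp] := in_chain _ _ cs ps.
  have [f ->] := GD _ _ p1 p2 pp.
  by rewrite ger0_norm ?fineK// fine_ge0// total_variation_ge0.
exists G; split => //.
- by move=> x y xab yab xy; have := GF x y xab yab xy; have := normr_ge0 (F y - F x); lra.
- move=> e e0; have [|eta eta0 h] := F_ac (e / 2); first by rewrite divr_gt0.
  have [|eta' eta'0 h'] := Gac (e / 2); first by rewrite divr_gt0.
  exists (Num.min eta eta') => [|s cs]; first by rewrite lt_min eta0.
  rewrite lt_min => /andP[/(h _ cs) hF /(h' _ cs) hG].
  suff : \sum_(p <- s) `|(G \- F) p.2 - (G \- F) p.1| <=
    \sum_(p <- s) `|F p.2 - F p.1| + \sum_(p <- s) `|G p.2 - G p.1| by lra.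
  rewrite -big_split/=; apply: ler_sum => p _.
  rewrite (_ : _ - _ - _ = (G p.2 - G p.1) - (F p.2 - F p.1)); last by ring.
  by rewrite addrC ler_normB.
- move=> x y xab yab xy /=; have := GF x y xab yab xy; rewrite ler_norml => /andP[_]; lra.
Qed.

End Chains.

(** * Components of bounded open sets, as ordered intervals *)

Section OpenIntervals.
Variable R : realType.
Implicit Types (I J : set R) (x y u v : R).

Lemma open_interval_bounds I lo hi : open I -> is_interval I -> I !=set0 -> I `<=` `]lo, hi[ ->
  [/\ lo <= inf I, inf I < sup I, sup I <= hi, I `<=` `]inf I, sup I] & `]inf I, sup I[ `<=` I].
Proof.
move=> oI iI [x0 Ix0] Ilh.
have bnd x : I x -> lo < x /\ x < hi by move=> /Ilh /=; rewrite in_itv/= => /andP.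
have hs : has_sup I by split; [exists x0|exists hi => x /bnd[_ /ltW]].
have hi' : has_inf I by split; [exists x0|exists lo => x /bnd[/ltW]].
have lows x : I x -> inf I < x.
  move=> Ix; have [e /= e0 eI] := (nbhs_ballP _ _).1 (oI _ Ix).
  have /(inf_lbound (proj2 hi')) h : I (x - e / 2).
    apply: eI; rewrite -ball_normE /= opprB addrC subrK ger0_norm ?divr_ge0 ?ltW//.
    by move: e0; lra.
  by rewrite (le_lt_trans h)// gtrBl divr_gt0.
have ups x : I x -> x <= sup I by move=> Ix; exact: sup_upper_bound.
split.
- by apply: lb_le_inf; [exists x0|move=> x /bnd[/ltW]].
- by apply: lt_le_trans (ups _ Ix0); exact: lows.
- by apply: ge_sup; [exists x0|move=> x /bnd[_ /ltW]].
- by move=> x Ix /=; rewrite in_itv/= lows// ups.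
- move=> x /=; rewrite in_itv/= => /andP[ix xs].
  have [y Iy yx] := inf_lt (proj1 hi') ix; have [z Iz xz] := sup_gt (proj1 hs) xs.
  by apply: (iI y z) => //; rewrite (ltW yx) (ltW xz).
Qed.

Lemma disjoint_intervals_bounds I J lo hi : is_interval I -> is_interval J ->
  I !=set0 -> J !=set0 -> I `<=` `]lo, hi[ -> J `<=` `]lo, hi[ -> I `&` J = set0 ->
  sup I <= inf J \/ sup J <= inf I.
Proof.
suff key I' J' x y : is_interval I' -> is_interval J' -> I' `<=` `]lo, hi[ -> J' `<=` `]lo, hi[ ->
    I' `&` J' = set0 -> I' x -> J' y -> x < y -> sup I' <= inf J'.
  move=> iI iJ [x Ix] [y Jy] Il Jl IJ.
  case: (ltgtP x y) => [xy|yx|xy]; first by left; exact: key xy.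
    by right; apply: key yx => //; rewrite setIC.
  have : (I `&` J) x by split => //; rewrite xy.
  by rewrite IJ.
move=> iI iJ Il Jl IJ Ix Jy xy; rewrite leNgt; apply/negP => h.
have bI z : I' z -> lo < z /\ z < hi by move=> /Il /=; rewrite in_itv/= => /andP.
have bJ z : J' z -> lo < z /\ z < hi by move=> /Jl /=; rewrite in_itv/= => /andP.
have hsI : has_sup I' by split; [exists x|exists hi => z /bI[_ /ltW]].
have hiJ : has_inf J' by split; [exists y|exists lo => z /bJ[/ltW]].
have [x' Ix' hx'] := sup_gt (proj1 hsI) h.
have [y' Jy' yx'] := inf_lt (proj1 hiJ) hx'.
have [xy'|yx] := leP x y'.
  have : (I' `&` J') y' by split => //; apply: (iI x x') => //; rewrite xy' ltW.
  by rewrite IJ.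
have : (I' `&` J') x by split => //; apply: (iJ y' y) => //; rewrite !ltW.
by rewrite IJ.
Qed.

End OpenIntervals.

(** * Density of a nondecreasing absolutely continuous function *)

Section Monotone.
Variables (R : realType) (a b : R) (G : R -> R).
Hypotheses (ab : a < b) (Gac : abs_contR a b G)
  (Gnd : {in `[a, b] &, {homo G : x y / x <= y}}).
Notation mu := (@lebesgue_measure R).

(** Clamping extends [G] to the whole line by constants, so that it defines a Stieltjes measure with
    no mass outside [[a, b]]. *)
Let cl (t : R) : R := Num.max a (Num.min b t).
Let Gc t := G (cl t).

Let cl_in t : cl t \in `[a, b].
Proof. by rewrite in_itv/= le_max lexx ge_max (ltW ab) ge_min lexx. Qed.

Let cl_mono x y : x <= y -> cl x <= cl y.
Proof. by move=> xy; rewrite /cl ge_max !le_max lexx/= le_min !ge_min lexx xy !orbT. Qed.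

Let cl_lip x y : x <= y -> cl y - cl x <= y - x.
Proof.
move=> xy; rewrite /cl; case: (leP b x) => bx; case: (leP b y) => yb; try lra.
- by case: (leP a x) => ax; case: (leP a b) => aab; move: ab; lra.
- by case: (leP a x) => ax; case: (leP a y) => ay; lra.
Qed.

Let cl_id x : a <= x <= b -> cl x = x.
Proof. by move=> /andP[ax xb]; rewrite /cl (min_idPr xb) (max_idPr ax). Qed.

Let Gc_nd : {homo Gc : x y / x <= y}.
Proof. by move=> x y xy; apply: Gnd; rewrite ?cl_in ?cl_mono. Qed.

Let Gc_cont : continuous Gc.
Proof.
move=> x; apply/(@cvgrPdist_lt _ R _ _ (nbhs_filter x)) => e e0.
have [eta eta0 h] := Gac e0.
have key y z : y <= z -> z - y < eta -> `|Gc z - Gc y| < e.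
  move=> yz zy; have := h [:: (cl y, cl z)].
  rewrite !big_seq1/=; apply; last by rewrite (le_lt_trans (cl_lip yz)).
  rewrite /= cl_mono//.
  by have := cl_in y; have := cl_in z; rewrite !in_itv/= => /andP[_ ->] /andP[->].
apply/nbhs_ballP; exists eta => // y; rewrite -ball_normE/=.
case: (leP x y) => xy.
  by rewrite distrC ger0_norm ?subr_ge0// => ?; rewrite distrC key.
by rewrite ger0_norm ?subr_ge0 ?ltW// => ?; rewrite key// ltW.
Qed.

Let Gc_rc : right_continuous Gc.
Proof. by move=> x; apply: cvg_at_right_filter; exact: Gc_cont. Qed.

HB.instance Definition _ := isCumulative.Build R _ R Gc Gc_nd Gc_rc.

Let nu : {measure set _ -> \bar R} := lebesgue_stieltjes_measure Gc.

Let nu_itv u v : u <= v -> nu (`]u, v]%classic) = (Gc v - Gc u)%:E.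
Proof.
move=> uv; rewrite /nu/= /lebesgue_stieltjes_measure/= /measure_extension.
rewrite measurable_mu_extE/=; last exact: is_ocitv.
rewrite wlength_itv/= lte_fin; case: ltP => //= vu.
have -> : u = v by apply/eqP; rewrite eq_le uv.
by rewrite subrr.
Qed.

(** An open set is a countable disjoint union of intervals. Finitely many of them, sorted and
    clamped, form a chain of length below [eta], on which absolute continuity bounds the Stieltjes
    mass; the bound passes to the limit. *)
Let nu_open (e eta : R) U : 0 < e ->
  (forall s, chain a b s -> \sum_(p <- s) (p.2 - p.1) < eta ->
    \sum_(p <- s) `|G p.2 - G p.1| < e) ->
  open U -> U `<=` `]a, b + 1[ -> (mu U < eta%:E)%E -> (nu U <= e%:E)%E.
Proof.
move=> e0 h oU Uab muU.
pose I := open_disjoint_itv oU.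
have Io i : open (I i) by exact: open_disjoint_itv_open.
have Ii i : is_interval (I i) by exact: open_disjoint_itv_is_interval.
have It : trivIset setT I by exact: open_disjoint_itv_trivIset.
have IU : U = \bigcup_i I i by exact: open_disjoint_itv_bigcup.
have Ib i : I i `<=` `]a, b + 1[ by move=> x Ix; apply: Uab; rewrite IU; exists i.
have Im i : measurable (I i) by exact: measurable_realfun.open_measurable.
rewrite IU measure_semi_bigcup//; last by apply: bigcup_measurable => i _; exact: Im.
apply: lime_le; first by apply: is_cvg_nneseries => i _ _; exact: measure_ge0.
apply: nearW => n.
pose J := [seq i <- iota 0 n | I i != set0].
have J0 i : i \in J -> I i !=set0 by rewrite mem_filter => /andP[/set0P].
have bnd i (iJ : i \in J) := open_interval_bounds (Io i) (Ii i) (J0 i iJ) (Ib i).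
have dis i j : i \in J -> j \in J -> i != j -> sup (I i) <= inf (I j) \/ sup (I j) <= inf (I i).
  move=> iJ jJ ij; apply: (disjoint_intervals_bounds (Ii i) (Ii j) (J0 i iJ) (J0 j jJ) (Ib i) (Ib j)).
  by have /trivIsetP := It; exact.
pose f i := (inf (I i), sup (I i)).
have ab1 : a <= b + 1 by rewrite ler_wpDr// ltW.
have [|||p q|t ts ch] := @chain_disjoint R a (b + 1) [seq f i | i <- J].
- exact: ab1.
- rewrite map_inj_in_uniq ?filter_uniq ?iota_uniq// => i j iJ jJ [eqi eqs].
  apply/eqP/negPn/negP => ij; have [_ l1 _ _ _] := bnd i iJ; have [_ l2 _ _ _] := bnd j jJ.
  case: (dis i j iJ jJ ij) => hij.
    by have := lt_le_trans l1 hij; rewrite eqi ltxx.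
  by have := lt_le_trans l2 hij; rewrite eqi ltxx.
- apply/allP => _ /mapP[i iJ ->]/=.
  by have [-> -> -> _ _] := bnd i iJ.
- move=> /mapP[i iJ ->] /mapP[j jJ ->] ij; apply: dis => //.
  by apply: contra ij => /eqP ->.
have sumE (F : R * R -> R) : \sum_(p <- t) F p = \sum_(i <- J) F (f i).
  by rewrite (perm_big _ ts)/= big_map.
have chcl s c : chain c (b + 1) s -> chain (cl c) b [seq (cl p.1, cl p.2) | p <- s].
  elim: s c => [|p s IHs] c /=; first by have := cl_in c; rewrite in_itv/= => /andP[_ ->].
  by move=> /and3P[cp pp /IHs ->]; rewrite !cl_mono.
have len : \sum_(p <- t) (p.2 - p.1) < eta.
  rewrite -lte_fin; apply: le_lt_trans muU.
  rewrite sumE -sumEFin.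
  apply: (@le_trans _ _ (\sum_(i <- iota 0 n) mu (I i))%E).
    rewrite big_filter big_mkcond/=; apply: lee_sum => i _.
    case: ifPn => [Ii0|_]; last exact: measure_ge0.
    have [_ uv _ _ sub] : [/\ a <= inf (I i), inf (I i) < sup (I i), sup (I i) <= b + 1,
       I i `<=` `]inf (I i), sup (I i)] & `]inf (I i), sup (I i)[ `<=` I i].
      by apply: open_interval_bounds => //; exact/set0P.
    have : (mu `]inf (I i), sup (I i)[ <= mu (I i))%E.
      by apply: le_measure => //; rewrite inE; [exact: measurable_itv|exact: Im].
    by rewrite lebesgue_measure_itv/= lte_fin uv.
  rewrite [in leRHS]IU measure_semi_bigcup//; last by apply: bigcup_measurable => i _; exact: Im.
  have := @nneseries_lim_ge R (mu \o I) xpredT 0 n.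
  by rewrite /index_iota subn0; apply=> i _ _; exact: measure_ge0.
have clch := chcl _ _ ch; rewrite cl_id ?lexx ?(ltW ab)// in clch.
have hG : \sum_(p <- [seq (cl p.1, cl p.2) | p <- t]) `|G p.2 - G p.1| < e.
  apply: h => //; rewrite big_map.
  apply: le_lt_trans len; rewrite big_seq [leRHS]big_seq; apply: ler_sum => p pt.
  by apply: cl_lip; move/chain_all/allP: ch => /(_ p pt)/andP[/andP[]].
rewrite big_map sumE/= in hG.
apply: (@le_trans _ _ (\sum_(i <- J) `|Gc (sup (I i)) - Gc (inf (I i))|)%:E); last first.
  by rewrite lee_fin ltW.
rewrite -sumEFin big_filter [leRHS]big_mkcond/= /index_iota subn0; apply: lee_sum => i _.
case: ifPn => [Ii0|/negPn/eqP ->]; last by rewrite measure0.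
have [_ uv _ sub _] : [/\ a <= inf (I i), inf (I i) < sup (I i), sup (I i) <= b + 1,
   I i `<=` `]inf (I i), sup (I i)] & `]inf (I i), sup (I i)[ `<=` I i].
  by apply: open_interval_bounds => //; exact/set0P.
rewrite ger0_norm ?subr_ge0 ?Gc_nd ?(ltW uv)// -nu_itv ?(ltW uv)//.
by apply: le_measure => //; rewrite inE; [exact: Im|exact: measurable_itv].
Qed.

Let nu_dom A : measurable A -> mu A = 0%E -> nu (A `&` `]a, b]) = 0%E.
Proof.
move=> mA A0; apply/eqP; rewrite eq_le measure_ge0 andbT.
apply/lee_addgt0Pr => e e0; rewrite add0e.
have [eta eta0 h] := Gac e0.
have mD : measurable (A `&` `]a, b] : set R) by apply: measurableI => //; exact: measurable_itv.
have D0 : mu (A `&` `]a, b]) = 0%E.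
  by apply: subset_measure0 A0 => //; exact: subIsetl.
have [|U [oU DU muU]] := @lebesgue_regularity_outer R (A `&` `]a, b]) eta mD _ eta0.
  by rewrite [ltLHS](_ : _ = 0%E) ?ltry//; exact: D0.
(* The open cover has to contain [b], hence the margin beyond it; [Gc] is constant there. *)
pose U' := U `&` `]a, b + 1[%classic.
have oU' : open U' by apply: openI => //; exact: interval_open.
have mU : measurable U by exact: measurable_realfun.open_measurable.
have mU' : measurable U' by exact: measurable_realfun.open_measurable.
have DU' : A `&` `]a, b] `<=` U'.
  move=> x Ax; split; first exact: DU.
  by case: Ax => _ /=; rewrite !in_itv/= => /andP[-> xb]; rewrite (le_lt_trans xb)// ltrDl.
apply: (@le_trans _ _ (nu U')); first by apply: le_measure => //; rewrite inE.
apply: (nu_open e0 h oU'); first by move=> x [].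
apply: le_lt_trans muU.
apply: (@le_trans _ _ (mu (U `\` (A `&` `]a, b]) `|` (A `&` `]a, b])))).
  apply: le_measure; rewrite ?inE//; first by apply: measurableU => //; exact: measurableD.
  by move=> x [Ux _]; have [?|?] := pselect ((A `&` `]a, b]) x); [right|left].
apply: (@le_trans _ _ (mu (U `\` (A `&` `]a, b])) + mu (A `&` `]a, b]))%E).
  by apply: measureU2 => //; exact: measurableD.
by rewrite [X in (_ + X)%E](_ : _ = 0%E) ?adde0//; exact: D0.
Qed.

(** By [nu_dom] the Stieltjes measure restricted to []a, b]] is dominated by Lebesgue measure; [f]
    is its Radon-Nikodym derivative. *)
Lemma monotone_density : exists f : R -> R,
  mu.-integrable setT (EFin \o f) /\
  forall x, a <= x <= b -> G x = G a + \int[mu]_(t in `]a, x]) f t.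
Proof.
have mab : measurable (`]a, b]%classic : set (measurableTypeR R)) by exact: measurable_itv.
have nab : (nu `]a, b]%classic < +oo)%E by rewrite nu_itv ?ltry// ltW.
pose m : {finite_measure set (measurableTypeR R) -> \bar R} := mfrestr mab nab.
have dom : m `<< mu.
  by apply/null_content_dominatesP => A mA A0; exact: nu_dom.
have [f [f0 ffin fint fE]] := radon_nikodym_sigma_finite dom.
have fineE : f = EFin \o (fine \o f) by apply/funext => x /=; rewrite fineK.
exists (fine \o f); split; first by rewrite -fineE.
move=> x /andP[ax xb]; rewrite /Rintegral -/(EFin \o (fine \o f)) -fineE -fE; last first.
  exact: measurable_itv.
rewrite /m /= /mfrestr/= /mrestr setIidl; last first.
  by move=> y /=; rewrite !in_itv/= => /andP[-> /le_trans]; apply.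
by rewrite nu_itv//= /Gc !cl_id ?ax ?lexx ?(ltW ab)// addrC subrK.
Qed.

End Monotone.

Section Density.
Variables (R : realType) (a b : R) (F : R -> R).
Notation mu := (@lebesgue_measure R).

(** The densities of the two monotone parts are subtracted, and Lebesgue differentiation of the
    indefinite integral gives the derivative almost everywhere. *)
Theorem abs_contR_density : a < b -> abs_contR a b F -> exists f : R -> R,
  [/\ mu.-integrable setT (EFin \o f),
      forall x, a <= x <= b -> F x = F a + \int[mu]_(t in `]a, x]) f t &
      {ae mu, forall x, a < x < b -> is_derive x 1 F (f x)}].
Proof.
move=> ab /(abs_contR_decomp ab)[G [Gac Gnd Hac Hnd]].
have [f1 [i1 E1]] := monotone_density ab Gac Gnd.
have [f2 [i2 E2]] := monotone_density ab Hac Hnd.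
have intf : mu.-integrable setT (EFin \o (f1 \- f2)).
  rewrite (_ : _ \o _ = (EFin \o f1) \- (EFin \o f2))%E; first exact: integrableB.
  by apply/funext => x /=; rewrite EFinB.
have sub A (f : R -> R) : measurable A -> mu.-integrable setT (EFin \o f) -> mu.-integrable A (EFin \o f).
  by move=> mA fi; apply: integrableS fi.
have FE x : a <= x <= b -> F x = F a + \int[mu]_(t in `]a, x]) (f1 \- f2) t.
  move=> xab; have := E1 x xab; have := E2 x xab => /=.
  rewrite RintegralB//; last 2 first.
  - by apply: sub => //; exact: measurable_itv.
  - by apply: sub => //; exact: measurable_itv.
  - by lra.
exists (f1 \- f2); split => //.
have := @FTC1 R (f1 \- f2) (BRight a).
move=> /(_ _ _)/wrap[].
- by move=> y; apply: sub => //; exact: measurable_itv.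
- by apply: open_integrable_locally => //; exact: openT.
apply: filterS; first exact: (ae_filter_ringOfSetsType mu).
move=> x hx /andP[ax xb].
have /hx[dI <-] : (BRight a < BRight x)%O by rewrite bnd_simp.
rewrite derive1E -[X in is_derive _ _ _ X]add0r.
apply: (@near_eq_is_derive _ _ _ (cst (F a) + (fun y => \int[mu]_(t in `]a, y]) (f1 \- f2) t))).
  near=> y; rewrite [RHS]FE//; apply/andP; split; apply/ltW; near: y.
    exact: lt_nbhsr.
  exact: lt_nbhsl.
by apply: is_deriveD; exact: derivableP.
Unshelve. all: by end_near. Qed.

End Density.

(** * The potential *)

Section PotentialShape.
Variables (R : realType) (h h' : R -> R).
Hypotheses (hP : potential_shape h h') (hmono : forall s t : R, 0 <= s -> s < t -> h s < h t).

Implicit Types (s t e B : R).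

Lemma shape_ge0 t : 0 <= t -> 0 <= h t. Proof. by case: hP => + _; exact. Qed.

Lemma shape_le s t : 0 <= s -> s <= t -> h s <= h t.
Proof. by move=> s0; rewrite le_eqVlt => /orP[/eqP -> //|/(hmono s0)/ltW]. Qed.

Lemma shape_quotient t e : 0 <= t -> 0 < e -> exists2 r, 0 < r &
  forall s, s != 0 -> 0 <= t + s -> `|s| < r -> `|h' t - s^-1 * (h (t + s) - h t)| < e.
Proof.
move=> t0 e0; have [_ [_ /(_ t t0) /cvgrPdist_lt/(_ e e0)]] := hP.
rewrite near_withinE => /nbhs_ballP[r /= r0 rP]; exists r => // s s0 ts sr.
by apply: rP => //; rewrite /ball/= sub0r normrN.
Qed.

Lemma shape_is_derive t : 0 < t -> is_derive t 1 h (h' t).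
Proof.
move=> t0; have cv : (fun s => s^-1 *: (h (s *: 1 + t) - h t)) @ 0^' --> h' t.
  apply/cvgrPdist_lt => e e0; have [r r0 rP] := shape_quotient (ltW t0) e0.
  near=> s; rewrite [s *: 1](_ : _ = s); last by rewrite /GRing.scale/= mulr1.
  rewrite [s + t]addrC; apply: rP.
  - by near: s; exact: nbhs_dnbhs_neq.
  - have : `|s| < t by near: s; exact: dnbhs0_lt.
    by rewrite ltr_norml => /andP[]; lra.
  - by near: s; exact: dnbhs0_lt.
apply: DeriveDef; first by apply/cvg_ex; exists (h' t).
by apply/cvg_lim => //.
Unshelve. all: by end_near. Qed.

Lemma shape_cont t e : 0 <= t -> 0 < e -> exists2 r, 0 < r &
  forall s, 0 <= s -> `|s - t| < r -> `|h s - h t| < e.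
Proof.
move=> t0 e0; have [r r0 rP] := shape_quotient t0 ltr01.
have n0 : 0 < `|h' t| + 1 by rewrite ltr_wpDl.
exists (Num.min r (e / (`|h' t| + 1))) => [|s s0]; first by rewrite lt_min r0 divr_gt0.
rewrite lt_min => /andP[sr]; rewrite ltr_pdivlMr// => se.
have [->|st] := eqVneq s t; first by rewrite subrr normr0.
have st0 : s - t != 0 by rewrite subr_eq0.
have := rP (s - t) st0; rewrite addrC subrK => /(_ s0 sr) hh.
apply: le_lt_trans se; rewrite -[h s - h t](mulVKf st0) normrM ler_wpM2l//.
set q := _ * (h s - h t) in hh *.
rewrite -[q](subKr (h' t)) (le_trans (ler_normB _ _))// lerD2l.
exact: ltW.
Qed.

Lemma shape_within s t : 0 <= s -> {within `[s, t], continuous h}.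
Proof.
move=> s0; apply/subspace_continuousP => x /=; rewrite in_itv/= => /andP[sx xt].
apply/cvgrPdist_lt => e e0; have [r r0 rP] := shape_cont (le_trans s0 sx) e0.
rewrite near_withinE; apply/nbhs_ballP; exists r => // y; rewrite /ball/= => xy.
by rewrite in_itv/= => /andP[sy _]; rewrite distrC rP// ?(le_trans s0)// distrC.
Qed.

Lemma shape_MVT s t : 0 <= s -> s < t -> exists2 c, s < c < t & h t - h s = h' c * (t - s).
Proof.
move=> s0 st; have [||c] := @MVT R h h' s t st.
- move=> x; rewrite in_itv/= => /andP[sx _]; apply: shape_is_derive.
  exact: le_lt_trans sx.
- exact: shape_within.
- by rewrite in_itv/=; exists c.
Qed.

Lemma shape_deriv_ge0 t : 0 <= t -> 0 <= h' t.
Proof.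
move=> t0; rewrite leNgt; apply/negP => h0.
have [|r r0 rP] := @shape_quotient t (- h' t) t0; first by rewrite oppr_gt0.
have r2 : 0 < r / 2 by rewrite divr_gt0.
have := rP (r / 2) (lt0r_neq0 r2) (addr_ge0 t0 (ltW r2)).
rewrite [`|r / 2|]ger0_norm ?(ltW r2)//.
have -> : r / 2 < r by move: r0; lra.
move=> /(_ isT); rewrite ltr_norml => /andP[+ _].
have : 0 <= (r / 2)^-1 * (h (t + r / 2) - h t).
  by rewrite mulr_ge0 ?invr_ge0 ?(ltW r2)// subr_ge0 shape_le// lerDl ltW.
by move=> ? ?; lra.
Qed.

Lemma shape_deriv_cont t e : 0 <= t -> 0 < e -> exists2 r, 0 < r &
  forall s, 0 <= s -> `|s - t| < r -> `|h' s - h' t| < e.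
Proof.
move=> t0 e0; have [_ [/subspace_continuousP/(_ t) hc _]] := hP.
have /hc : [set` `[0, +oo[%R] t by rewrite /= in_itv/= t0.
move=> /cvgrPdist_lt/(_ e e0); rewrite near_withinE => /nbhs_ballP[r /= r0 rP].
exists r => // s s0 st; rewrite distrC; apply: rP.
  by rewrite /ball/= distrC.
by rewrite in_itv/= s0.
Qed.

Lemma shape_deriv_bound B : exists2 M, 0 < M & forall t, 0 <= t <= B -> `|h' t| <= M.
Proof.
have [B0|B0] := ltP B 0.
  by exists 1 => // t /andP[t0 tB]; have := lt_le_trans B0 (le_trans t0 tB); rewrite ltxx.
have hc : {within `[0, B], continuous h'}.
  have [_ [hc _]] := hP; apply: continuous_subspaceW hc => x /=.
  by rewrite !in_itv/= => /andP[-> _].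
have [c1 _ c1P] := EVT_max B0 hc; have [c2 _ c2P] := EVT_min B0 hc.
exists (`|h' c1| + `|h' c2| + 1) => [|t tB]; first by rewrite ltr_wpDl ?addr_ge0.
have tB' : t \in `[0, B] by rewrite in_itv.
have := c1P t tB'; have := c2P t tB'.
have := ler_norm (h' c1); have := ler_norm (- h' c2); rewrite normrN.
have := normr_ge0 (h' c1); have := normr_ge0 (h' c2).
by rewrite ler_norml => *; apply/andP; split; lra.
Qed.

(** Potentials are always compared through distances, so the useful function is p -> h(p^2): the
    mean value theorem for [h] and the factor p + q, at most [2 * B]. *)
Lemma shape_sq_lip B : 0 <= B -> exists2 M, 0 < M & forall p q, 0 <= p <= B -> 0 <= q <= B ->
  `|h (p ^+ 2) - h (q ^+ 2)| <= M * `|p - q|.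
Proof.
move=> B0; have [M M0 MP] := shape_deriv_bound (B ^+ 2).
exists (M * (2 * B + 1)); first by rewrite mulr_gt0//; lra.
suff key p q : 0 <= p <= B -> 0 <= q <= B -> p < q ->
    `|h (p ^+ 2) - h (q ^+ 2)| <= M * (2 * B + 1) * `|p - q|.
  move=> p q pB qB; case: (ltgtP p q) => [pq|qp|->]; first exact: key.
    by rewrite distrC [X in _ * X]distrC key.
  by rewrite !subrr normr0 mulr0.
move=> /andP[p0 pB] /andP[q0 qB] pq.
have pq2 : p ^+ 2 < q ^+ 2 by rewrite ltr_sqr ?nnegrE.
have [c /andP[pc cq] hE] := shape_MVT (sqr_ge0 p) pq2.
rewrite distrC hE normrM -mulrA; apply: ler_pM => //.
  apply: MP; apply/andP; split; first exact: le_trans (sqr_ge0 p) (ltW pc).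
  by apply: le_trans (ltW cq) _; rewrite ler_sqr ?nnegrE.
rewrite subr_sqr normrM [X in _ <= _ * X]distrC mulrC ler_wpM2r//.
by rewrite ger0_norm ?addr_ge0//; lra.
Qed.

End PotentialShape.

Section Potential.
Variables (R : realType) (d : nat) (K : seq 'rV[R]_d) (h h' : R -> R).
Hypotheses (K0 : K != [::]) (Ku : uniq K).
Hypotheses (hP : potential_shape h h') (hmono : forall s t : R, 0 <= s -> s < t -> h s < h t).
Notation V := 'rV[R]_d.
Implicit Types (x y z e : V).

Definition pot y : R := h (sqn (extgrad K y)).

Lemma potE y : pot y = h (enorm (y - etaK K y) ^+ 2).
Proof. by rewrite /pot (extgradE K0 Ku) sqnBC enorm_sqr. Qed.

Lemma pot_ge0 y : 0 <= pot y.
Proof. exact: (shape_ge0 hP) (sqn_ge0 _). Qed.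

Lemma pot_le_cell y e : cell K e y -> pot y <= h (enorm (y - e) ^+ 2).
Proof.
move=> ey; rewrite potE; apply: shape_le; rewrite ?sqr_ge0// !enorm_sqr.
exact: sqn_etaK_le.
Qed.

Lemma pot_le_pt y k : k \in K -> pot y <= h (enorm (y - k) ^+ 2).
Proof.
move=> kK; rewrite potE; apply: shape_le; rewrite ?sqr_ge0// !enorm_sqr.
exact: sqn_etaK_le_pt.
Qed.

Lemma etaK_near_ge x y : {subset opt K y <= opt K x} ->
  sqn (x - etaK K x) <= sqn (x - etaK K y).
Proof.
move=> yx; apply: sqn_etaK_le => //; apply: conv_mono yx _ _ => //; exact: etaK_conv.
Qed.

(** Near [x] the class shrinks, so [eta] of [y] is a point of conv(opt(x)) and is at least as far
    from [x] as [eta] of [x]. The potential may jump upwards away from [x], never downwards. *)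
Lemma pot_lsc x c : c < pot x -> exists2 r, 0 < r & forall y, enorm (y - x) < r -> c < pot y.
Proof.
rewrite potE; set p := enorm (x - etaK K x) => cp.
have p0 : 0 <= p by exact: enorm_ge0.
have [r r0 rP] := opt_near K0 x.
have [M M0 MP] := shape_sq_lip hP p0.
exists (Num.min r ((h (p ^+ 2) - c) / M)) => [|y]; first by rewrite lt_min r0 divr_gt0// subr_gt0.
rewrite lt_min => /andP[/rP yx]; rewrite ltr_pdivlMr// => yc.
have p1 : p <= enorm (x - etaK K y) by rewrite enorm_le_sqn etaK_near_ge.
have p2 := ler_enormB x y (etaK K y); rewrite (enormB x y) in p2.
(* [q] is [p] lowered by the displacement and clipped at 0, which keeps it in the range of the
   Lipschitz bound. *)
have [q [q0 qp pq qy]] : exists q, [/\ 0 <= q, q <= p, p - q <= enorm (y - x) & q <= enorm (y - etaK K y)].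
  exists (Num.max 0 (p - enorm (y - x))); split; first by rewrite le_max lexx.
  - by rewrite ge_max p0 gerBl enorm_ge0.
  - by rewrite lerBlDl -lerBlDr le_max lexx orbT.
  - by rewrite ge_max enorm_ge0; lra.
have : h (q ^+ 2) <= pot y.
  by rewrite potE; apply: shape_le; rewrite ?sqr_ge0// ler_sqr ?nnegrE ?enorm_ge0.
have := MP p q; rewrite p0 lexx q0 qp => /(_ isT isT).
have pq0 : 0 <= p - q by rewrite subr_ge0 qp.
rewrite [X in _ <= _ * X](ger0_norm pq0) => hpq.
have := ler_norm (h (p ^+ 2) - h (q ^+ 2)).
by nra.
Qed.

End Potential.

(** * Integration *)

Section LowerIntegral.
Import HBNNSimple.
Variable R : realType.
Notation mu := (@lebesgue_measure R).
Implicit Types (D : set R) (u v : R -> \bar R).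

Lemma ae_imp2 (P Q S : R -> Prop) : (forall x, P x -> Q x -> S x) ->
  {ae mu, forall x, P x} -> {ae mu, forall x, Q x} -> {ae mu, forall x, S x}.
Proof.
have F : Filter (almost_everywhere mu) := ae_filter_ringOfSetsType mu.
by move=> h hP hQ; exact: (@filterS2 _ _ F _ _ _ h hP hQ).
Qed.

Lemma ae_imp3 (P Q S T : R -> Prop) : (forall x, P x -> Q x -> S x -> T x) ->
  {ae mu, forall x, P x} -> {ae mu, forall x, Q x} -> {ae mu, forall x, S x} -> {ae mu, forall x, T x}.
Proof.
by move=> h hP hQ; apply: (ae_imp2 (P := fun x => P x /\ Q x)) => [x []|]; [exact: h|exact: ae_imp2 hP hQ].
Qed.

(** The integral of a nonnegative function is a supremum over simple functions below it, hence
    monotone for arbitrary functions. *)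
Lemma ge0_le_lower_integral D u v : (forall x, D x -> 0 <= u x)%E ->
  (forall x, D x -> u x <= v x)%E -> (\int[mu]_(x in D) u x <= \int[mu]_(x in D) v x)%E.
Proof.
move=> u0 uv; rewrite !ge0_integralE//; last by move=> x Dx; rewrite (le_trans (u0 x Dx))// uv.
apply: le_ereal_sup => _ [g gu <-]; exists g => // x; rewrite (le_trans (gu x))//.
by rewrite !patchE; case: ifPn => // xD; apply/uv/set_mem.
Qed.

(** Each simple function below [u] is almost everywhere below the measurable [v]. It is applied with
    [u] the Lagrangian of a competitor. *)
Lemma ae_le_upper_integral D u v : measurable D -> (forall x, D x -> 0 <= u x)%E ->
  (forall x, D x -> 0 <= v x)%E -> measurable_fun D v ->
  {ae mu, forall x, D x -> (u x <= v x)%E} -> (\int[mu]_(x in D) u x <= \int[mu]_(x in D) v x)%E.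
Proof.
move=> mD u0 v0 mv uv.
have mvD : measurable_fun setT (v \_ D) by apply/(measurable_restrictT _ _).1.
rewrite ge0_integralE//; apply: ge_ereal_sup => _ [g gu <-].
rewrite -integralT_nnsfun [leRHS]integral_mkcond; apply: ae_ge0_le_integral => //.
- by move=> x _; rewrite lee_fin; exact: fun_ge0.
- by apply/measurable_EFinP; exact: measurable_funPT.
- by move=> x _; rewrite patchE; case: ifPn => // /set_mem/v0.
- apply: (ae_imp2 _ uv uv) => x uvx _ _; rewrite (le_trans (gu x))//.
  by rewrite !patchE; case: ifPn => // /set_mem.
Qed.

Lemma ae_le_lower_integral D u v : measurable D -> (forall x, D x -> 0 <= u x)%E ->
  (forall x, D x -> 0 <= v x)%E -> measurable_fun D u ->
  {ae mu, forall x, D x -> (u x <= v x)%E} -> (\int[mu]_(x in D) u x <= \int[mu]_(x in D) v x)%E.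
Proof.
move=> mD u0 v0 mu' [N [mN N0 subN]].
rewrite (ge0_negligible_integral mN)// setDE integral_mkcondr.
apply: ge0_le_lower_integral => x Dx; rewrite patchE; case: ifPn => //; try by move=> _; exact: u0.
  move=> /set_mem xN; apply: contrapT => h; apply: xN; apply: subN => /= h'; apply: h; exact: h'.
by move=> _; exact: v0.
Qed.

Lemma ae_neq (a : R) : {ae mu, forall x, x != a}.
Proof.
exists [set a]; split; [exact: measurable_set1|exact: lebesgue_measure_set1|].
by move=> x /= /negP; rewrite negbK => /eqP.
Qed.

End LowerIntegral.

(** * Integrals over intervals and integrable majorants *)

Section IntervalIntegrals.
Variable R : realType.
Notation mu := (@lebesgue_measure R).
Implicit Types (x y z r : R) (p q : R -> R).

(** Half-open intervals make concatenation an exact disjoint union. *)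
Definition has_int p x y r :=
  mu.-integrable `]x, y] (EFin \o p) /\ \int[mu]_(t in `]x, y]) p t = r.

Lemma has_intD p q x y r r' : has_int p x y r -> has_int q x y r' ->
  has_int (fun t => p t + q t) x y (r + r').
Proof.
move=> [ip <-] [iq <-]; split; last by rewrite RintegralD.
by rewrite (_ : _ \o _ = (EFin \o p) \+ (EFin \o q))%E//; exact: integrableD.
Qed.

Lemma has_intZ c p x y r : has_int p x y r -> has_int (fun t => c * p t) x y (c * r).
Proof.
move=> [ip <-]; split; last by rewrite RintegralZl.
by rewrite (_ : _ \o _ = (fun t => c%:E * (EFin \o p) t))%E//; exact: integrableZl.
Qed.

Lemma has_int_cst c x y : x <= y -> has_int (fun _ => c) x y (c * (y - x)).
Proof.
move=> xy.
have mxy : mu `]x, y] = (y - x)%:E.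
  rewrite lebesgue_measure_itv/= lte_fin; case: ltP => // yx.
  by congr (_%:E); lra.
split; last by rewrite Rintegral_cst//; congr (_ * _); rewrite [X in fine X]mxy.
apply/integrableP; split; first exact/measurable_EFinP/measurable_cst.
by rewrite integral_cst// [X in (_ * X)%E]mxy ltry.
Qed.

Lemma has_int_sum n (p : 'I_n -> R -> R) x y (r : 'I_n -> R) : x <= y ->
  (forall i, has_int (p i) x y (r i)) -> has_int (fun t => \sum_(i < n) p i t) x y (\sum_(i < n) r i).
Proof.
move=> xy; elim: n p r => [|n IHn] p r hp.
  rewrite (_ : (fun t => _) = fun _ => 0); last by apply/funext => t; rewrite big_ord0.
  by have := has_int_cst 0 xy; rewrite mul0r big_ord0.
rewrite (_ : (fun t => _) = fun t => p ord0 t + \sum_(i < n) p (lift ord0 i) t); last first.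
  by apply/funext => t; rewrite big_ord_recl.
by rewrite big_ord_recl; apply: has_intD => //; exact: IHn.
Qed.

Lemma has_int_ext p q x y r : (forall t, x < t <= y -> p t = q t) -> has_int p x y r -> has_int q x y r.
Proof.
move=> pq [ip <-].
have e : {in (`]x, y]%classic : set R), p =1 q} by move=> t /set_mem/=; rewrite in_itv/=; exact: pq.
split; last by apply/esym/eq_Rintegral.
by apply: eq_integrable ip => // t /e /= ->.
Qed.

Lemma has_int_cat p x y z r r' : x <= y -> y <= z ->
  has_int p x y r -> has_int p y z r' -> has_int p x z (r + r').
Proof.
move=> xy yz [i1 <-] [i2 <-].
have U : (`]x, z] = `]x, y] `|` `]y, z] :> set R)%classic.
  by apply/seteqP; split=> t /=; rewrite !in_itv/=; case: (leP t y) => ty; lra.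
have i : mu.-integrable `]x, z] (EFin \o p).
  move: i1 i2 => /integrableP[m1 f1] /integrableP[m2 f2].
  have mU : measurable_fun (`]x, y] `|` `]y, z] : set R) (EFin \o p).
    by apply/measurable_funU.
  rewrite U; apply/integrableP; split => //.
  rewrite ge0_integral_setU//; first exact: lte_add_pinfty.
  - by apply: measurableT_comp.
  - by apply/disj_setPS => t [/=]; rewrite !in_itv/= => /andP[_ ty] /andP[]; rewrite ltNge ty.
split => //; rewrite U Rintegral_setU//; first by rewrite -U.
by apply/disj_setPS => t [/=]; rewrite !in_itv/= => /andP[_ ty] /andP[]; rewrite ltNge ty.
Qed.

Lemma has_int_sub p x y x' y' r : x <= x' -> y' <= y -> has_int p x y r ->
  has_int p x' y' (\int[mu]_(t in `]x', y']) p t).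
Proof.
move=> xx yy [ip _]; split => //; apply: integrableS ip => //.
by move=> t /=; rewrite !in_itv/= => /andP[? ?]; apply/andP; split; lra.
Qed.

Lemma has_int_inj p x y r r' : has_int p x y r -> has_int p x y r' -> r = r'.
Proof. by move=> [_ <-] [_ <-]. Qed.

Lemma has_int_le p q x y r r' : (forall t, x < t < y -> p t <= q t) ->
  has_int p x y r -> has_int q x y r' -> r <= r'.
Proof.
have mo : measurable (`]x, y[%classic : set R) by exact: measurable_itv.
have io f : mu.-integrable `]x, y] (EFin \o f) -> mu.-integrable `]x, y[ (EFin \o f).
  move=> fi; apply: integrableS fi => //.
  by move=> t /=; rewrite !in_itv/= => /andP[-> /ltW ->].
move=> pq [ip <-] [iq <-]; have ipo := io _ ip; have iqo := io _ iq.
rewrite -(Rintegral_itv_bndo_bndc ipo) -(Rintegral_itv_bndo_bndc iqo).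
by apply: le_Rintegral => // t /=; rewrite in_itv/=; exact: pq.
Qed.

(** [r] is the integral of an almost everywhere majorant of [Q], which makes it an upper bound for
    the integral of a nonnegative [Q]. *)
Definition ub_int (Q : R -> R) x y r := exists2 B : R -> R,
  {ae mu, forall t, x < t < y -> Q t <= B t} & has_int B x y r.

Lemma ub_int_cat Q x y z r r' : x <= y -> y <= z ->
  ub_int Q x y r -> ub_int Q y z r' -> ub_int Q x z (r + r').
Proof.
move=> xy yz [B hB iB] [C hC iC].
exists (fun t => if t <= y then B t else C t).
  apply: ae_imp3 (ae_neq y) hB hC => t ty ht ht' /andP[xt tz].
  by case: (leP t y) => ty'; [apply: ht; rewrite xt lt_neqAle ty|apply: ht'; rewrite ty'].
apply: has_int_cat xy yz _ _.
  by apply: has_int_ext iB => t /andP[_ ->].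
by apply: has_int_ext iC => t /andP[yt _]; rewrite leNgt yt.
Qed.

Lemma ub_int_upper Q a b r : a < b -> (forall t, 0 <= Q t) -> ub_int Q a b r ->
  (\int[mu]_(t in `[a, b]) (Q t)%:E <= r%:E)%E.
Proof.
move=> ab Q0 [B hB [iB <-]].
have mB : measurable_fun `]a, b] (EFin \o B) by case/integrableP: iB.
have mab : measurable (`[a, b]%classic : set R) by exact: measurable_itv.
(* [B] may be negative on the exceptional null set, hence the absolute value; elsewhere
   [0 <= Q <= B] and nothing changes. *)
pose v : R -> \bar R := (abse \o (EFin \o B)) \_ (`]a, b] : set R).
have mv : measurable_fun setT v.
  by apply/(measurable_restrictT _ _).1 => //; exact: measurableT_comp.
apply: (@le_trans _ _ (\int[mu]_(t in `[a, b]) v t)%E).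
  apply: ae_le_upper_integral => //.
  - by move=> t _; rewrite lee_fin.
  - by move=> t _; rewrite /v /patch; case: ifP => // _; exact: abse_ge0.
  - exact: measurable_funS mv.
  - apply: ae_imp3 (ae_neq a) (ae_neq b) hB => t ta tb ht /=; rewrite in_itv/= => /andP[at_ tb'].
    have at' : a < t by rewrite lt_neqAle eq_sym ta.
    have tb2 : t < b by rewrite lt_neqAle tb.
    rewrite /v /patch mem_set/=; last by rewrite in_itv/= at'.
    by rewrite lee_fin (le_trans (ht _))// ?at'// ler_norm.
rewrite /v -integral_mkcondr setIidr; last first.
  by move=> t /=; rewrite !in_itv/= => /andP[/ltW -> ->].
rewrite /Rintegral fineK; last exact: integrable_fin_num.
rewrite le_eqVlt; apply/orP; left; apply/eqP; apply: ae_eq_integral => //.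
  exact: measurableT_comp.
apply: ae_imp2 (ae_neq b) hB => t tb ht /=; rewrite in_itv/= => /andP[at_ tb'].
by rewrite ger0_norm// (le_trans (Q0 t))// ht// at_ lt_neqAle tb.
Qed.

End IntervalIntegrals.

(** * Absolutely continuous paths in Euclidean space *)

Section AbsCont.
Variables (R : realType) (d : nat).
Notation V := 'rV[R]_d.
Notation mu := (@lebesgue_measure R).
Implicit Types (g : R -> V) (a b x y t : R).

Lemma sorted_chain a b (s : seq (R * R)) : a <= b ->
  all (fun p => (a <= p.1) && (p.1 <= p.2) && (p.2 <= b)) s ->
  sorted (fun p q => p.2 <= q.1) s -> chain a b s.
Proof.
move=> ab; case: s => [//|p s] /= /andP[/andP[/andP[-> ->] pb] sa] /=.
elim: s p pb sa => [|q s IHs] p pb //= /andP[/andP[/andP[aq qq] qb] sa] /andP[-> ps].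
by rewrite qq IHs.
Qed.

Lemma chain_widenr a b b' (s : seq (R * R)) : b <= b' -> chain a b s -> chain a b' s.
Proof.
move=> bb; elim: s a => [|p s IHs] a /=; first by move=> /le_trans; exact.
by move=> /and3P[-> -> /IHs ->].
Qed.

Lemma abs_contP a b g : a <= b -> (abs_cont a b g <->
  forall e : R, 0 < e -> exists2 eta : R, 0 < eta & forall s, chain a b s ->
    \sum_(p <- s) (p.2 - p.1) < eta -> \sum_(p <- s) enorm (g p.2 - g p.1) < e).
Proof.
move=> ab; split=> h e /h[eta eta0 etaP]; exists eta => // s.
  by move=> cs; apply: etaP; [exact: chain_all|exact: chain_sorted cs].
by move=> sa ss; apply: etaP; exact: sorted_chain.
Qed.

Lemma abs_cont_sub a b x y g : a <= x -> x <= y -> y <= b -> abs_cont a b g -> abs_cont x y g.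
Proof.
move=> ax xy yb /abs_contP h; apply/abs_contP => // e /h[]; first by rewrite (le_trans ax)// (le_trans xy).
move=> eta eta0 etaP; exists eta => // s cs; apply: etaP.
exact: chain_widenr yb (chain_widen ax cs).
Qed.

Lemma abs_cont_unif a b g e : a <= b -> abs_cont a b g -> 0 < e -> exists2 r, 0 < r &
  forall x y, a <= x <= b -> a <= y <= b -> `|x - y| < r -> enorm (g x - g y) < e.
Proof.
move=> ab /(abs_contP _ ab) h /h[r r0 rP]; exists r => //.
suff key x y : a <= x <= b -> a <= y <= b -> x <= y -> `|x - y| < r -> enorm (g y - g x) < e.
  move=> x y xab yab; case: (leP x y) => [xy|/ltW yx]; first by rewrite enormB; exact: key.
  by rewrite distrC; exact: key.
move=> /andP[ax xb] /andP[ay yb] xy; rewrite distrC ger0_norm ?subr_ge0// => yxr.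
by have := rP [:: (x, y)]; rewrite !big_seq1/= ax xy yb; apply.
Qed.

Lemma abs_cont_dominated a b g (s : R -> V) (C M : R) : a <= b -> 0 <= C -> 0 <= M ->
  (forall x y, a <= x <= b -> a <= y <= b ->
     enorm (s x - s y) <= C * enorm (g x - g y) + M * `|x - y|) ->
  abs_cont a b g -> abs_cont a b s.
Proof.
move=> ab C0 M0 dom /(abs_contP _ ab) h; apply/abs_contP => // e e0.
have C1 : 0 < 2 * (C + 1) by rewrite mulr_gt0// ltr_wpDl.
have M1 : 0 < 2 * (M + 1) by rewrite mulr_gt0// ltr_wpDl.
have [|eta eta0 etaP] := h (e / (2 * (C + 1))); first by rewrite divr_gt0.
exists (Num.min eta (e / (2 * (M + 1)))) => [|l cl]; first by rewrite lt_min eta0 divr_gt0.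
rewrite lt_min => /andP[/(etaP _ cl)]; rewrite !ltr_pdivlMr// => h1 h2.
apply: (@le_lt_trans _ _ (C * \sum_(p <- l) enorm (g p.2 - g p.1) + M * \sum_(p <- l) (p.2 - p.1))).
  rewrite !mulr_sumr -big_split/= big_seq [leRHS]big_seq; apply: ler_sum => p pl.
  move/chain_all/allP: cl => /(_ p pl)/andP[/andP[ap pp] pb].
  rewrite (le_trans (dom _ _ _ _))//; first by rewrite pb andbT (le_trans ap).
    by rewrite ap (le_trans pp).
  by rewrite ger0_norm ?subr_ge0.
have s0 : 0 <= \sum_(p <- l) enorm (g p.2 - g p.1).
  by rewrite sumr_ge0// => p _; exact: enorm_ge0.
have l0 : 0 <= \sum_(p <- l) (p.2 - p.1).
  rewrite big_seq sumr_ge0// => p pl; rewrite subr_ge0.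
  by move/chain_all/allP: cl => /(_ p pl)/andP[/andP[]].
by nra.
Qed.

Lemma abs_cont_cat a b x g : a <= x -> x <= b ->
  abs_cont a x g -> abs_cont x b g -> abs_cont a b g.
Proof.
move=> ax xb /(abs_contP _ ax) h1 /(abs_contP _ xb) h2.
apply/abs_contP => [|e e0]; first exact: le_trans xb.
have [|r r0 rP] := h1 (e / 2); first by rewrite divr_gt0.
have [|r' r'0 rP'] := h2 (e / 2); first by rewrite divr_gt0.
exists (Num.min r r') => [|l cl]; first by rewrite lt_min r0.
rewrite lt_min => /andP[lr lr'].
(* Clamping every interval at [x] from above and from below splits a chain into one on each side,
   straddling intervals included. *)
pose mn y := Num.min x y; pose mx y := Num.max x y.
have cmn c s : chain c b s -> chain (mn c) x [seq (mn p.1, mn p.2) | p <- s].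
  elim: s c => [|p s IHs] c /=; first by rewrite ge_min lexx.
  move=> /and3P[cp pp /IHs ->]; rewrite andbT; apply/andP.
  by split; rewrite le_min !ge_min lexx ?cp ?pp ?orbT.
have cmx c s : chain c b s -> chain (mx c) b [seq (mx p.1, mx p.2) | p <- s].
  elim: s c => [|p s IHs] c /=; first by rewrite ge_max xb.
  move=> /and3P[cp pp /IHs ->]; rewrite andbT; apply/andP.
  by split; rewrite ge_max !le_max lexx ?cp ?pp ?orbT.
have c1 := cmn _ _ cl; rewrite [mn a](min_idPr ax) in c1.
have c2 := cmx _ _ cl; rewrite [mx a](max_idPl ax) in c2.
have pl p : p \in l -> p.1 <= p.2 by move/chain_all/allP: cl => h /h/andP[/andP[]].
have len_mn p : p \in l -> mn p.2 - mn p.1 <= p.2 - p.1.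
  by move=> /pl; rewrite /mn; case: (leP x p.1) => ?; case: (leP x p.2) => ?; lra.
have len_mx p : p \in l -> mx p.2 - mx p.1 <= p.2 - p.1.
  by move=> /pl; rewrite /mx; case: (leP x p.1) => ?; case: (leP x p.2) => ?; lra.
have := rP _ c1; rewrite !big_map/= => /(_ _)/wrap[].
  by apply: le_lt_trans lr; rewrite big_seq [leRHS]big_seq; exact: ler_sum.
have := rP' _ c2; rewrite !big_map/= => /(_ _)/wrap[].
  by apply: le_lt_trans lr'; rewrite big_seq [leRHS]big_seq; exact: ler_sum.
move=> s2 s1.
suff : \sum_(p <- l) enorm (g p.2 - g p.1) <=
  \sum_(p <- l) enorm (g (mn p.2) - g (mn p.1)) + \sum_(p <- l) enorm (g (mx p.2) - g (mx p.1)).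
  by lra.
rewrite -big_split/= big_seq [leRHS]big_seq; apply: ler_sum => p /pl pp.
have -> : g p.2 - g p.1 = (g (mn p.2) - g (mn p.1)) + (g (mx p.2) - g (mx p.1)); last exact: ler_enormD.
rewrite /mn /mx; case: (leP x p.1) => h1'; case: (leP x p.2) => h2'.
- by rewrite subrr add0r.
- by have := lt_le_trans h2' (le_trans h1' pp); rewrite ltxx.
- by rewrite [RHS]addrC addrA subrK.
- by rewrite subrr addr0.
Qed.

Lemma abs_cont_coord a b g i : a <= b -> abs_cont a b g -> abs_contR a b (fun t => g t ord0 i).
Proof.
move=> ab /(abs_contP _ ab) h e /h[eta eta0 etaP]; exists eta => // s cs /(etaP _ cs).
apply: le_lt_trans; apply: ler_sum => p _.
by have := coord_enorm (g p.2 - g p.1) i; rewrite !mxE.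
Qed.

Theorem abs_cont_density a b g : a < b -> abs_cont a b g -> exists f : R -> V,
  (forall x y i, a <= x -> x <= y -> y <= b ->
     has_int (fun t => f t ord0 i) x y ((g y - g x) ord0 i)) /\
  {ae mu, forall t, a < t < b -> is_derive t 1 g (f t)}.
Proof.
move=> ab gac.
have /choice[F FP] i := abs_contR_density ab (abs_cont_coord i (ltW ab) gac).
exists (fun t => \row_i F i t); split.
  move=> x y i ax xy yb; have [fi fE _] := FP i.
  have fo x' y' : has_int (F i) x' y' (\int[mu]_(t in `]x', y']) F i t).
    by split => //; apply: integrableS fi => //; exact: measurable_itv.
  apply: has_int_ext (fun t => F i t) _ _ _ _ _ _; first by move=> t _; rewrite mxE.
  have [ii _] := fo x y; split => //.
  have := has_int_cat ax xy (fo a x) (fo x y) => /(has_int_inj (fo a y)).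
  rewrite !mxE (fE y) ?(fE x)//; first by move=> ->; ring.
    by rewrite ax (le_trans xy).
  by rewrite (le_trans ax).
have : {ae mu, forall t, forall i, a < t < b -> is_derive t 1 (fun t => g t ord0 i) (F i t)}.
  have Fm : Filter (almost_everywhere mu) := ae_filter_ringOfSetsType mu.
  by apply: (@filter_forall _ _ _ _ Fm) => i; have [_ _] := FP i.
move=> h; apply: (ae_imp2 _ h h) => t ht _ tab.
have dg : derivable g t 1.
  apply/derivable_mxP => i j; have -> : i = ord0 by exact: ord1.
  by case: (ht j tab).
apply: DeriveDef => //; rewrite derive_mx//; apply/rowP => j; rewrite !mxE.
by case: (ht j tab) => _ <-.
Qed.

Lemma derive_not_derivable g t : ~ derivable g t 1 -> 'D_1 g t = 0.
Proof. by move=> ng; rewrite /derive dvgP//; apply/rowP => i; rewrite !mxE. Qed.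

(** Where [s] is not derivable, ['D_1] takes the default value 0 and the bound is trivial; elsewhere
    difference quotients are compared in the limit. *)
Lemma derive_dominated g (s : R -> V) t (f u : V) (c r : R) : 0 < r -> is_derive t 1 g f ->
  (forall x, `|x - t| < r -> enorm (s x - s t) <= enorm (c *: (g x - g t) + (x - t) *: u)) ->
  sqn ('D_1 s t) <= sqn (c *: f + u).
Proof.
move=> r0 gf dom; have [ds|/derive_not_derivable ->] := pselect (derivable s t 1); last first.
  by rewrite /sqn dotp0l; exact: sqn_ge0.
rewrite -enorm_le_sqn.
have c1 : (fun k => enorm (k^-1 *: (s (k *: 1 + t) - s t))) @ 0^' --> enorm ('D_1 s t).
  apply: (@cvg_comp _ _ _ (fun k => k^-1 *: (s (k *: 1 + t) - s t)) (@enorm R d)); first exact: ds.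
  exact: enorm_continuous.
have c2 : (fun k => enorm (c *: (k^-1 *: (g (k *: 1 + t) - g t)) + u)) @ 0^' --> enorm (c *: f + u).
  apply: (@cvg_comp _ _ _ (fun k => c *: (k^-1 *: (g (k *: 1 + t) - g t)) + u) (@enorm R d)); last exact: enorm_continuous.
  apply: cvgD; last exact: cvg_cst.
  by apply: cvgZr; case: gf => dg <-.
apply: (ler_cvg_to c1 c2); near=> k.
have k0 : k != 0 by near: k; exact: nbhs_dnbhs_neq.
have -> : c *: (k^-1 *: (g (k *: 1 + t) - g t)) + u =
    k^-1 *: (c *: (g (k *: 1 + t) - g t) + (k *: 1 + t - t) *: u).
  rewrite addrK; move: (g _ - g t) => D.
  rewrite [k *: 1](_ : _ = k); last by rewrite /GRing.scale/= mulr1.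
  by rewrite [RHS]scalerDr !scalerA mulVf// scale1r mulrC.
rewrite !enormZ ler_wpM2l//; apply: dom; rewrite addrK [k *: 1](_ : _ = k); last first.
  by rewrite /GRing.scale/= mulr1.
by near: k; exact: dnbhs0_lt.
Unshelve. all: by end_near. Qed.

End AbsCont.

(** * The action *)

Section Action.
Variables (R : realType) (d : nat) (K : seq 'rV[R]_d) (h h' : R -> R) (delta : R).
Hypotheses (K0 : K != [::]) (Ku : uniq K).
Hypotheses (hP : potential_shape h h') (hmono : forall s t : R, 0 <= s -> s < t -> h s < h t).
Hypothesis delta0 : 0 < delta.
Notation V := 'rV[R]_d.
Notation mu := (@lebesgue_measure R).
Notation L := (pot K h).
Implicit Types (g sg : R -> V) (x y t : R).

Definition lagr g t : R := sqn ('D_1 g t) + L (g t).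

Lemma lagr_ge0 g t : 0 <= lagr g t.
Proof. by rewrite addr_ge0 ?sqn_ge0// (pot_ge0 _ hP). Qed.

Lemma actionE (x0 xd : V) g : abs_cont 0 delta g -> g 0 = x0 -> g delta = xd ->
  action h K delta x0 xd g = (\int[mu]_(t in `[0%R, delta]) (lagr g t)%:E)%E.
Proof. by move=> gac g0 gd; rewrite /action; case: asboolP => // -[]. Qed.

(** A lower semicontinuous function along a continuous path is lower semicontinuous, hence
    measurable; the clamp extends the path to the line. *)
Lemma measurable_pot g : abs_cont 0 delta g -> measurable_fun `]0, delta] (fun t => L (g t)).
Proof.
move=> gac; pose cl t := Num.max 0 (Num.min delta t).
have cl_in t : 0 <= cl t <= delta by rewrite le_max lexx ge_max (ltW delta0) ge_min lexx.
have cl_lip x y : `|cl x - cl y| <= `|x - y|.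
  suff key x' y' : x' <= y' -> `|cl x' - cl y'| <= `|x' - y'|.
    by case: (leP x y) => [|/ltW] /key//; rewrite distrC [X in _ <= X]distrC.
  move=> xy; rewrite distrC [X in _ <= X]distrC [X in _ <= X]ger0_norm ?subr_ge0//.
  have m1 : Num.min delta x' <= Num.min delta y' by rewrite le_min !ge_min lexx xy orbT.
  rewrite ger0_norm; last by rewrite subr_ge0 ge_max !le_max lexx m1 orbT.
  have := delta0; rewrite /cl; case: (leP delta x') => ?; case: (leP delta y') => ?;
    do 2 ?case: (leP 0 _) => ?; lra.
have mf : measurable_fun setT (fun t => (L (g (cl t)))%:E).
  apply: lower_semicontinuous_measurable => x a; rewrite lte_fin => /(pot_lsc K0 Ku hP hmono)[r r0 rP].
  have [r' r'0 r'P] := abs_cont_unif (ltW delta0) gac r0.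
  exists (ball x r'); first exact: nbhsx_ballx.
  move=> y; rewrite /ball/= => xy; rewrite lte_fin; apply: rP; apply: r'P => //.
  by rewrite distrC (le_lt_trans (cl_lip _ _)).
apply: (@eq_measurable_fun _ _ _ _ _ (fun t => L (g (cl t)))).
  move=> t /set_mem/=; rewrite in_itv/= => /andP[t0 td].
  by rewrite /cl (min_idPr td) (max_idPr (ltW t0)).
by apply: measurable_funTS; apply/measurable_EFinP; exact: mf.
Qed.

Section Density.
Variables (g f : R -> V).
Hypothesis fI : forall x y i, 0 <= x -> x <= y -> y <= delta ->
  has_int (fun t => f t ord0 i) x y ((g y - g x) ord0 i).
Hypothesis fD : {ae mu, forall t, 0 < t < delta -> is_derive t 1 g (f t)}.

Let e t := sqn (f t) + L (g t).

(** The measurable density [f] stands for ['D_1 g] almost everywhere; finiteness of the action then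
    makes the two nonnegative summands integrable separately. *)
Lemma finite_action_integrals : abs_cont 0 delta g ->
  (\int[mu]_(t in `[0%R, delta]) (lagr g t)%:E < +oo)%E -> exists k p,
  [/\ has_int (fun t => sqn (f t)) 0 delta k, has_int (fun t => L (g t)) 0 delta p &
      ((k + p)%:E <= \int[mu]_(t in `[0%R, delta]) (lagr g t)%:E)%E].
Proof.
move=> gac fin.
have mD : measurable (`]0, delta]%classic : set R) by exact: measurable_itv.
have mL := measurable_pot gac.
have mS : measurable_fun `]0, delta] (fun t => sqn (f t)).
  rewrite /sqn /dotp; apply: measurable_sum => i.
  have mi : measurable_fun `]0, delta] (fun t => f t ord0 i).
    have [/integrableP[/measurable_EFinP mi _] _] := fI i (lexx 0) (ltW delta0) (lexx delta).
    exact: mi.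
  exact: measurable_funM.
have me : measurable_fun `]0, delta] (fun t => (e t)%:E).
  by apply/measurable_EFinP; exact: measurable_funD.
have e0 t : 0 <= e t by rewrite addr_ge0 ?sqn_ge0// (pot_ge0 _ hP).
have le1 : (\int[mu]_(t in `]0%R, delta]) (e t)%:E <= \int[mu]_(t in `]0%R, delta]) (lagr g t)%:E)%E.
  apply: ae_le_lower_integral => //.
  - by move=> t _; rewrite lee_fin.
  - by move=> t _; rewrite lee_fin lagr_ge0.
  - apply: ae_imp2 (ae_neq delta) fD => t td ht /=; rewrite in_itv/= => /andP[t0 td'].
    have /ht[_ df] : 0 < t < delta by rewrite t0 lt_neqAle td.
    by rewrite lee_fin /lagr df.
have le2 : (\int[mu]_(t in `]0%R, delta]) (lagr g t)%:E <= \int[mu]_(t in `[0%R, delta]) (lagr g t)%:E)%E.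
  rewrite [leLHS]integral_mkcond [leRHS]integral_mkcond; apply: ge0_le_lower_integral => t _.
    by rewrite /patch; case: ifP => // _; rewrite lee_fin lagr_ge0.
  rewrite /patch; case: ifPn => [/set_mem/=|_]; last first.
    by case: ifP => // _; rewrite lee_fin lagr_ge0.
  by rewrite in_itv/= => /andP[/ltW t0 td]; rewrite mem_set//= in_itv/= t0.
have le := le_trans le1 le2.
have ie : mu.-integrable `]0, delta] (EFin \o e).
  apply/integrableP; split => //; apply: le_lt_trans fin; apply: le_trans le.
  rewrite le_eqVlt; apply/orP; left; apply/eqP; apply: eq_integral => t _ /=.
  by rewrite ger0_norm.
have iS : mu.-integrable `]0, delta] (EFin \o (fun t => sqn (f t))).
  apply: le_integrable ie => //; first exact/measurable_EFinP.
  by move=> t _ /=; rewrite lee_fin !ger0_norm ?sqn_ge0// lerDl (pot_ge0 _ hP).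
have iL : mu.-integrable `]0, delta] (EFin \o (fun t => L (g t))).
  apply: le_integrable ie => //; first exact/measurable_EFinP.
  by move=> t _ /=; rewrite lee_fin !ger0_norm ?sqn_ge0 ?(pot_ge0 _ hP)// lerDr sqn_ge0.
exists (\int[mu]_(t in `]0, delta]) sqn (f t)), (\int[mu]_(t in `]0, delta]) L (g t)).
split => //; rewrite -RintegralD// /Rintegral fineK//; exact: integrable_fin_num.
Qed.

(** In the expansion of [sqn (c *: f + u)] the cross term integrates to the increment of [g]. *)
Lemma piece_upper_bound (kk pp : R -> R -> R) sg x y (c c' w : R) (u : V) :
  (forall x y, 0 <= x -> x <= y -> y <= delta -> has_int (fun t => sqn (f t)) x y (kk x y)) ->
  (forall x y, 0 <= x -> x <= y -> y <= delta -> has_int (fun t => L (g t)) x y (pp x y)) ->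
  0 <= x -> x <= y -> y <= delta ->
  (forall s t, x <= s <= y -> x <= t <= y ->
    enorm (sg s - sg t) <= enorm (c *: (g s - g t) + (s - t) *: u)) ->
  (forall t, x < t < y -> L (sg t) <= c' * L (g t) + w) ->
  ub_int (lagr sg) x y
   (c ^+ 2 * kk x y + 2 * c * dotp u (g y - g x) + (sqn u + w) * (y - x) + c' * pp x y).
Proof.
move=> kkP ppP x0 xy yd dom Lw.
have hu : has_int (fun t => dotp u (f t)) x y (dotp u (g y - g x)).
  by apply: has_int_sum => // i; apply: has_intZ; exact: fI.
exists (fun t => c ^+ 2 * sqn (f t) + 2 * c * dotp u (f t) + (sqn u + w) + c' * L (g t)); last first.
  apply: has_intD; last by apply: has_intZ; exact: ppP.
  apply: has_intD; last exact: has_int_cst.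
  by apply: has_intD; [apply: has_intZ; exact: kkP|exact: has_intZ].
apply: (ae_imp2 _ fD fD) => t ht _ /andP[xt ty].
have tx : 0 < Num.min (t - x) (y - t) by rewrite lt_min !subr_gt0 xt.
have td : 0 < t < delta by rewrite (le_lt_trans x0 xt) (lt_le_trans ty yd).
have := @derive_dominated _ _ g sg t (f t) u c _ tx (ht td).
rewrite sqnD sqnZ dotpZl (dotpC (f t)) => /(_ _)/wrap[]; last first.
  by have := Lw t; rewrite xt ty => /(_ isT); rewrite /lagr; lra.
move=> s; rewrite lt_min ltr_norml !ltr_norml => /andP[/andP[s1 s2] /andP[s3 s4]].
by apply: dom; apply/andP; split; lra.
Qed.

End Density.

End Action.

(** * Comparison with competitors *)

Section Compare.
Variables (R : realType) (d : nat) (K : seq 'rV[R]_d) (h h' : R -> R) (delta : R).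
Hypotheses (K0 : K != [::]) (Ku : uniq K).
Hypotheses (hP : potential_shape h h') (hmono : forall s t : R, 0 <= s -> s < t -> h s < h t).
Hypothesis delta0 : 0 < delta.
Notation V := 'rV[R]_d.
Notation mu := (@lebesgue_measure R).
Notation L := (pot K h).

(* [kk x y] and [pp x y] are the kinetic and the potential energy of [g] on [[x, y]]; only
   properties that survive time reversal are recorded. *)
Record energies (g : R -> V) (kk pp : R -> R -> R) : Prop := Energies {
  kin_ge : forall x y (u : V), 0 <= x -> x <= y -> y <= delta ->
    2 * dotp u (g y - g x) <= kk x y + sqn u * (y - x) ;
  kin_cat : forall x y z, 0 <= x -> x <= y -> y <= z -> z <= delta -> kk x z = kk x y + kk y z ;
  pot_cat : forall x y z, 0 <= x -> x <= y -> y <= z -> z <= delta -> pp x z = pp x y + pp y z ;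
  pot_ge : forall x y w, 0 <= x -> x <= y -> y <= delta ->
    (forall t, x < t < y -> w <= L (g t)) -> w * (y - x) <= pp x y }.

(* On a piece, the competitor [sg] satisfies [|sg'| <= |c g' + u|] and [L sg <= c' L g + w];
   expanding the square gives its cost. *)
Definition piece_cost (g : R -> V) (kk pp : R -> R -> R) (c c' w : R) (u : V) x y :=
  c ^+ 2 * kk x y + 2 * c * dotp u (g y - g x) + (sqn u + w) * (y - x) + c' * pp x y.

Definition piece_dom (g sg : R -> V) (c c' w : R) (u : V) x y :=
  (forall s t, x <= s <= y -> x <= t <= y ->
    enorm (sg s - sg t) <= enorm (c *: (g s - g t) + (s - t) *: u)) /\
  (forall t, x < t < y -> L (sg t) <= c' * L (g t) + w).

(** Three pieces suffice for all competitors: segments have [c = c' = 0], a projected path has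
    [c = c' = 1] and [u = 0], a projected trapezoidal translation has [u] nonzero on its two
    ramps. *)
Definition compare_prop (g : R -> V) kk pp (rho : R) :=
  forall (sg : R -> V) a p q b (c c' w1 w2 w3 : R) (u1 u2 u3 : V),
    0 <= a -> a <= p -> p <= q -> q <= b -> b <= delta ->
    (forall t, 0 <= t <= delta -> t <= a \/ b <= t -> sg t = g t) ->
    (forall t, a <= t <= b -> enorm (sg t - g t) < rho) ->
    piece_dom g sg c c' w1 u1 a p -> piece_dom g sg c c' w2 u2 p q -> piece_dom g sg c c' w3 u3 q b ->
    kk a b + pp a b <= piece_cost g kk pp c c' w1 u1 a p + piece_cost g kk pp c c' w2 u2 p q +
      piece_cost g kk pp c c' w3 u3 q b.

(** The energy of the density is at most the action of [g], hence that of the competitor, hence any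
    integral of a majorant. Outside [[a, b]] the paths agree, and additivity cancels those parts. *)
Lemma local_minimizer_compare (x0 xd : V) g : local_minimizer h K delta x0 xd g ->
  abs_cont 0 delta g /\ exists kk pp rho, [/\ energies g kk pp, 0 < rho & compare_prop g kk pp rho].
Proof.
move=> [fin [rho rho0 minP]].
have [gac [g0 gd]] : abs_cont 0 delta g /\ g 0 = x0 /\ g delta = xd.
  by move: fin; rewrite /action; case: asboolP => //; rewrite ltxx.
split => //; rewrite (actionE _ _ gac g0 gd) in fin.
have [f [fI fD]] := abs_cont_density delta0 gac.
have [k0 [p0 [k0P p0P low]]] := finite_action_integrals K0 Ku hP hmono delta0 fI fD gac fin.
pose kk x y := \int[mu]_(t in `]x, y]) sqn (f t).
pose pp x y := \int[mu]_(t in `]x, y]) L (g t).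
have kkP x y : 0 <= x -> x <= y -> y <= delta -> has_int (fun t => sqn (f t)) x y (kk x y).
  by move=> x0' xy yd; exact: has_int_sub k0P.
have ppP x y : 0 <= x -> x <= y -> y <= delta -> has_int (fun t => L (g t)) x y (pp x y).
  by move=> x0' xy yd; exact: has_int_sub p0P.
have d0 := ltW delta0.
have kcat x y z : 0 <= x -> x <= y -> y <= z -> z <= delta -> kk x z = kk x y + kk y z.
  move=> x0' xy yz zd; have xz := le_trans xy yz.
  apply: (has_int_inj (kkP x z x0' xz zd)); apply: (has_int_cat xy yz); apply: kkP => //.
    exact: le_trans zd.
  exact: le_trans xy.
have pcat x y z : 0 <= x -> x <= y -> y <= z -> z <= delta -> pp x z = pp x y + pp y z.
  move=> x0' xy yz zd; have xz := le_trans xy yz.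
  apply: (has_int_inj (ppP x z x0' xz zd)); apply: (has_int_cat xy yz); apply: ppP => //.
    exact: le_trans zd.
  exact: le_trans xy.
exists kk, pp, rho; split => //.
  split => //.
  - move=> x y u x0' xy yd.
    have hu : has_int (fun t => dotp u (f t)) x y (dotp u (g y - g x)).
      by apply: has_int_sum => // i; apply: has_intZ; exact: fI.
    apply: (has_int_le (p := fun t => 2 * dotp u (f t)) (q := fun t => sqn (f t) + sqn u) _ (has_intZ 2 hu)).
      by move=> t _; have := sqn_ge0 (f t - u); rewrite sqnB (dotpC u); lra.
    by apply: has_intD; [exact: kkP|exact: has_int_cst].
  - move=> x y w x0' xy yd wP.
    by apply: (has_int_le (p := fun=> w) (q := fun t => L (g t)) wP); [exact: has_int_cst|exact: ppP].
move=> sg a p q b c c' w1 w2 w3 u1 u2 u3 a0 ap pq qb bd out close [d1 l1] [d2 l2] [d3 l3].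
have p0' : 0 <= p by exact: le_trans ap.
have q0 : 0 <= q by exact: le_trans pq.
have b0 : 0 <= b by exact: le_trans qb.
have qd : q <= delta by exact: le_trans bd.
have pd : p <= delta by exact: le_trans qd.
have ad : a <= delta by exact: le_trans pd.
have pc x y (c0 : R) (u : V) : 0 <= x -> x <= y -> y <= delta ->
    (forall s t, x <= s <= y -> x <= t <= y -> enorm (sg s - sg t) <= enorm (c0 *: (g s - g t) + (s - t) *: u)) ->
    abs_cont x y sg.
  move=> x0' xy yd dom.
  apply: (@abs_cont_dominated _ _ x y g sg `|c0| (enorm u)); rewrite ?enorm_ge0//; last exact: abs_cont_sub gac.
  move=> s t sx tx; rewrite (le_trans (dom s t sx tx))// (le_trans (ler_enormD _ _))//.
  by rewrite !enormZ [X in _ + X]mulrC.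
(* The two outer pieces are taken with [c = 1] and [u = 0], where the bound is exactly the energy of
   [g]. *)
have pe x y : 0 <= x -> x <= y -> y <= delta -> (forall t, x <= t <= y -> sg t = g t) ->
    abs_cont x y sg /\ ub_int (lagr K h sg) x y (kk x y + pp x y).
  move=> x0' xy yd E.
  have dom s t : x <= s <= y -> x <= t <= y -> enorm (sg s - sg t) <= enorm (1 *: (g s - g t) + (s - t) *: 0).
    by move=> sx tx; rewrite scale1r scaler0 addr0 !E.
  split; first exact: (pc _ _ _ _ _ _ _ dom).
  have -> : kk x y + pp x y = 1 ^+ 2 * kk x y + 2 * 1 * dotp (0 : V) (g y - g x) + (sqn (0 : V) + 0) * (y - x) + 1 * pp x y.
    by rewrite /sqn !dotp0l; ring.
  apply: (piece_upper_bound fI fD kkP ppP) => // t /andP[xt ty].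
  by rewrite E ?(ltW xt) ?(ltW ty)// mul1r addr0.
have [ac0 ub0] : abs_cont 0 a sg /\ ub_int (lagr K h sg) 0 a (kk 0 a + pp 0 a).
  apply: pe => // t /andP[t0 ta]; apply: out; last by left.
  by rewrite t0 (le_trans ta).
have [ac4 ub4] : abs_cont b delta sg /\ ub_int (lagr K h sg) b delta (kk b delta + pp b delta).
  apply: pe => // t /andP[bt td]; apply: out; last by right.
  by rewrite td (le_trans b0).
have ub1 := piece_upper_bound fI fD kkP ppP a0 ap pd d1 l1.
have ub2 := piece_upper_bound fI fD kkP ppP p0' pq qd d2 l2.
have ub3 := piece_upper_bound fI fD kkP ppP q0 qb bd d3 l3.
have ac : abs_cont 0 delta sg.
  apply: (@abs_cont_cat _ _ _ _ a) => //; apply: (@abs_cont_cat _ _ _ _ p) => //; first exact: (pc _ _ _ _ _ _ _ d1).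
  apply: (@abs_cont_cat _ _ _ _ q) => //; first exact: (pc _ _ _ _ _ _ _ d2).
  by apply: (@abs_cont_cat _ _ _ _ b) => //; exact: (pc _ _ _ _ _ _ _ d3).
have s0 : sg 0 = x0 by rewrite out ?lexx//; left.
have sd : sg delta = xd by rewrite out ?lexx ?d0//; right.
have clo t : 0 <= t <= delta -> enorm (sg t - g t) < rho.
  move=> td; have [ta|ta] := leP t a; first by rewrite out ?subrr ?enorm0//; left.
  have [bt|bt] := leP b t; first by rewrite out ?subrr ?enorm0//; right.
  by apply: close; rewrite !ltW.
have := minP sg clo; rewrite (actionE _ _ gac g0 gd) (actionE _ _ ac s0 sd) => mn.
have ub01 := ub_int_cat a0 ap ub0 ub1.
have ub02 := ub_int_cat p0' pq ub01 ub2.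
have ub03 := ub_int_cat q0 qb ub02 ub3.
have ub04 := ub_int_cat b0 bd ub03 ub4.
have up := ub_int_upper delta0 (lagr_ge0 K hP sg) ub04.
have {mn low} := le_trans low (le_trans mn up); rewrite lee_fin.
have -> : k0 = kk 0 delta by apply: has_int_inj k0P (kkP _ _ _ _ _).
have -> : p0 = pp 0 delta by apply: has_int_inj p0P (ppP _ _ _ _ _).
have ab : a <= b by rewrite (le_trans ap)// (le_trans pq).
rewrite (kcat 0 a delta)// (kcat a b delta)// (pcat 0 a delta)// (pcat a b delta)//.
by rewrite /piece_cost; lra.
Qed.

End Compare.

(** * Line and projection competitors, and time reversal *)

Section OneSided.
Variables (R : realType) (d : nat) (K : seq 'rV[R]_d) (h : R -> R).
Notation V := 'rV[R]_d.
Notation L := (pot K h).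

Definition line_prop (delta : R) (g : R -> V) (kk pp : R -> R -> R) (rho : R) :=
  forall (a p b w1 w2 : R) (y : V), 0 <= a -> a < p -> p < b -> b <= delta ->
    (forall l, 0 <= l <= 1 -> L (g a + l *: (y - g a)) <= w1) ->
    (forall l, 0 <= l <= 1 -> L (y + l *: (g b - y)) <= w2) ->
    (forall t l, a <= t <= b -> 0 <= l <= 1 -> enorm (g a + l *: (y - g a) - g t) < rho) ->
    (forall t l, a <= t <= b -> 0 <= l <= 1 -> enorm (y + l *: (g b - y) - g t) < rho) ->
    kk a b + pp a b <= sqn (y - g a) / (p - a) + w1 * (p - a) + (sqn (g b - y) / (b - p) + w2 * (b - p)).

Definition proj_prop (delta : R) (g : R -> V) (rho : R) :=
  forall (a p q b : R) (e : V) (kappa : R) (P : R -> V),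
    0 <= a -> a <= p -> p < q -> q <= b -> b <= delta -> 0 < kappa ->
    (forall t, a <= t <= b -> is_proj (cell K e) (g t) (P t)) ->
    cell K e (g a) -> cell K e (g b) ->
    (forall t, a <= t <= b -> enorm (P t - g t) < rho) ->
    (forall t, a < t < b -> L (P t) <= L (g t)) ->
    (forall t, p < t < q -> L (P t) <= L (g t) - kappa) -> False.

(* [z T] is [g (t0 + T)] or [g (t0 - T)]. *)
Record one_sided (z : R -> V) (T0 : R) (E P : R -> R -> R) (rho : R) : Prop := OneSided {
  os_energies : energies K h T0 z E P ;
  os_cont : forall e, 0 < e -> exists2 r, 0 < r & forall s t, 0 <= s <= T0 -> 0 <= t <= T0 ->
    `|s - t| < r -> enorm (z s - z t) < e ;
  os_line : line_prop T0 z E P rho ;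
  os_proj : proj_prop T0 z rho }.

Lemma line_of_compare delta g kk pp rho : compare_prop K h delta g kk pp rho ->
  line_prop delta g kk pp rho.
Proof.
move=> cmp a p b w1 w2 y a0 ap pb bd Lw1 Lw2 c1 c2.
have pa : 0 < p - a by rewrite subr_gt0.
have bp : 0 < b - p by rewrite subr_gt0.
pose l1 t := (p - a)^-1 * (t - a); pose l2 t := (b - p)^-1 * (t - p).
pose sg t := if (t <= a) || (b <= t) then g t
  else if t <= p then g a + l1 t *: (y - g a) else y + l2 t *: (g b - y).
have l1p : l1 p = 1 by rewrite /l1 mulVf// lt0r_neq0.
have l2b : l2 b = 1 by rewrite /l2 mulVf// lt0r_neq0.
have l1in t : a <= t <= p -> 0 <= l1 t <= 1.
  move=> /andP[ta tp]; rewrite /l1 mulr_ge0 ?subr_ge0 ?invr_ge0 ?(ltW pa)//=.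
  by rewrite mulrC ler_pdivrMr// mul1r lerD2r.
have l2in t : p <= t <= b -> 0 <= l2 t <= 1.
  move=> /andP[tp tb]; rewrite /l2 mulr_ge0 ?subr_ge0 ?invr_ge0 ?(ltW bp)//=.
  by rewrite mulrC ler_pdivrMr// mul1r lerD2r.
have sg1 t : a <= t <= p -> sg t = g a + l1 t *: (y - g a).
  move=> /andP[ta tp]; rewrite /sg tp [b <= t]leNgt (le_lt_trans tp pb)/= orbF.
  case: ifPn => // ta'; have -> : t = a by apply/eqP; rewrite eq_le ta ta'.
  by rewrite /l1 subrr mulr0 scale0r addr0.
have sg2 t : p <= t <= b -> sg t = y + l2 t *: (g b - y).
  move=> /andP[pt tb]; rewrite /sg [t <= a]leNgt (lt_le_trans ap pt)/=.
  case: ifPn => [bt|_].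
    have -> : t = b by apply/eqP; rewrite eq_le tb bt.
    by rewrite l2b scale1r addrC subrK.
  case: ifPn => // tp; have -> : t = p by apply/eqP; rewrite eq_le pt tp.
  by rewrite l1p scale1r /l2 subrr mulr0 scale0r addr0 addrC subrK.
have ab : a <= b by rewrite ltW// (lt_trans ap).
(* A segment ignores [g], hence the zero coefficients; the third piece is reduced to the point
   [b]. *)
have := cmp sg a p b b 0 0 w1 w2 0 ((p - a)^-1 *: (y - g a)) ((b - p)^-1 *: (g b - y)) 0
  a0 (ltW ap) (ltW pb) (lexx b) bd.
rewrite /piece_cost !sqnZ => /(_ _ _ _ _ _)/wrap[].
- by move=> t _ [ta|bt]; rewrite /sg ?ta// bt orbT.
- move=> t /andP[ta tb]; have tab : a <= t <= b by rewrite ta.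
  have [tp|/ltW pt] := leP t p.
    by rewrite sg1 ?ta//; apply: c1 => //; apply: l1in; rewrite ta.
  by rewrite sg2 ?pt//; apply: c2 => //; apply: l2in; rewrite pt.
- split=> [s t sI tI|t /andP[ta tp]].
    rewrite !sg1// scale0r add0r opprD addrACA subrr add0r -scalerBl scalerA.
    by rewrite (_ : l1 s - l1 t = (s - t) * (p - a)^-1)//; rewrite /l1; ring.
  by rewrite mul0r add0r sg1 ?(ltW ta) ?(ltW tp)//; apply: Lw1; apply: l1in; rewrite !ltW.
- split=> [s t sI tI|t /andP[tp tb]].
    rewrite !sg2// scale0r add0r opprD addrACA subrr add0r -scalerBl scalerA.
    by rewrite (_ : l2 s - l2 t = (s - t) * (b - p)^-1)//; rewrite /l2; ring.
  by rewrite mul0r add0r sg2 ?(ltW tp) ?(ltW tb)//; apply: Lw2; apply: l2in; rewrite !ltW.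
- split=> [s t|t /andP[bt /(lt_trans bt)]]; last by rewrite ltxx.
  rewrite -!eq_le => /eqP <- /eqP <-; rewrite subrr enorm0; exact: enorm_ge0.
move=> {}cmp; apply: (le_trans cmp); rewrite /sqn dotp0l -!/(sqn _).
have e1 : ((p - a)^-1) ^+ 2 * sqn (y - g a) * (p - a) = sqn (y - g a) / (p - a).
  by field; rewrite lt0r_neq0.
have e2 : ((b - p)^-1) ^+ 2 * sqn (g b - y) * (b - p) = sqn (g b - y) / (b - p).
  by field; rewrite lt0r_neq0.
rewrite !mulrDl e1 e2; lra.
Qed.

(** Projection does not raise the kinetic energy and fixes both endpoints, so a gain [kappa] of
    potential on an interval of positive length contradicts minimality. *)
Lemma proj_of_compare delta g kk pp rho : energies K h delta g kk pp ->
  compare_prop K h delta g kk pp rho -> proj_prop delta g rho.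
Proof.
move=> [_ kcat pcat _] cmp a p q b e kappa P a0 ap pq qb bd kappa0 pP ca cb close L1 L2.
pose sg t := if (a <= t) && (t <= b) then P t else g t.
have ab : a <= b by rewrite (le_trans ap)// (le_trans (ltW pq)).
have sga : P a = g a.
  apply: (is_proj_unique (pP a _)); last exact: is_proj_id.
  by rewrite lexx.
have sgb : P b = g b.
  apply: (is_proj_unique (pP b _)); last exact: is_proj_id.
  by rewrite lexx andbT.
have sgE t : a <= t <= b -> sg t = P t by rewrite /sg => ->.
have dom w x y : a <= x -> y <= b -> (forall t, x < t < y -> L (P t) <= L (g t) + w) ->
    piece_dom K h g sg 1 1 w 0 x y.
  move=> ax yb Lw; have sub t : x <= t <= y -> a <= t <= b.
    by move=> /andP[xt ty]; rewrite (le_trans ax xt) (le_trans ty yb).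
  split=> [s t /sub sI /sub tI|t /andP[xt ty]].
    by rewrite !sgE// scale1r scaler0 addr0; apply: is_proj_dist; exact: pP.
  rewrite mul1r sgE; last by apply: sub; rewrite !ltW.
  by apply: Lw; rewrite xt.
have q0 : 0 <= p by exact: le_trans ap.
have pq' := ltW pq.
have := cmp sg a p q b 1 1 0 (- kappa) 0 0 0 0 a0 ap (ltW pq) qb bd.
rewrite /piece_cost => /(_ _ _ _ _ _)/wrap[].
- move=> t _ [ta|bt]; rewrite /sg; case: ifP => // /andP[at_ tb].
    by have -> : t = a by apply/eqP; rewrite eq_le ta at_.
  by have -> : t = b by apply/eqP; rewrite eq_le tb bt.
- by move=> t tab; rewrite sgE// close.
- apply: dom => //; first by rewrite (le_trans pq').
  move=> t /andP[at_ tp]; rewrite addr0 L1// at_/=.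
  by rewrite (lt_le_trans tp)// (le_trans pq').
- by apply: dom.
- apply: dom => //; first by rewrite (le_trans ap).
  move=> t /andP[qt tb]; rewrite addr0 L1// tb andbT.
  by rewrite (le_lt_trans _ qt)// (le_trans ap).
rewrite /sqn !dotp0l (kcat a p b)// ?(kcat p q b)// ?(pcat a p b)// ?(pcat p q b)//; last first.
- by rewrite (le_trans pq').
- by rewrite (le_trans pq').
have : 0 < kappa * (q - p) by rewrite mulr_gt0// subr_gt0.
rewrite !expr1n => k1 k2; suff : (0 : R) < 0 by rewrite ltxx.
lra.
Qed.

Lemma one_sided_right delta g kk pp rho t0 : 0 <= t0 -> t0 <= delta ->
  energies K h delta g kk pp -> abs_cont 0 delta g -> compare_prop K h delta g kk pp rho ->
  one_sided (fun T => g (t0 + T)) (delta - t0) (fun s t => kk (t0 + s) (t0 + t))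
    (fun s t => pp (t0 + s) (t0 + t)) rho.
Proof.
move=> t0p t0d en gac cmp; have [kg kc pc pg] := en.
have ln := line_of_compare cmp; have pj := proj_of_compare en cmp.
have sh x y : t0 + y - (t0 + x) = y - x by ring.
have lo x : 0 <= x -> 0 <= t0 + x by move=> x0; rewrite addr_ge0.
have hi x : x <= delta - t0 -> t0 + x <= delta by rewrite lerBrDl.
have inI x y t : x <= t - t0 <= y -> t0 + x <= t <= t0 + y by move=> /andP[? ?]; apply/andP; split; lra.
split.
- split.
  + move=> x y u x0 xy yd; rewrite -(sh x y); apply: kg; rewrite ?lerD2l//; [exact: lo|exact: hi].
  + move=> x y z x0 xy yz zd; apply: kc; rewrite ?lerD2l//; [exact: lo|exact: hi].
  + move=> x y z x0 xy yz zd; apply: pc; rewrite ?lerD2l//; [exact: lo|exact: hi].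
  + move=> x y w x0 xy yd Lw; rewrite -(sh x y); apply: pg; rewrite ?lerD2l//; [exact: lo|exact: hi|].
    move=> t /andP[xt ty]; rewrite -[t](subrK t0) [_ + t0]addrC; apply: Lw; apply/andP; split; lra.
- move=> e e0; have d0 : 0 <= delta by exact: le_trans t0d.
  have [r r0 rP] := abs_cont_unif d0 gac e0; exists r => // s t /andP[s0 sd] /andP[t0' td] st.
  by apply: rP; rewrite ?lo ?hi// (_ : _ - _ = s - t)//; ring.
- move=> a p b w1 w2 y a0 ap pb bd L1 L2 c1 c2.
  rewrite -(sh a p) -(sh p b); apply: ln; rewrite ?ltrD2l//; [exact: lo|exact: hi|..].
    move=> t l tI lI; have := c1 (t - t0) l; rewrite [t0 + (t - t0)]addrC subrK; apply=> //.
    by move: tI => /andP[? ?]; apply/andP; split; lra.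
  move=> t l tI lI; have := c2 (t - t0) l; rewrite [t0 + (t - t0)]addrC subrK; apply=> //.
  by move: tI => /andP[? ?]; apply/andP; split; lra.
- move=> a p q b e kappa P a0 ap pq qb bd k0 pP ca cb close L1 L2.
  have back t : t0 + (t - t0) = t by ring.
  apply: (pj (t0 + a) (t0 + p) (t0 + q) (t0 + b) e kappa (fun t => P (t - t0)));
    rewrite ?lerD2l ?ltrD2l//; [exact: lo|exact: hi|..] => t /andP[t1 t2].
  + by have := pP (t - t0); rewrite back; apply; apply/andP; split; lra.
  + by have := close (t - t0); rewrite back; apply; apply/andP; split; lra.
  + by have := L1 (t - t0); rewrite back; apply; apply/andP; split; lra.
  + by have := L2 (t - t0); rewrite back; apply; apply/andP; split; lra.
Qed.

(** Reversal exchanges the ends of intervals, swaps the two segments of a broken line and changes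
    the sign of the test vector in [kin_ge]. *)
Lemma one_sided_left delta g kk pp rho t0 : 0 <= t0 -> t0 <= delta ->
  energies K h delta g kk pp -> abs_cont 0 delta g -> compare_prop K h delta g kk pp rho ->
  one_sided (fun T => g (t0 - T)) t0 (fun s t => kk (t0 - t) (t0 - s))
    (fun s t => pp (t0 - t) (t0 - s)) rho.
Proof.
move=> t0p t0d en gac cmp; have [kg kc pc pg] := en.
have ln := line_of_compare cmp; have pj := proj_of_compare en cmp.
have sh x y : t0 - x - (t0 - y) = y - x by ring.
have lo x : x <= t0 -> 0 <= t0 - x by move=> x0; rewrite subr_ge0.
have hi x : 0 <= x -> t0 - x <= delta by move=> x0; move: t0d; lra.
have back t : t0 - (t0 - t) = t by ring.
split.
- split.
  + move=> x y u x0 xy yd; rewrite -(sh x y) -(sqnN u) -[X in dotp u X]opprB dotpNr -dotpNl.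
    by apply: kg; rewrite ?lerB//; [exact: lo|exact: hi].
  + move=> x y z x0 xy yz zd; rewrite [RHS]addrC; apply: kc; rewrite ?lerB//; [exact: lo|exact: hi].
  + move=> x y z x0 xy yz zd; rewrite [RHS]addrC; apply: pc; rewrite ?lerB//; [exact: lo|exact: hi].
  + move=> x y w x0 xy yd Lw; rewrite -(sh x y); apply: pg; rewrite ?lerB//; [exact: lo|exact: hi|].
    by move=> t /andP[xt ty]; rewrite -(back t); apply: Lw; apply/andP; split; lra.
- move=> e e0; have d0 : 0 <= delta by exact: le_trans t0d.
  have [r r0 rP] := abs_cont_unif d0 gac e0; exists r => // s t /andP[s0 sd] /andP[t0' td] st.
  by apply: rP; rewrite ?lo ?hi// (_ : _ - _ = t - s); [rewrite distrC|ring].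
- move=> a p b w1 w2 y a0 ap pb bd L1 L2 c1 c2.
  have flip (x1 x2 : V) l : x1 + l *: (x2 - x1) = x2 + (1 - l) *: (x1 - x2).
    by rewrite scalerBl scale1r scalerBr scalerBr [RHS]addrA [x2 + (x1 - x2)]addrC subrK opprB.
  have fl (l : R) : 0 <= l <= 1 -> 0 <= 1 - l <= 1 by move=> /andP[? ?]; apply/andP; split; lra.
  rewrite [leRHS]addrC -(sh a p) -(sh p b) (sqnBC y) (sqnBC (g (t0 - b))).
  apply: (ln (t0 - b) (t0 - p) (t0 - a) w2 w1 y (lo _ bd) _ _ (hi _ a0)).
  + by rewrite ltrD2l ltrN2.
  + by rewrite ltrD2l ltrN2.
  + by move=> l /fl lI; rewrite flip L2.
  + by move=> l /fl lI; rewrite flip L1.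
  + move=> t l tI /fl lI; rewrite flip; have := c2 (t0 - t) (1 - l); rewrite back; apply=> //.
    by move: tI => /andP[? ?]; apply/andP; split; lra.
  + move=> t l tI /fl lI; rewrite flip; have := c1 (t0 - t) (1 - l); rewrite back; apply=> //.
    by move: tI => /andP[? ?]; apply/andP; split; lra.
- move=> a p q b e kappa P a0 ap pq qb bd k0 pP ca cb close L1 L2.
  apply: (pj (t0 - b) (t0 - q) (t0 - p) (t0 - a) e kappa (fun t => P (t0 - t)));
    rewrite ?lerB ?ltrD2l ?ltrN2//; [exact: lo|exact: hi|..] => t /andP[t1 t2].
  + by have := pP (t0 - t); rewrite back; apply; apply/andP; split; lra.
  + by have := close (t0 - t); rewrite back; apply; apply/andP; split; lra.
  + by have := L1 (t0 - t); rewrite back; apply; apply/andP; split; lra.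
  + by have := L2 (t0 - t); rewrite back; apply; apply/andP; split; lra.
Qed.

End OneSided.

(** * One-sided constancy of the optimality class *)

Lemma sqrt_small (R : realType) (C e : R) : 0 <= C -> 0 < e ->
  exists2 r, 0 < r & forall T, 0 <= T -> T <= r -> Num.sqrt (C * T) < e.
Proof.
move=> C0 e0; exists (e ^+ 2 / (C + 1)) => [|T T_0]; first by rewrite divr_gt0 ?exprn_gt0 ?ltr_wpDl.
rewrite ler_pdivlMr ?ltr_wpDl// => h.
rewrite -(ger0_norm (ltW e0)) -sqrtr_sqr ltr_sqrt ?exprn_gt0//.
have [T0|T0] := ltP 0 T; first by nra.
have -> : T = 0 by apply/le_anti; rewrite T0.
by rewrite mulr0 exprn_gt0.
Qed.

Lemma seq_argmin (R : realType) (T : eqType) (f : T -> R) (P : T -> Prop) (s : seq T) :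
  (exists2 e, e \in s & P e) -> exists e, [/\ e \in s, P e & forall e', e' \in s -> P e' -> f e <= f e'].
Proof.
elim: s => [[e]//|a s IHs] [e].
have [[e2 e2s Pe2] _ _|no] := pselect (exists2 e, e \in s & P e).
  have [e1 [e1s Pe1 e1P]] : exists e, [/\ e \in s, P e & forall e', e' \in s -> P e' -> f e <= f e'].
    by apply: IHs; exists e2.
  have [Pa|nPa] := pselect (P a); last first.
    exists e1; split; rewrite ?inE ?e1s ?orbT// => e'; rewrite inE => /orP[/eqP ->//|]; exact: e1P.
  have [fa|fa] := leP (f a) (f e1).
    exists a; split; rewrite ?mem_head// => e'; rewrite inE => /orP[/eqP -> //|es /(e1P _ es)].
    exact: le_trans.
  exists e1; split; rewrite ?inE ?e1s ?orbT// => e'; rewrite inE => /orP[/eqP -> _|]; last exact: e1P.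
  exact: ltW.
rewrite inE => /orP[/eqP -> Pa|es Pe]; last by case: no; exists e.
exists a; split; rewrite ?mem_head// => e'; rewrite inE => /orP[/eqP -> //|es Pe].
by case: no; exists e'.
Qed.

Lemma ray_arith (R : realType) (T b w1 w2 a c v w E P : R) :
  E + P <= (1 - b) * T * v + w1 * ((1 - b) * T) + (T * a + 2 * T * c + b * T * v + w2 * (b * T)) ->
  2 * (T * c + T * v) <= E + v * T -> w * T <= P ->
  T * w <= T * (w1 * (1 - b) + a + w2 * b).
Proof. by move=> h1 h2 h3; lra. Qed.

Section LocalConstancy.
Variables (R : realType) (d : nat) (K : seq 'rV[R]_d) (h h' : R -> R).
Hypotheses (K0 : K != [::]) (Ku : uniq K).
Hypotheses (hP : potential_shape h h') (hmono : forall s t : R, 0 <= s -> s < t -> h s < h t).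
Notation V := 'rV[R]_d.
Notation L := (pot K h).
Variables (z : R -> V) (T0 : R) (E P : R -> R -> R) (rho : R).
Hypotheses (os : one_sided K h z T0 E P rho) (T0_gt0 : 0 < T0) (rho0 : 0 < rho).
Notation x := (z 0).
Notation hs p := (h (p ^+ 2)).
Notation rad T := (Num.sqrt (E 0 T0 * T)).
(** Measured from the limit point [x] and not from [z T], so that only finitely many levels
    occur. *)
Notation lev T := (enorm (x - etaK K (z T))).

Lemma energy_ge0 s t : 0 <= s -> s <= t -> t <= T0 -> 0 <= E s t.
Proof.
move=> s0 st tT; have := kin_ge (os_energies os) 0 s0 st tT.
by rewrite /sqn !dotp0l; lra.
Qed.

(** [kin_ge] tested with the mean velocity: the Hölder bound of exponent 1/2 for paths of finite
    energy. *)
Lemma displacement (s T : R) : 0 <= s -> s <= T -> T <= T0 -> enorm (z s - x) <= rad T.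
Proof.
move=> s0 sT TT; have T_0 := le_trans s0 sT.
have E0 : 0 <= E 0 T0 by exact: energy_ge0 (ltW T0_gt0) _.
have [->|sn0] := eqVneq s 0; first by rewrite subrr enorm0 sqrtr_ge0.
have {sn0} sp : 0 < s by rewrite lt_neqAle eq_sym sn0.
rewrite enorm_le ?sqrtr_ge0// sqr_sqrtr ?mulr_ge0//.
have sT0 := le_trans sT TT.
have : sqn (z s - x) / s <= E 0 T0.
  rewrite (kin_cat (os_energies os) (lexx 0) s0 sT0 (lexx _)).
  have := energy_ge0 s0 sT0 (lexx _).
  have := kin_ge (os_energies os) (s^-1 *: (z s - x)) (lexx 0) s0 sT0.
  rewrite dotpZl -/(sqn _) sqnZ subr0 (_ : s^-1 ^+ 2 * _ * s = sqn (z s - x) / s); last first.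
    by field; rewrite lt0r_neq0.
  by rewrite [_^-1 * _]mulrC; lra.
by rewrite ler_pdivrMr// => /le_trans -> //; rewrite ler_wpM2l.
Qed.

Lemma rad_mono (s t : R) : 0 <= s -> s <= t -> rad s <= rad t.
Proof.
move=> s0 st; have E0 : 0 <= E 0 T0 by exact: energy_ge0 (ltW T0_gt0) _.
by rewrite ler_sqrt ?mulr_ge0 ?ler_wpM2l// (le_trans s0).
Qed.

(** [m] is the least level visited arbitrarily close to time 0, [c] the gap above it and [M] a
    Lipschitz constant of p -> h(p^2) on [[0, B]]. Up to time [T1] the potential error [M * rad] is
    small against the gain [hs (m + c) - hs m]. *)
Record levels (m c M B T1 : R) : Prop := Levels {
  lv_T1 : 0 < T1 <= T0 ;
  lv_m : 0 <= m ;
  lv_c : 0 < c ;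
  lv_M : 0 < M ;
  lv_lip : forall p q, 0 <= p <= B -> 0 <= q <= B -> `|hs p - hs q| <= M * `|p - q| ;
  lv_opt : forall T, 0 <= T <= T1 -> {subset opt K (z T) <= opt K x} ;
  lv_lev : forall T, 0 < T <= T1 -> lev T = m \/ m + c <= lev T ;
  lv_levB : forall T, 0 < T <= T1 -> lev T + 1 <= B ;
  lv_rho : 3 * rad T1 < rho ;
  lv_rad : rad T1 <= 1 ;
  lv_small : 2 * M * rad T1 < (hs (m + c) - hs m) / 64 ;
  lv_freq : forall r, 0 < r -> exists T, [/\ 0 < T < r, T <= T1 & lev T = m] }.

Lemma levels_exist : exists m c M B T1 e1, [/\ levels m c M B T1, enorm (x - e1) = m,
  forall r, 0 < r -> exists T, [/\ 0 < T < r, T <= T1 & etaK K (z T) = e1] &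
  forall T, 0 < T <= T1 -> forall r, 0 < r -> exists T', [/\ 0 < T' < r, T' <= T1 & etaK K (z T') = etaK K (z T)]].
Proof.
have [S SP] := etaK_range K0 Ku.
pose vis e := forall r, 0 < r -> exists T, [/\ 0 < T < r, T <= T0 & etaK K (z T) = e].
(* Values of [eta] that are not visited arbitrarily close to time 0 no longer occur before [Ta]. *)
have [||Ta Ta0 TaP] := @unif_radius R _ S (fun e r => vis e \/ forall T, 0 < T < r -> T <= T0 -> etaK K (z T) != e).
- move=> e r r' [v|nv] r'0 rr; [by left|right=> T /andP[T_0 Tr]].
  by apply: nv; rewrite T_0 (lt_le_trans Tr).
- move=> e _; have [v|/existsNP[r /not_implyP[r0 nv]]] := pselect (vis e).
    by exists 1 => //; left.
  exists r => //; right=> T Tr TT; apply/eqP => eT; apply: nv; exists T; by split.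
have visT T : 0 < T < Ta -> T <= T0 -> vis (etaK K (z T)).
  by move=> TT TT0; have [//|/(_ T TT TT0)] := TaP _ (SP (z T)); rewrite eqxx.
have [|e1 [e1S e1v e1min]] := @seq_argmin R _ (fun e => enorm (x - e)) vis S.
  pose T := Num.min Ta T0 / 2; exists (etaK K (z T)); first exact: SP.
  have mn : 0 < Num.min Ta T0 by rewrite lt_min Ta0.
  have : T < Num.min Ta T0 by rewrite /T; lra.
  rewrite lt_min => /andP[T1 T2]; apply: visT; last exact: ltW.
  by rewrite T1 divr_gt0.
pose m := enorm (x - e1).
have [||c c0 cP] := @unif_radius R _ S (fun e r => enorm (x - e) <= m \/ m + r <= enorm (x - e)).
- by move=> e r r' [hm|hm] r'0 rr; [left|right; rewrite (le_trans _ hm)// lerD2l].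
- move=> e _; have [me|me] := leP (enorm (x - e)) m; first by exists 1 => //; left.
  by exists (enorm (x - e) - m); rewrite ?subr_gt0//; right; rewrite addrC subrK.
have m0 : 0 <= m by exact: enorm_ge0.
have [B0 B0P] : exists B0, forall e, e \in S -> enorm (x - e) <= B0.
  elim: (S) => [|e s [B0 IH]]; first by exists 0.
  exists (Num.max B0 (enorm (x - e))) => e'; rewrite inE le_max => /orP[/eqP ->|/IH ->//].
  by rewrite lexx orbT.
pose B := B0 + 1.
have B_0 : 0 <= B by rewrite /B addr_ge0// (le_trans _ (B0P _ e1S))// enorm_ge0.
have [M M0 MP] := shape_sq_lip hP B_0.
have kap : 0 < hs (m + c) - hs m.
  by rewrite subr_gt0; apply: hmono; rewrite ?sqr_ge0// ltr_sqr ?nnegrE//; lra.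
have [r1 r10 r1P] := opt_near K0 x.
have E0 : 0 <= E 0 T0 by exact: energy_ge0 (ltW T0_gt0) _.
(* In order: inclusion of optimality classes, competitors close to the path, [rad <= 1] for the
   range of the Lipschitz bound, and the potential error against the level gap. *)
pose e := Num.min r1 (Num.min (rho / 3) (Num.min 1 ((hs (m + c) - hs m) / 64 / (2 * M)))).
have e0 : 0 < e by rewrite !lt_min r10 ltr01 !divr_gt0// mulr_gt0.
have [Tb Tb0 TbP] := sqrt_small E0 e0.
pose T1 := Num.min Tb (Num.min (Ta / 2) T0).
have T1p : 0 < T1 by rewrite !lt_min Tb0 T0_gt0 divr_gt0.
have T1T0 : T1 <= T0 by rewrite !ge_min lexx !orbT.
have T1a : T1 < Ta.
  have : T1 <= Ta / 2 by rewrite !ge_min lexx !orbT.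
  by move: Ta0; lra.
have := TbP T1 (ltW T1p); rewrite ge_min lexx => /(_ isT).
rewrite 3!lt_min => /and4P[q1 q2 q3 q4].
have vis1 e' : vis e' -> forall r, 0 < r -> exists T, [/\ 0 < T < r, T <= T1 & etaK K (z T) = e'].
  move=> v r r0; have [|T [/andP[T_0 Tr] _ eT]] := v (Num.min r T1); first by rewrite lt_min r0.
  by move: Tr; rewrite lt_min => /andP[Tr /ltW TT]; exists T; rewrite T_0.
exists m, c, M, B, T1, e1; split => //.
- split => //.
  + by rewrite T1p.
  + move=> T /andP[T_0 TT]; apply: r1P; apply: le_lt_trans q1.
    exact: displacement.
  + move=> T /andP[T_0 TT].
    have vT : vis (etaK K (z T)) by apply: visT; rewrite ?T_0 ?(le_lt_trans TT)// (le_trans TT).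
    have [le|] := cP _ (SP (z T)); last by right.
    by left; apply/le_anti; rewrite le e1min.
  + by move=> T _; rewrite /B lerD2r B0P.
  + by move: q2; rewrite ltr_pdivlMr//; lra.
  + exact: ltW.
  + by move: q4; rewrite ltr_pdivlMr ?mulr_gt0//; lra.
  + by move=> r r0; have [T [? ? eT]] := vis1 _ e1v r r0; exists T; rewrite eT.
- by move=> r r0; exact: vis1.
- move=> T /andP[T_0 TT] r r0; apply: vis1 => //; apply: visT; rewrite ?T_0 ?(le_lt_trans TT)//.
  exact: le_trans TT _.
Qed.

Section Levels.
Variables (m c M B T1 : R).
Hypothesis lv : levels m c M B T1.

(** [lev s] differs from the distance of [z s] to its own [eta] by at most the displacement; [B]
    exceeds every level by 1 so that both lie in the range of [lv_lip]. *)
Lemma pot_low (s T : R) : 0 < s -> s <= T -> T <= T1 -> hs (lev s) - M * rad T <= L (z s).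
Proof.
move=> s0 sT TT; have sT1 : 0 < s <= T1 by rewrite s0 (le_trans sT).
have /andP[_ T1T0] := lv_T1 lv.
have dis := displacement (ltW s0) sT (le_trans TT T1T0).
have r1 : rad T <= 1 by apply: le_trans (lv_rad lv); apply: rad_mono => //; rewrite (le_trans (ltW s0)).
have b1 := lv_levB lv sT1.
rewrite (potE h K0 Ku); set q := enorm (z s - _).
have q0 : 0 <= q by exact: enorm_ge0.
have l0 : 0 <= lev s by exact: enorm_ge0.
have ql : `|lev s - q| <= rad T.
  rewrite (le_trans (ler_enorm_dist _ _))// opprB addrA subrK enormB//.
have := lv_lip lv (p := lev s) (q := q).
rewrite l0 q0 /= => /(_ _ _)/wrap[||hq].
- by move: b1; lra.
- by move: ql; rewrite ler_norml => /andP[? ?]; lra.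
have := le_trans hq (ler_wpM2l (ltW (lv_M lv)) ql).
by rewrite ler_norml => /andP[? ?]; lra.
Qed.

Lemma pot_low_min (s T : R) : 0 < s -> s <= T -> T <= T1 -> hs m - M * rad T <= L (z s).
Proof.
move=> s0 sT TT; rewrite (le_trans _ (pot_low s0 sT TT))// lerD2r.
apply: (shape_le hmono); rewrite ?sqr_ge0// ler_sqr ?nnegrE ?(lv_m lv) ?enorm_ge0//.
have [|->//|] := lv_lev lv (T := s); first by rewrite s0 (le_trans sT).
have := lv_c lv; lra.
Qed.

Lemma pot_low_gap (s T : R) : 0 < s -> s <= T -> T <= T1 -> lev s <> m ->
  hs (m + c) - M * rad T <= L (z s).
Proof.
move=> s0 sT TT ns; rewrite (le_trans _ (pot_low s0 sT TT))// lerD2r.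
have := lv_c lv; have := lv_m lv => m0 c0.
apply: (shape_le hmono); rewrite ?sqr_ge0// ler_sqr ?nnegrE ?enorm_ge0 ?addr_ge0 ?(ltW c0)//.
by have [|//|] := lv_lev lv (T := s); first by rewrite s0 (le_trans sT).
Qed.

Lemma level_cell (T : R) : 0 < T -> T <= T1 -> cell K (etaK K (z T)) x.
Proof.
move=> T_0 TT; have sub : {subset opt K (z T) <= opt K x} by apply: (lv_opt lv); rewrite ltW.
exact: (conv_mono K0 sub (etaK_conv K0 Ku _)).
Qed.

Lemma pot_near e y (r : R) : cell K e y -> enorm (x - e) = m -> enorm (y - x) <= r -> r <= 1 ->
  L y <= hs m + M * r.
Proof.
move=> ey em yr r1; rewrite (le_trans (pot_le_cell K0 Ku hmono ey))//.
have [T [/andP[T_0 _] TT lT]] := lv_freq lv ltr01.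
have b1 : m + 1 <= B by rewrite -lT (lv_levB lv)// T_0.
have q0 : 0 <= enorm (y - e) by exact: enorm_ge0.
have ql : `|enorm (y - e) - m| <= r.
  by rewrite -em (le_trans (ler_enorm_dist _ _))// opprB addrA subrK.
have := lv_lip lv (p := enorm (y - e)) (q := m).
rewrite q0 (lv_m lv) /= => /(_ _ _)/wrap[||hq].
- by move: ql; rewrite ler_norml => /andP[? ?]; lra.
- by move: b1; lra.
have := le_trans hq (ler_wpM2l (ltW (lv_M lv)) ql).
by rewrite ler_norml => /andP[? ?]; lra.
Qed.

Notation vel T := (T^-1 *: (z T - x)).

Lemma velE (T : R) : 0 < T -> z T - x = T *: vel T.
Proof. by move=> T_0; rewrite scalerA mulfV ?scale1r// lt0r_neq0. Qed.

(** Both [x] and [z T] lie in the convex cell of [eta (z T)], so the segment between them does, and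
    its potential is near [hs m]. *)
Lemma line_cost (T : R) : 0 < T -> T <= T1 -> lev T = m ->
  E 0 T + P 0 T <= T * sqn (vel T) + (hs m + M * rad T) * T.
Proof.
move=> T_0 TT lT; have /andP[_ T1T0] := lv_T1 lv; have TT0 := le_trans TT T1T0.
have dis := displacement (ltW T_0) (lexx T) TT0.
have rT : rad T <= rad T1 by apply: rad_mono => //; exact: ltW.
have r1 := le_trans rT (lv_rad lv); have r0 : 0 <= rad T by exact: sqrtr_ge0.
(* One segment, cut at its midpoint to fit the two-segment form of [os_line]. *)
pose y := x + 2^-1 *: (z T - x).
have [_ cx] := cell_closed_convex K0 Ku (level_cell T_0 TT).
have seg l : 0 <= l <= 1 -> L (x + l *: (z T - x)) <= hs m + M * rad T /\
    enorm (x + l *: (z T - x) - x) <= rad T.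
  move=> lI; have dl : enorm (x + l *: (z T - x) - x) <= rad T.
    rewrite addrAC subrr add0r enormZ (le_trans _ dis)//.
    by case/andP: lI => l0 l1; rewrite ger0_norm// ler_piMl ?enorm_ge0.
  split => //; apply: (pot_near (e := etaK K (z T))) => //.
  apply: cx => //; first exact: level_cell.
  exact: etaK_conv.
have y1 l : x + l *: (y - x) = x + (l / 2) *: (z T - x).
  by rewrite /y addrAC subrr add0r scalerA.
have y2 l : y + l *: (z T - y) = x + (2^-1 + l / 2) *: (z T - x).
  have -> : z T - y = 2^-1 *: (z T - x).
    rewrite /y opprD addrA -[X in X - _]scale1r -scalerBl; congr (_ *: _); lra.
  by rewrite /y scalerA -addrA -scalerDl.
have close l t : 0 <= l <= 1 -> 0 <= t <= T -> enorm (x + l *: (z T - x) - z t) < rho.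
  move=> lI /andP[t0 tT]; rewrite (le_lt_trans (ler_enormB _ x _))//.
  have [_ dl] := seg l lI; have := displacement t0 tT TT0; rewrite enormB.
  by move: (lv_rho lv) rT r0; lra.
have := os_line os (a := 0) (p := T / 2) (b := T) (w1 := hs m + M * rad T)
  (w2 := hs m + M * rad T) (y := y) (lexx _).
move=> /(_ _ _ TT0 _ _ _ _)/wrap[].
- by rewrite divr_gt0.
- by lra.
- by move=> l /andP[l0 l1]; rewrite y1; apply: (proj1 (seg _ _)); apply/andP; split; lra.
- by move=> l /andP[l0 l1]; rewrite y2; apply: (proj1 (seg _ _)); apply/andP; split; lra.
- by move=> t l tI /andP[l0 l1]; rewrite y1; apply: close => //; apply/andP; split; lra.
- by move=> t l tI /andP[l0 l1]; rewrite y2; apply: close => //; apply/andP; split; lra.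
have -> : y - x = 2^-1 *: (z T - x) by rewrite /y addrAC subrr add0r.
have -> : z T - y = 2^-1 *: (z T - x).
  rewrite /y opprD addrA -[X in X - _]scale1r -scalerBl; congr (_ *: _); lra.
move=> /le_trans; apply; rewrite !sqnZ le_eqVlt; apply/orP; left; apply/eqP.
by field; rewrite lt0r_neq0.
Qed.

(** Test [kin_ge] with [vel s] on [[0, s]] and with [vel T] on [[s, T]]: the squares recombine into
    Jensen's bound plus a defect that measures the change of mean velocity. *)
Lemma kin_excess (s T : R) : 0 < s -> s <= T -> T <= T0 ->
  T * sqn (vel T) + s * sqn (vel s - vel T) <= E 0 T.
Proof.
move=> s0 sT TT; have T_0 := lt_le_trans s0 sT.
have [_ kc _ _] := os_energies os; have kg := kin_ge (os_energies os).
rewrite (kc 0 s T)//; last exact: ltW.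
have es := velE s0; have eT := velE T_0.
move: (vel s) (vel T) es eT => W U es eT.
have := kg 0 s W (lexx _) (ltW s0) (le_trans sT TT).
have := kg s T U (ltW s0) sT TT.
have -> : z T - z s = T *: U - s *: W by rewrite -es -eT opprB addrA subrK.
rewrite es subr0 dotpDr dotpNr !dotpZr sqnB -!/(sqn _) (dotpC W).
lra.
Qed.

(** Jensen's bound cancels the kinetic part of [line_cost]; the remaining slack must pay for the
    time spent above level [m]. *)
Lemma gap_short (p q T : R) : 0 < p -> p <= q -> q <= T -> T <= T1 -> lev T = m ->
  (forall s, p < s < q -> lev s <> m) ->
  (hs (m + c) - hs m) * (q - p) <= 2 * M * rad T * T.
Proof.
move=> p0 pq qT TT lT gap; have T_0 : 0 < T by rewrite (lt_le_trans p0)// (le_trans pq).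
have /andP[_ T1T0] := lv_T1 lv; have TT0 := le_trans TT T1T0.
have pT := le_trans pq qT; have q0 := le_trans (ltW p0) pq.
have [_ _ pc pg] := os_energies os.
have := line_cost T_0 TT lT.
have := kin_excess T_0 (lexx T) TT0; rewrite subrr /(sqn 0) dotp0l mulr0 addr0.
rewrite (pc 0 p T) ?(ltW p0)// (pc p q T) ?(ltW p0)//.
have := pg 0 p (hs m - M * rad T) (lexx _) (ltW p0) (le_trans pT TT0).
move=> /(_ _)/wrap[t /andP[t0 tp]|h1].
  by apply: pot_low_min => //; rewrite (le_trans (ltW tp)).
have := pg q T (hs m - M * rad T) q0 qT TT0.
move=> /(_ _)/wrap[t /andP[t0 tp]|h2].
  by apply: pot_low_min => //; [exact: le_lt_trans t0|exact: ltW].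
have := pg p q (hs (m + c) - M * rad T) (ltW p0) pq (le_trans qT TT0).
move=> /(_ _)/wrap[t /andP[t0 tp]|h3].
  apply: pot_low_gap => //; [exact: lt_trans t0|by rewrite (le_trans (ltW tp))|].
  by apply: gap; rewrite t0.
nra.
Qed.

(** The same slack, now spent on the kinetic defect. *)
Lemma vel_close (s T : R) : 0 < s -> s <= T -> T <= T1 -> lev T = m ->
  s * sqn (vel s - vel T) <= 2 * M * rad T * T.
Proof.
move=> s0 sT TT lT; have T_0 := lt_le_trans s0 sT.
have /andP[_ T1T0] := lv_T1 lv; have TT0 := le_trans TT T1T0.
have := line_cost T_0 TT lT; have := kin_excess s0 sT TT0.
have := pot_ge (os_energies os) (w := hs m - M * rad T) (lexx _) (ltW T_0) TT0.
move=> /(_ _)/wrap[t /andP[t0 tp]|]; last by lra.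
by apply: pot_low_min => //; exact: ltW.
Qed.

(** If level [m] were avoided throughout the window, of length 3T/64, the cost would exceed the
    slack, which [lv_small] keeps below T/64 times the level gap. *)
Lemma dense (T : R) : 0 < T -> T <= T1 -> lev T = m ->
  exists s, [/\ T / 64 <= s, s <= T / 16 & lev s = m].
Proof.
move=> T_0 TT lT; apply: contrapT => no.
have := @gap_short (T / 64) (T / 16) T; move=> /(_ _ _ _ TT lT _)/wrap[||||].
- by rewrite divr_gt0.
- by lra.
- by lra.
- move=> s /andP[s1 s2] ls; apply: no; exists s; split => //; exact: ltW.
have rT : rad T <= rad T1 by apply: rad_mono => //; exact: ltW.
have := lv_small lv => sm.
have : 2 * M * rad T < (hs (m + c) - hs m) / 64.
  by apply: le_lt_trans sm; rewrite ler_wpM2l// mulr_ge0// ltW// (lv_M lv).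
move=> q1 q2; suff : (0 : R) < 0 by rewrite ltxx.
have : 0 < ((hs (m + c) - hs m) / 64 - 2 * M * rad T) * T by rewrite mulr_gt0// subr_gt0.
have : 0 <= 2 * M * rad T * T.
  by rewrite !mulr_ge0 ?sqrtr_ge0 ?(ltW T_0)// (ltW (lv_M lv)).
lra.
Qed.

Variable N : R.
(** 128 is 2 times 64: the slack [2 * M * rad T * T] of [vel_close] is divided by a time at least
    T/64. *)
Hypothesis NE : N = 128 * M.
Notation om T := (Num.sqrt (N * rad T)).

Lemma om_arg (T : R) : 0 <= N * rad T.
Proof. by rewrite NE !mulr_ge0 ?sqrtr_ge0// ltW// (lv_M lv). Qed.

(** [om] is a multiple of the fourth root of time, so a factor 16 in time halves it. *)
Lemma om_quarter (s T : R) : 0 < s -> s <= T / 16 -> om s <= om T / 2.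
Proof.
move=> s0 sT; have E0 : 0 <= E 0 T0 by exact: energy_ge0 (ltW T0_gt0) _.
have T_0 : 0 < T by move: sT s0; lra.
have h2 : rad s <= rad T / 4.
  rewrite -(@ler_sqr R) ?nnegrE ?divr_ge0 ?sqrtr_ge0// exprMn !sqr_sqrtr ?mulr_ge0 ?(ltW s0) ?(ltW T_0)//.
  by nra.
have N0 : 0 <= N by rewrite NE mulr_ge0// ltW// (lv_M lv).
rewrite -(@ler_sqr R) ?nnegrE ?divr_ge0 ?sqrtr_ge0// exprMn !sqr_sqrtr ?om_arg//.
by nra.
Qed.

Lemma vel_near (s T : R) : 0 < s -> s <= T -> T <= T1 -> lev T = m -> T / 64 <= s ->
  enorm (vel s - vel T) <= om T.
Proof.
move=> s0 sT TT lT Ts; have T_0 := lt_le_trans s0 sT.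
rewrite enorm_le ?sqrtr_ge0// sqr_sqrtr ?om_arg// NE.
have := vel_close s0 sT TT lT; have := sqn_ge0 (vel s - vel T).
set a := sqn _ => a0 h1.
have r0 : 0 <= rad T by exact: sqrtr_ge0.
have := lv_M lv; set b := rad T in h1 r0 * => M0.
have h2 : T * a <= T * (128 * M * b) by nra.
by rewrite ler_pM2l in h2.
Qed.

(** Descend along visits to level [m] that each divide the time by at least 16: [om] halves at every
    step and the series sums to [2 * om T]. [n] bounds the number of steps. *)
Lemma vel_cauchy n (s T : R) : 0 < s -> s <= T -> T <= T1 -> lev T = m -> T / 16 ^+ n <= s ->
  enorm (vel s - vel T) <= 2 * om T.
Proof.
elim: n T => [|n IHn] T s0 sT TT lT Ts.
  rewrite expr0 divr1 in Ts; have -> : s = T by apply/le_anti; rewrite sT.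
  by rewrite subrr enorm0 mulr_ge0 ?sqrtr_ge0.
have T_0 := lt_le_trans s0 sT.
have [T' [T1' T2' lT']] := dense T_0 TT lT.
have [h1|h1] := leP T' s.
  by rewrite (le_trans (vel_near s0 sT TT lT (le_trans T1' h1)))// ler_peMl ?sqrtr_ge0// ler1n.
have T'0 := lt_trans s0 h1.
have T'T : T' <= T by clear lT lT' Ts; move: T2' T_0; lra.
have := IHn T' s0 (ltW h1) (le_trans T'T TT) lT'.
move=> /(_ _)/wrap[|h2].
  apply: le_trans Ts; rewrite exprS invfM mulrA ler_wpM2r// invr_ge0 exprn_ge0//.
have := vel_near T'0 T'T TT lT T1'.
have := om_quarter T'0 T2'; have := ler_enormB (vel s) (vel T') (vel T).
clear Ts lT lT'; move: h2; move: (om s) (om T) (om T') => o1 o2 o3; lra.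
Qed.

(** In each coordinate the values of [vel - 2 om] lie below all values of [vel + 2 om]; their
    supremum is the limit. The factor [d] comes from summing the coordinates. *)
Lemma vel_limit : exists v0 : V, forall T : R, 0 < T -> T <= T1 -> lev T = m ->
  enorm (vel T - v0) <= d%:R * (2 * om T).
Proof.
have vc (s T : R) : 0 < s -> s <= T -> T <= T1 -> lev T = m -> enorm (vel s - vel T) <= 2 * om T.
  move=> s0 sT TT lT; have := upper_nthrootP (leqnn (Num.bound (T / s))).
  set n := Num.bound _; rewrite ltr_pdivrMr// => nP.
  apply: (vel_cauchy (n := n)) => //; rewrite ler_pdivrMr ?exprn_gt0//.
  rewrite mulrC; apply: le_trans (ltW nP) _; rewrite ler_wpM2r ?(ltW s0)//.
  by rewrite lerXn2r// ?nnegrE ?ler_nat.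
pose A i := [set y | exists T : R, [/\ 0 < T, T <= T1, lev T = m & y = vel T ord0 i - 2 * om T]].
have ub i T : 0 < T -> T <= T1 -> lev T = m -> ubound (A i) (vel T ord0 i + 2 * om T).
  move=> T_0 TT lT y [T' [T'0 TT' lT' ->]].
  have := sqrtr_ge0 (N * rad T); have := sqrtr_ge0 (N * rad T').
  have [h1|/ltW h1] := leP T T'.
    have := le_trans (coord_enorm _ i) (vc _ _ T_0 h1 TT' lT').
    clear lT lT'; move: (om T) (om T') => o1 o2; rewrite !mxE ler_norml => /andP[? ?] ? ?; lra.
  have := le_trans (coord_enorm _ i) (vc _ _ T'0 h1 TT lT).
  by clear lT lT'; move: (om T) (om T') => o1 o2; rewrite !mxE ler_norml => /andP[? ?] ? ?; lra.
exists (\row_i sup (A i)) => T T_0 TT lT.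
rewrite (le_trans (enorm_le_sum _))// mulr_natl -[X in _ *+ X]card_ord -sumr_const.
have Ay i : A i (vel T ord0 i - 2 * om T) by exists T.
apply: ler_sum => i _.
have hs : has_sup (A i) by split; [exists (vel T ord0 i - 2 * om T)|exists (vel T ord0 i + 2 * om T); exact: ub].
have := sup_upper_bound hs (Ay i); have := ge_sup (proj1 hs) (ub i T T_0 TT lT).
move: (om T) => o; rewrite !mxE ler_norml => *; apply/andP; split; lra.
Qed.

Lemma om_small e : 0 < e -> exists2 r, 0 < r & forall T, 0 <= T -> T <= r -> om T < e.
Proof.
have E0 : 0 <= E 0 T0 by exact: energy_ge0 (ltW T0_gt0) _.
have N0 : 0 <= N by rewrite NE mulr_ge0// ltW// (lv_M lv).
move=> e0; have [r r0 rP] := sqrt_small N0 e0; have [r' r'0 r'P] := sqrt_small E0 r0.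
by exists r' => // T T_0 Tr; apply: rP; rewrite ?sqrtr_ge0// ltW// r'P.
Qed.

Notation visited e := (forall r, 0 < r -> exists T, [/\ 0 < T < r, T <= T1 & etaK K (z T) = e]).

Lemma visited_conv e : visited e -> conv (opt K x) e.
Proof. by move=> vis; have [T [/andP[T_0 _] TT <-]] := vis 1 ltr01; exact: level_cell. Qed.

(** At times when [eta] equals [e], [e] is a convex combination of points optimal at [z T], whence
    [dotp (k - e) (z T - x) <= 0]; divide by [T] and let such times tend to 0. *)
Lemma limit_direction v0 e k :
  (forall T : R, 0 < T -> T <= T1 -> lev T = m -> enorm (vel T - v0) <= d%:R * (2 * om T)) ->
  enorm (x - e) = m -> visited e -> k \in opt K x -> dotp (k - e) v0 <= 0.
Proof.
move=> v0P em vis kx; rewrite leNgt; apply/negP => dpos.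
have n0 : 0 < (enorm (k - e) + 1) * (d%:R * 2 + 1).
  by rewrite mulr_gt0// ltr_wpDl ?enorm_ge0// mulr_ge0.
have [r r0 rP] := om_small (e := dotp (k - e) v0 / ((enorm (k - e) + 1) * (d%:R * 2 + 1))) (divr_gt0 dpos n0).
have [T [/andP[T_0 Tr] TT eT]] := vis r r0.
have := rP T (ltW T_0) (ltW Tr); rewrite ltr_pdivlMr// => small.
have lT : lev T = m by rewrite eT.
have ex : conv (opt K x) e by exact: visited_conv.
have := etaK_conv K0 Ku (z T); rewrite eT => /(conv_optKP K0 Ku _ ex)/(_ _ (opt_sub K0 kx)).
rewrite (qKD k x) (opt_qK K0 kx) lerD2l => hk.
have cs := normr_dotp (k - e) (vel T - v0); have vT := v0P T T_0 TT lT.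
have cs2 : `|dotp (k - e) (vel T - v0)| <= enorm (k - e) * (d%:R * (2 * om T)).
  by apply: le_trans cs _; rewrite ler_wpM2l ?enorm_ge0.
have hk' : dotp (k - e) (vel T) <= 0.
  by rewrite dotpZr dotpDl dotpNl pmulr_rle0 ?invr_gt0// subr_le0.
have h0 : dotp (k - e) v0 <= enorm (k - e) * (d%:R * (2 * om T)).
  by move: cs2; rewrite ler_norml dotpDr dotpNr => /andP[cs3 _]; clear lT em; lra.
move: h0 small (enorm_ge0 (k - e)) (sqrtr_ge0 (N * rad T)) (ler0n R d).
clear lT em rP vis hk cs cs2 hk' vT v0P dpos n0.
move: (d%:R : R) (om T) (enorm (k - e)) (dotp _ v0) => D o a b h1 h2 a0 o0 D0.
suff : (0 : R) < 0 by rewrite ltxx.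
have : 0 <= o * a by rewrite mulr_ge0.
have : 0 <= o * D by rewrite mulr_ge0.
by move: h1 h2 o0; lra.
Qed.

Lemma pot_segment e m' (s : R) (v0 : V) : cell K e (x + s *: v0) -> enorm (x - e) = m' -> m' + 1 <= B ->
  0 <= s -> s * enorm v0 <= 1 -> L (x + s *: v0) <= hs m' + M * (s * enorm v0).
Proof.
move=> ce em mB s0 s1; rewrite (le_trans (pot_le_cell K0 Ku hmono ce))//.
have q0 : 0 <= enorm (x + s *: v0 - e) by exact: enorm_ge0.
have m0 : 0 <= m' by rewrite -em enorm_ge0.
have ql : `|enorm (x + s *: v0 - e) - m'| <= s * enorm v0.
  rewrite -em (le_trans (ler_enorm_dist _ _))//.
  have -> : x + s *: v0 - e - (x - e) = s *: v0 by apply/rowP => i; rewrite !mxE; ring.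
  by rewrite enormZ ger0_norm.
clear em; have := lv_lip lv (p := enorm (x + s *: v0 - e)) (q := m').
rewrite q0 m0 /= => /(_ _ _)/wrap[||hq].
- by move: ql; rewrite ler_norml => /andP[? ?]; lra.
- by move: mB; lra.
have := le_trans hq (ler_wpM2l (ltW (lv_M lv)) ql).
by rewrite ler_norml => /andP[? ?]; lra.
Qed.

(* Run along the ray [x + s v0] up to time (1 - b) T, then join z T in a straight line: the
   terms linear in the velocities cancel. *)
Lemma ray_cost (T b w1 w2 : R) (v0 : V) : 0 < T -> T <= T1 -> 0 < b < 1 ->
  (forall s, 0 <= s <= T -> L (x + s *: v0) <= w1) ->
  (forall y, enorm (y - x) <= T * enorm v0 + rad T -> L y <= w2) ->
  T * enorm v0 + 2 * rad T < rho ->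
  hs m - M * rad T <= w1 * (1 - b) + sqn (vel T - v0) / b + w2 * b.
Proof.
move=> T_0 TT /andP[b0 b1] L1 L2 close.
have /andP[_ T1T0] := lv_T1 lv; have TT0 := le_trans TT T1T0.
have b1' : 0 < 1 - b by rewrite subr_gt0.
pose p := (1 - b) * T; have p0 : 0 < p by rewrite mulr_gt0.
have pT : p < T by rewrite /p gtr_pMl// gtrBl.
pose y := x + p *: v0.
have r0 : 0 <= rad T by exact: sqrtr_ge0.
have yx : y - x = p *: v0 by rewrite /y addrAC subrr add0r.
have dy : enorm (y - x) <= T * enorm v0.
  by rewrite yx enormZ ger0_norm ?(ltW p0)// ler_wpM2r ?enorm_ge0// ltW.
have s1 l : 0 <= l <= 1 -> 0 <= l * p <= T /\ x + l *: (y - x) = x + (l * p) *: v0.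
  move=> /andP[l0 l1]; rewrite yx scalerA; split => //.
  by rewrite mulr_ge0 ?(ltW p0)//= (le_trans _ (ltW pT))// ler_piMl// ltW.
have s2 l : 0 <= l <= 1 -> enorm (y + l *: (z T - y) - x) <= T * enorm v0 + rad T.
  move=> /andP[l0 l1].
  have -> : y + l *: (z T - y) - x = (1 - l) *: (y - x) + l *: (z T - x).
    by apply/rowP => i; rewrite !mxE; ring.
  have := displacement (ltW T_0) (lexx T) TT0 => dz.
  rewrite (le_trans (ler_enormD _ _))// !enormZ !ger0_norm ?subr_ge0// lerD//.
    by rewrite (le_trans _ dy)// ler_piMl ?enorm_ge0// gerBl.
  by rewrite (le_trans _ dz)// ler_piMl ?enorm_ge0.
have s3 t : 0 <= t <= T -> enorm (x - z t) <= rad T.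
  by move=> /andP[t0 tT]; rewrite enormB; exact: displacement.
have := os_line os (a := 0) (p := p) (b := T) (w1 := w1) (w2 := w2) (y := y) (lexx _).
move=> /(_ p0 pT TT0 _ _ _ _)/wrap[].
- by move=> l lI; have [lp ->] := s1 l lI; exact: L1.
- by move=> l lI; apply: L2; exact: s2.
- move=> t l tI lI; rewrite (le_lt_trans (ler_enormB _ x _))//.
  apply: le_lt_trans close; have := s3 t tI.
  have [/andP[lp lp'] ->] := s1 l lI; rewrite addrAC subrr add0r enormZ ger0_norm// => h1.
  have : l * p * enorm v0 <= T * enorm v0 by rewrite ler_wpM2r ?enorm_ge0.
  by move: h1 r0; lra.
- move=> t l tI lI; rewrite (le_lt_trans (ler_enormB _ x _))//.
  by apply: le_lt_trans close; have := s3 t tI; have := s2 l lI; lra.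
have := kin_ge (os_energies os) v0 (lexx _) (ltW T_0) TT0.
have := pot_ge (os_energies os) (w := hs m - M * rad T) (lexx _) (ltW T_0) TT0.
move=> /(_ _)/wrap[t /andP[t0 tT]|hp hk].
  by apply: pot_low_min => //; exact: ltW.
have zy : z T - y = T *: (vel T - v0) + (T - p) *: v0.
  rewrite scalerBr -velE// scalerBl addrA subrK /y opprD addrA //.
have zx : z T - x = T *: (vel T - v0) + T *: v0 by rewrite scalerBr subrK -velE.
move: (vel T) zx zy => U zx zy.
rewrite zy yx => hl; move: hk; rewrite zx; move: hl; move: (U - v0) => W.
have Tp : T - p = b * T by rewrite /p; ring.
 rewrite sqnZ sqnD !sqnZ !subr0 Tp dotpDr !dotpZr !dotpZl (dotpC W v0) -!/(sqn _).
have -> : p ^+ 2 * sqn v0 / p = p * sqn v0 by field; rewrite lt0r_neq0.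
have -> : (T ^+ 2 * sqn W + 2 * (b * T * (T * dotp v0 W)) + (b * T) ^+ 2 * sqn v0) / (b * T) =
    T * (sqn W / b) + 2 * T * dotp v0 W + b * T * sqn v0.
  by field; rewrite !lt0r_neq0.
move=> hl hk; rewrite -(ler_pM2l T_0).
by rewrite subr0 in hp; exact: ray_arith hl hk hp.
Qed.

(** By [limit_direction] both values maximize the product with [v0] over [opt K x], hence so does
    their midpoint, which therefore remains a subgradient along the ray. *)
Lemma no_two_minima e1 e2 : enorm (x - e1) = m -> enorm (x - e2) = m ->
  visited e1 -> visited e2 -> e1 = e2.
Proof.
move=> m1 m2 vis1 vis2; apply/eqP; apply: contrapT => /negP ne.
have /andP[T1p T1T0] := lv_T1 lv.
have [v0 v0P] := vel_limit.
have E0 : 0 <= E 0 T0 by exact: energy_ge0 (ltW T0_gt0) _.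
pose e := e1 + 2^-1 *: (e2 - e1).
have ex : conv (opt K x) e.
  by apply: conv_convex; [exact: visited_conv|exact: visited_conv|apply/andP; split; lra].
have [r r0 rP] := opt_near K0 x.
have ray s : 0 <= s -> s * enorm v0 < r -> cell K e (x + s *: v0).
  move=> s0 sr; apply/(conv_optP K0 Ku _ ex).
  have near : enorm (x + s *: v0 - x) < r by rewrite addrAC subrr add0r enormZ ger0_norm.
  have [k ky] := opt_nonempty K0 (x + s *: v0); have kx := rP _ near _ ky.
  rewrite -(opt_qK K0 ky) (qKD k x) (opt_qK K0 kx) lerD2l addrAC subrr add0r !dotpZr ler_wpM2l//.
  have := limit_direction v0P m1 vis1 kx; have := limit_direction v0P m2 vis2 kx.
  rewrite /e !dotpDl !dotpNl dotpZl dotpDl dotpNl; clear m1 m2; lra.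
have m0 := lv_m lv.
have [m' em] : exists m', enorm (x - e) = m' by exists (enorm (x - e)).
have m'0 : 0 <= m' by rewrite -em enorm_ge0.
have m'm : m' < m.
  have q : m' ^+ 2 = m ^+ 2 - sqn (e2 - e1) / 4.
    have -> : m ^+ 2 = (sqn (x - e1) + sqn (x - e2)) / 2.
      by rewrite -!enorm_sqr m1 m2; field.
    rewrite -em enorm_sqr /e.
    have -> : x - (e1 + 2^-1 *: (e2 - e1)) = 2^-1 *: ((x - e1) + (x - e2)).
      by apply/rowP => i; rewrite !mxE; field.
    have -> : e2 - e1 = (x - e1) - (x - e2) by apply/rowP => i; rewrite !mxE; ring.
    by move: (x - e1) (x - e2) => a b; rewrite sqnZ sqnD sqnB; field.
  have : 0 < sqn (e2 - e1).
    rewrite lt_neqAle sqn_ge0 andbT eq_sym; apply/negP => /eqP/sqn_eq0/eqP.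
    by rewrite subr_eq0 eq_sym (negPf ne).
  by move=> hpos; rewrite -(@ltr_sqr R m') ?nnegrE// q; move: hpos; clear em m1 m2 q; lra.
have mB : m + 1 <= B.
  by have [T [/andP[T_0 _] TT <-]] := lv_freq lv ltr01; rewrite (lv_levB lv)// T_0.
pose kap := hs m - hs m'.
have kap0 : 0 < kap by rewrite subr_gt0 hmono ?sqr_ge0// ltr_sqr ?nnegrE.
have [k kx] := opt_nonempty K0 x; have kK := opt_sub K0 kx.
pose Lm := hs (enorm (x - k) + 2).
have Lm0 : 0 <= Lm by apply: (shape_ge0 hP); exact: sqr_ge0.
have Lmax y : enorm (y - x) <= 2 -> L y <= Lm.
  move=> yx; rewrite (le_trans (pot_le_pt K0 Ku hmono y kK))//.
  apply: (shape_le hmono); rewrite ?sqr_ge0// ler_sqr ?nnegrE ?enorm_ge0 ?addr_ge0 ?enorm_ge0//.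
  by have := ler_enormB y x k; clear em m1 m2; move: yx; lra.
(* The joining segment takes the fraction [b] of the time and its potential is only bounded by [Lm];
   [b] is fixed before [T], so that this costs at most [kap / 4]. *)
pose b := Num.min 2^-1 (kap / 4 / (Lm + 1)).
have b0 : 0 < b by rewrite lt_min invr_gt0 ltr0n/= !divr_gt0// ltr_wpDl.
have b1 : b < 1 by apply: (@le_lt_trans _ _ 2^-1); rewrite ?ge_min ?lexx//; clear em m1 m2; lra.
have bL : Lm * b <= kap / 4.
  have : b <= kap / 4 / (Lm + 1) by rewrite ge_min lexx orbT.
  rewrite ler_pdivlMr ?ltr_wpDl// => h1; have : 0 <= b * 1 by rewrite mulr1 ltW.
  by clear em m1 m2; move: h1; lra.
(* The factor 4 d^2 comes from squaring the velocity error [d * (2 * om T)], which is then divided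
   by [b]. *)
pose e3 := Num.min 1 (kap * b / 4 / (4 * d%:R ^+ 2 + 1)).
have D0 : 0 <= 4 * d%:R ^+ 2 :> R by rewrite mulr_ge0// exprn_ge0.
have e30 : 0 < e3 by rewrite lt_min ltr01 divr_gt0 ?divr_gt0 ?mulr_gt0// ltr_wpDl.
have [ra ra0 raP] := om_small e30.
have M0 := lv_M lv.
have [rb rb0 rbP] := sqrt_small E0 (divr_gt0 kap0 (mulr_gt0 (ltr0n R 4 : 0 < 4%:R) M0)).
pose q := Num.min r (Num.min 1 (Num.min (rho / 3) (kap / 4 / M))).
have q0 : 0 < q by rewrite !lt_min r0 ltr01 !divr_gt0.
have n0 : 0 < enorm v0 + 1 by rewrite ltr_wpDl ?enorm_ge0.
have [|T [/andP[T_0 Tlt] TT lT]] := lv_freq lv (r := Num.min ra (Num.min rb (q / (enorm v0 + 1)))).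
  by rewrite !lt_min ra0 rb0 divr_gt0.
move: Tlt; rewrite !lt_min => /and3P[Ta Tb]; rewrite ltr_pdivlMr// => Tq.
have Tv : T * enorm v0 < q by apply: le_lt_trans Tq; rewrite ler_wpM2l ?(ltW T_0)// lerDl.
move: Tv; rewrite !lt_min => /and4P[Tv1 Tv2 Tv3]; rewrite ltr_pdivlMr// => Tv4.
have rT : rad T <= rad T1 by apply: rad_mono => //; exact: ltW.
have rT1 := lv_rad lv; have rrho := lv_rho lv.
have := @ray_cost T b (hs m' + M * (T * enorm v0)) Lm v0 T_0 TT.
rewrite b0 b1 => /(_ isT _ _ _)/wrap[].
- move=> s /andP[s0 sT].
  have sv : s * enorm v0 <= T * enorm v0 by rewrite ler_wpM2r ?enorm_ge0.
  apply: le_trans (pot_segment (m' := m') _ em _ s0 _) _.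
  + by apply: ray => //; exact: le_lt_trans Tv1.
  + by clear em m1 m2 lT; move: mB m'm; lra.
  + exact: le_trans (ltW Tv2).
  + by rewrite lerD2l ler_wpM2l// ltW.
- by move=> y yx; apply: Lmax; clear em m1 m2 lT; move: yx Tv2 rT rT1; lra.
- by clear em m1 m2 lT; move: Tv3 rT rrho; lra.
have hW : sqn (vel T - v0) / b <= kap / 4.
  rewrite ler_pdivrMr// -enorm_sqr; have := v0P T T_0 TT lT.
  have := raP T (ltW T_0) (ltW Ta); rewrite lt_min => /andP[+].
  rewrite ltr_pdivlMr ?ltr_wpDl// => o1 o2 hv.
  have o0 := sqrtr_ge0 (N * rad T).
  have : enorm (vel T - v0) ^+ 2 <= (d%:R * (2 * om T)) ^+ 2.
    by rewrite ler_sqr// nnegrE ?enorm_ge0// !mulr_ge0.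
  move: o0 o1 o2; move: (enorm (vel T - v0) ^+ 2) (om T) => a o o0 o1 o2.
  move=> /le_trans; apply; have -> : (d%:R * (2 * o)) ^+ 2 = o * (4 * d%:R ^+ 2 * o) :> R by ring.
  have : 4 * d%:R ^+ 2 * o <= 4 * d%:R ^+ 2 by rewrite ler_piMr// ltW.
  clear em m1 m2 lT; move=> /(ler_wpM2l o0); move: o1 o2; lra.
have := rbP T (ltW T_0) (ltW Tb); rewrite ltr_pdivlMr ?mulr_gt0// => hR.
have hm : 0 <= hs m' by apply: (shape_ge0 hP); exact: sqr_ge0.
have hv : 0 <= M * (T * enorm v0) by rewrite !mulr_ge0 ?enorm_ge0 ?ltW.
have hb : (hs m' + M * (T * enorm v0)) * (1 - b) <= hs m' + M * (T * enorm v0).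
  by rewrite ler_piMr ?addr_ge0// gerBl ltW.
(* Four errors, each at most a quarter of [kap] and two of them strictly less, against a gain of
   [kap]. *)
move: hb hW bL hR Tv4; rewrite /kap.
move: (sqn (vel T - v0) / b) (T * enorm v0) (rad T) (hs m) (hs m') (Lm * b) ((_ + _) * _).
clear em m1 m2 lT; move=> a1 a2 a3 a4 a5 a6 a7 h1 h2 h3 h4 h5 h6; suff : (0 : R) < 0 by rewrite ltxx.
lra.
Qed.

Lemma unique_min_constant e1 Tb : enorm (x - e1) = m -> visited e1 ->
  (forall T, 0 < T <= T1 -> lev T = m -> etaK K (z T) = e1) ->
  Tb <= T1 -> etaK K (z Tb) = e1 -> forall T, 0 < T <= Tb -> etaK K (z T) = e1.
Proof.
move=> m1 vis uniq1 Tb1 eb T /andP[T_0 TTb]; apply: contrapT => ne.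
have /andP[T1p T1T0] := lv_T1 lv; have TbT0 := le_trans Tb1 T1T0.
have TT1 := le_trans TTb Tb1; have Tb0 := lt_le_trans T_0 TTb.
have TTb' : T < Tb by rewrite lt_neqAle TTb andbT; apply/eqP => TE; apply: ne; rewrite TE.
have [Ta [/andP[Ta0 TaT] TaT1 ea]] := vis T T_0.
have lT : lev T <> m by move=> lT; apply: ne; apply: uniq1; rewrite ?T_0.
have lev1 : enorm (x - e1) < lev T.
  have := lv_c lv; have [||] := lv_lev lv (T := T) => //; first by rewrite T_0.
  by rewrite m1; clear m1 lT; lra.
clear lT; have [r r0 rP] := opt_near K0 (z T).
have [w w0 wP] := os_cont os r0.
have inT0 s : Ta <= s <= Tb -> 0 <= s <= T0.
  by move=> /andP[s1 s2]; rewrite (le_trans (ltW Ta0) s1) (le_trans s2 TbT0).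
(* If [e1] occurred near [T], it would lie in conv(opt(z T)), whose point nearest to [x] is
   [eta (z T)]; this contradicts [lev1]. *)
have far s : Ta < s < Tb -> `|s - T| < w -> lev s <> m.
  move=> /andP[s1 s2] sT ls; have s0 := lt_trans Ta0 s1.
  have es : etaK K (z s) = e1 by apply: (uniq1 s _ ls); rewrite s0 (le_trans (ltW s2)).
  have sub : {subset opt K (z s) <= opt K (z T)}.
    by apply: rP; apply: wP => //; apply: inT0; rewrite ?(ltW s1) ?(ltW s2) ?(ltW TaT).
  have := conv_mono K0 sub (etaK_conv K0 Ku (z s)); rewrite es => eT.
  have sub' : {subset opt K (z T) <= opt K x} by apply: (lv_opt lv); rewrite (ltW T_0).
  have := is_proj_pythagoras (etaK_sub K0 Ku sub') eT.
  move: lev1; rewrite enorm_lt_sqn; have := sqn_ge0 (e1 - etaK K (z T)).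
  by clear ls m1; move=> h1 h2 h3; (suff : (0 : R) < 0 by rewrite ltxx); lra.
have cx : cell K e1 x by exact: visited_conv.
have [clC cC] := cell_closed_convex K0 Ku cx.
pose Pr t := xget 0 [set p | is_proj (cell K e1) (z t) p].
have PrP t : is_proj (cell K e1) (z t) (Pr t).
  have [p pP] := is_proj_exists (z t) clC cC (ex_intro _ x cx).
  by rewrite /Pr; case: xgetP => [q _ //|/(_ p)].
have rb : rad Tb <= rad T1 by apply: rad_mono => //; exact: ltW.
have dis t : Ta <= t <= Tb -> enorm (z t - x) <= rad Tb.
  by move=> tI; have /andP[t0 _] := inT0 t tI; apply: displacement => //; case/andP: tI.
have dP t : Ta <= t <= Tb -> enorm (Pr t - x) <= rad Tb.
  by move=> tI; apply: le_trans (dis t tI); apply: is_proj_dist (PrP t) (is_proj_id cx).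
have LP t : Ta <= t <= Tb -> L (Pr t) <= hs m + M * rad Tb.
  move=> tI; apply: (pot_near (e := e1)) => //; first by case: (PrP t).
    exact: dP.
  exact: le_trans rb (lv_rad lv).
(* Half of the level gap is kept as gain; the other half absorbs the potential errors of the path
   and of its projection. *)
pose kap := (hs (m + c) - hs m) / 2.
have kap0 : 0 < kap.
  have := lv_c lv; have := lv_m lv => m0 c0.
  rewrite divr_gt0// subr_gt0 hmono ?sqr_ge0// ltr_sqr ?nnegrE ?ltrDl//.
  by rewrite addr_ge0// ltW.
have small : 2 * M * rad Tb < kap.
  apply: le_lt_trans (_ : 2 * M * rad T1 < _).
    by rewrite ler_wpM2l// mulr_ge0// ltW// (lv_M lv).
  have := lv_small lv; move: kap0; rewrite /kap; clear m1; lra.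
have gain t : Ta < t < Tb -> lev t <> m -> L (Pr t) <= L (z t) - kap.
  move=> /andP[t1 t2] lt; have := LP t; rewrite (ltW t1) (ltW t2) => /(_ isT).
  have := pot_low_gap (lt_trans Ta0 t1) (ltW t2) Tb1 lt.
  by move: small; rewrite /kap; clear m1 lev1 lt; lra.
pose p := Num.max Ta (T - w / 2); pose q := Num.min Tb (T + w / 2).
have w2 : 0 < w / 2 by rewrite divr_gt0.
have pj := os_proj os; rewrite /proj_prop in pj.
apply: (pj Ta p q Tb e1 kap Pr _ _ _ _ _ kap0 (fun t _ => PrP t)).
- exact: ltW.
- by rewrite le_max lexx.
- apply: (@lt_trans _ _ T); first by rewrite gt_max TaT gtrBl.
  by rewrite lt_min TTb' ltrDl.
- by rewrite ge_min lexx.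
- exact: TbT0.
- by rewrite /cell/= -ea; exact: etaK_conv.
- by rewrite /cell/= -eb; exact: etaK_conv.
- move=> t tI; apply: (le_lt_trans (ler_enormB _ x _)).
  have := dP t tI; have := dis t tI; rewrite (enormB (z t)).
  by move: rb (lv_rho lv) (sqrtr_ge0 (E 0 T0 * T1)); clear m1 lev1; lra.
(* At level [m] the path is already in the cell of [e1] and the projection fixes it; at the other
   times [gain] applies. *)
- move=> t tI; have [lt|/eqP/(gain t tI) hg] := eqVneq (lev t) m; last first.
    by rewrite (le_trans hg)// gerBl ltW.
  have et : etaK K (z t) = e1.
    apply: (uniq1 t _ lt); move: tI => /andP[t1 t2].
    by rewrite (lt_trans Ta0 t1) (le_trans (ltW t2)).
  have ct : cell K e1 (z t) by rewrite /cell/= -et; exact: etaK_conv.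
  by rewrite (is_proj_unique (PrP t) (is_proj_id ct)).
- move=> t /andP[]; rewrite gt_max lt_min => /andP[t1 t2] /andP[t3 t4].
  have tI : Ta < t < Tb by rewrite t1.
  apply: gain => //; apply: far => //.
  by rewrite ltr_norml; clear m1 lev1; apply/andP; split; lra.
Qed.

End Levels.

Lemma one_sided_constant : exists e r, [/\ 0 < r, r <= T0 &
  forall T, 0 < T <= r -> etaK K (z T) = e].
Proof.
have [m [c [M [B [T1 [e1 [lv m1 vis1 visT]]]]]]] := levels_exist.
have /andP[T1p T1T0] := lv_T1 lv.
have uniq1 T : 0 < T <= T1 -> lev T = m -> etaK K (z T) = e1.
  move=> TI lT; apply: (no_two_minima lv (erefl (128 * M))) => //; exact: visT.
have [Tb [/andP[Tb0 _] Tb1 eb]] := vis1 1 ltr01.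
exists e1, Tb; split => //; first exact: le_trans T1T0.
by apply: (unique_min_constant lv (e1 := e1)) => //; rewrite ?eb.
Qed.

End LocalConstancy.

(** * Regularity between shocks *)

(** The supremum of the endpoints reachable from [a] is reachable, and below [b] its own
    neighbourhood would extend it. This is the form of compactness used here. *)
Lemma cousin (R : realType) (a b : R) (Q : R -> R -> Prop) : a <= b ->
  (forall x y z, a <= x -> x <= y -> y <= z -> z <= b -> Q x y -> Q y z -> Q x z) ->
  (forall t, a <= t <= b -> exists2 r, 0 < r &
    forall x y, a <= x -> x <= t -> t <= y -> y <= b -> t - r < x -> y < t + r -> Q x y) ->
  Q a b.
Proof.
move=> ab Qcat Qloc.
have Qxx t : a <= t <= b -> Q t t.
  move=> /[dup] tI /andP[at_ tb]; have [r r0 rP] := Qloc t tI.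
  by apply: rP => //; rewrite ?ltrBlDr ltrDl.
pose S := [set t | a <= t <= b /\ Q a t].
have Sa : S a by split; [rewrite lexx|apply: Qxx; rewrite lexx].
have Sb : ubound S b by move=> t [/andP[]].
have hS : has_sup S by split; [exists a|exists b].
have sa : a <= sup S by exact: sup_upper_bound.
have sb : sup S <= b by apply: ge_sup => //; exists a.
have [|r r0 rP] := Qloc (sup S); first by rewrite sa.
have [t [/andP[ta tb] Qt] tr] := sup_adherent r0 hS.
have ts : t <= sup S by apply: sup_upper_bound => //; split=> //; rewrite ta.
pose y := Num.min b (sup S + r / 2).
have yb : y <= b by rewrite ge_min lexx.
have sy : sup S <= y by rewrite le_min sb lerDl divr_ge0// ltW.
have r2 : r / 2 < r by move: r0; lra.
have Qy : Q a y.
  apply: (Qcat a t y) => //; first exact: le_trans sy.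
  by apply: rP => //; rewrite (@le_lt_trans _ _ (sup S + r / 2)) ?ge_min ?lexx ?orbT// ltrD2l.
have [by_|ys] := leP b (sup S + r / 2).
  by move: Qy; rewrite /y min_l.
have : y <= sup S by apply: sup_upper_bound => //; split=> //; rewrite yb (le_trans sa).
rewrite /y min_r ?(ltW ys)// => h; suff : (0 : R) < 0 by rewrite ltxx.
by move: h r0; lra.
Qed.

(** McShane's extension: the upper envelope of the downward cones with vertices on the graph over
    [G]. *)
Lemma lipschitz_extension (R : realType) (G : set R) (f : R -> R) (C : R) : 0 <= C ->
  (forall s t, G s -> G t -> `|f s - f t| <= C * `|s - t|) ->
  exists2 g : R -> R, (forall s, G s -> g s = f s) & forall s t, `|g s - g t| <= C * `|s - t|.
Proof.
move=> C0 lip; have [[w Gw]|nG] := pselect (G !=set0); last first.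
  exists (fun=> 0) => [s Gs|s t]; first by case: nG; exists s.
  by rewrite subrr normr0 mulr_ge0.
pose A t := [set f s - C * `|t - s| | s in G].
have tri (s t t' : R) : `|t - s| <= `|t - t'| + `|t' - s|.
  by have := ler_normD (t - t') (t' - s); rewrite addrA subrK.
have ub t t' : forall y, A t y -> y <= f w + C * `|t - w|.
  move=> y [s Gs <-]; have := lip s w Gs Gw; have := ler_norm (f s - f w) => h1 h2.
  have := ler_wpM2l C0 (tri w s t); rewrite (distrC s t); move: h1 h2.
  by rewrite mulrDr; lra.
have hs t : has_sup (A t) by split; [exists (f w - C * `|t - w|), w|exists (f w + C * `|t - w|); exact: ub].
have le_sup s t : sup (A s) <= sup (A t) + C * `|s - t|.
  apply: ge_sup; first by case: (hs s).
  move=> _ [r Gr <-]; have : f r - C * `|t - r| <= sup (A t) by apply: sup_upper_bound => //; exists r.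
  have := ler_wpM2l C0 (tri r t s); rewrite (distrC t s) mulrDr; lra.
exists (fun t => sup (A t)) => [s Gs|s t].
  apply/le_anti/andP; split.
    apply: ge_sup; first by case: (hs s).
    move=> _ [r Gr <-]; have := lip r s Gr Gs; rewrite (distrC r s).
    by have := ler_norm (f r - f s); lra.
  apply: sup_upper_bound => //; exists s => //.
  by rewrite subrr normr0 mulr0 subr0.
by rewrite ler_norml; have := le_sup s t; have := le_sup t s; rewrite (distrC t s) => *; apply/andP; split; lra.
Qed.

(** * From a derivative that is Lipschitz on a set of full measure to class C^{1,1} *)

Section LipschitzDensity.
Variables (R : realType) (d : nat).
Notation V := 'rV[R]_d.
Notation mu := (@lebesgue_measure R).

Lemma has_int_ae_le (p q : R -> R) x y r r' : {ae mu, forall t, x < t < y -> p t <= q t} ->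
  has_int p x y r -> has_int q x y r' -> r <= r'.
Proof.
move=> pq [ip <-] [iq <-].
have mD : measurable (`]x, y]%classic : set R) by exact: measurable_itv.
rewrite -subr_ge0 -RintegralB// /Rintegral; pose D (t : R) := q t - p t.
change (0 <= fine (\int[mu]_(t in `]x, y]) (EFin \o D) t)).
have id : mu.-integrable `]x, y] (EFin \o D).
  by rewrite (_ : _ \o _ = (EFin \o q) \- (EFin \o p))%E//; exact: integrableB.
have md : measurable_fun `]x, y] (EFin \o D) by case/integrableP: id.
have -> : (\int[mu]_(t in `]x, y]) (EFin \o D) t = \int[mu]_(t in `]x, y]) (abse \o (EFin \o D)) t)%E.
  apply: ae_eq_integral => //; first exact: measurableT_comp.
  apply: ae_imp2 (ae_neq y) pq => t ty ht /=; rewrite in_itv/= => /andP[xt tle].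
  by rewrite ger0_norm// subr_ge0 ht// xt/= lt_neqAle ty.
by apply: fine_ge0; apply: integral_ge0 => t _; exact: abse_ge0.
Qed.

Lemma is_derive_quotient (g : R -> V) (t : R) (v : V) : is_derive t 1 g v ->
  forall e, 0 < e -> exists2 r, 0 < r & forall s, s != 0 -> `|s| < r ->
    enorm (s^-1 *: (g (t + s) - g t) - v) < e.
Proof.
move=> [dg <-] e e0.
have : (fun k => enorm (k^-1 *: (g (k *: 1 + t) - g t) - 'D_1 g t)) @ 0^' --> enorm ('D_1 g t - 'D_1 g t).
  apply: (@cvg_comp _ _ _ (fun k => k^-1 *: (g (k *: 1 + t) - g t) - 'D_1 g t) (@enorm R d)); last exact: enorm_continuous.
  by apply: cvgB; [exact: dg|exact: cvg_cst].
rewrite subrr enorm0 => /cvgrPdist_lt/(_ e e0)/nbhs_ballP[r /= r0 rP].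
exists r => // s s0 sr; have := rP s; rewrite /ball/= sub0r normrN => /(_ sr s0).
rewrite sub0r normrN ger0_norm ?enorm_ge0// [s *: 1](_ : _ = s) 1?[s + t]addrC//.
by rewrite /GRing.scale/= mulr1.
Qed.

(** The slope may be taken at any [w] of the interval, so one estimate covers quotients from either
    side and at the ends [a] and [b]. *)
Definition taylor_on a b (g g' : R -> V) (C : R) := forall x y w,
  a <= x -> x <= y -> y <= b -> x <= w <= y -> enorm (g y - g x - (y - x) *: g' w) <= C * (y - x) ^+ 2.

Lemma taylor_quotient a b (g g' : R -> V) (C : R) s t : taylor_on a b g g' C ->
  s != t -> a <= s <= b -> a <= t <= b -> enorm (g' t - (s - t)^-1 *: (g s - g t)) <= C * `|s - t|.
Proof.
move=> tay st /andP[sa sb] /andP[ta tb]; have n0 : s - t != 0 by rewrite subr_eq0.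
have np : 0 < `|s - t| by rewrite normr_gt0.
rewrite enormB; have -> : (s - t)^-1 *: (g s - g t) - g' t = (s - t)^-1 *: (g s - g t - (s - t) *: g' t).
  by rewrite [RHS]scalerBr [_ *: (_ *: g' t)]scalerA mulVf// scale1r.
rewrite enormZ normfV mulrC ler_pdivrMr// -mulrA -expr2.
have [ts|/ltW ts] := leP t s.
  by have := @tay t s t ta ts sb; rewrite lexx ts real_normK ?num_real//; apply.
have := @tay s t t sa ts tb; rewrite lexx ts real_normK ?num_real// => /(_ isT).
rewrite -(sqrrN (t - s)) opprB enormB opprB => h1; apply: le_trans h1; rewrite le_eqVlt; apply/orP; left.
by apply/eqP; congr enorm; apply/rowP => i; rewrite !mxE; ring.
Qed.

Lemma taylor_C11 a b (g g' : R -> V) (C D : R) : 0 <= C -> taylor_on a b g g' C ->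
  (forall s t, enorm (g' s - g' t) <= D * `|s - t|) -> C11_on a b g.
Proof.
move=> C0 tay lip; exists g', D; split => // t tI.
apply/cvgrPdist_lt => e e0.
rewrite near_withinE; apply/nbhs_ballP; exists (e / (C + 1)) => [|s]; first by rewrite /= divr_gt0// ltr_wpDl.
rewrite /ball/= => ts [st sI]; apply: le_lt_trans (norm_le_enorm _) _.
apply: le_lt_trans (taylor_quotient tay st sI tI) _; rewrite distrC.
move: ts; rewrite ltr_pdivlMr ?ltr_wpDl// mulrDr mulr1 mulrC => h.
by apply: le_lt_trans h; rewrite lerDl.
Qed.

Lemma taylor_is_derive a b (g g' : R -> V) (C : R) t : 0 <= C -> taylor_on a b g g' C ->
  a < t < b -> is_derive t 1 g (g' t).
Proof.
move=> C0 tay /andP[at_ tb].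
have cv : (fun k => k^-1 *: (g (k *: 1 + t) - g t)) @ 0^' --> g' t.
  apply/cvgrPdist_lt => e e0.
  have r0 : 0 < Num.min (e / (C + 1)) (Num.min (t - a) (b - t)).
    by rewrite !lt_min !subr_gt0 at_ tb divr_gt0 ?ltr_wpDl.
  apply/nbhs_ballP; exists (Num.min (e / (C + 1)) (Num.min (t - a) (b - t))) => // k.
  rewrite /ball/= sub0r normrN !lt_min => /and3P[k1 k2 k3] k0.
  rewrite [k *: 1](_ : _ = k); last by rewrite /GRing.scale/= mulr1.
  have := @taylor_quotient a b g g' C (k + t) t tay; rewrite addrK => h.
  apply: le_lt_trans (norm_le_enorm _) _; apply: le_lt_trans (h _ _ _) _.
  - by rewrite -subr_eq0 addrK.
  - by move: k2 k3; rewrite !ltr_norml => /andP[? ?] /andP[? ?]; apply/andP; split; lra.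
  - by rewrite !ltW.
  move: k1; rewrite ltr_pdivlMr ?ltr_wpDl// mulrDr mulr1 mulrC.
  by apply: le_lt_trans; rewrite lerDl.
by apply: DeriveDef; [apply/cvg_ex; exists (g' t)|exact/cvg_lim].
Qed.

(** The density is controlled only on [G], but integrals see nothing else; it is extended coordinate
    by coordinate, which costs the factor [d]. *)
Lemma lipschitz_density_taylor a b (g f : R -> V) (G : set R) (C : R) : 0 <= C -> a <= b ->
  (forall x y i, a <= x -> x <= y -> y <= b -> has_int (fun t => f t ord0 i) x y ((g y - g x) ord0 i)) ->
  {ae mu, forall t, a < t < b -> G t} ->
  (forall s t, G s -> G t -> enorm (f s - f t) <= C * `|s - t|) ->
  exists g' : R -> V, [/\ forall s t, enorm (g' s - g' t) <= d%:R * C * `|s - t|,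
    forall t, G t -> g' t = f t & taylor_on a b g g' (d%:R * C)].
Proof.
move=> C0 ab fI Gae lip.
have /choice[F FP] (i : 'I_d) : exists F : R -> R, (forall t, G t -> F t = f t ord0 i) /\
    forall s t, `|F s - F t| <= C * `|s - t|.
  have [||F F1 F2] := @lipschitz_extension R G (fun t => f t ord0 i) C; last by exists F.
    by [].
  move=> s t Gs Gt; apply: le_trans (lip s t Gs Gt).
  by have := coord_enorm (f s - f t) i; rewrite !mxE.
have sumC (D : R) : \sum_(i < d) C * D = d%:R * C * D.
  by rewrite sumr_const card_ord -[in RHS]mulrA mulr_natl.
exists (fun t => \row_i F i t); split.
- move=> s t; apply: le_trans (enorm_le_sum _) _; rewrite -sumC; apply: ler_sum => i _.
  by rewrite !mxE; have [_] := FP i.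
- by move=> t Gt; apply/rowP => i; rewrite mxE; have [-> ] := FP i.
- move=> x y w ax xy yb /andP[xw wy].
  apply: le_trans (enorm_le_sum _) _; rewrite -sumC; apply: ler_sum => i _.
  have [FG Flip] := FP i; have := fI x y i ax xy yb.
  rewrite !mxE; set D := _ + _ => hI.
  have near_w t : x < t < y -> G t -> `|f t ord0 i - F i w| <= C * (y - x).
    move=> /andP[xt ty] Gt; rewrite -FG// (le_trans (Flip _ _))// ler_wpM2l//.
    by rewrite ler_norml; apply/andP; split; lra.
  have aeG : {ae mu, forall t, x < t < y -> G t}.
    by apply: (ae_imp2 _ Gae Gae) => t h _ /andP[xt ty]; apply: h; rewrite (le_lt_trans ax)// (lt_le_trans ty).
  have := @has_int_ae_le (fun t => f t ord0 i) (fun=> F i w + C * (y - x)) x y D _ _ hI (has_int_cst _ xy).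
  move=> /(_ _)/wrap[|h1].
    by apply: (ae_imp2 _ aeG aeG) => t h _ tI; have := near_w t tI (h tI); rewrite ler_norml => /andP[_ ?]; lra.
  have := @has_int_ae_le (fun=> F i w - C * (y - x)) (fun t => f t ord0 i) x y _ D _ (has_int_cst _ xy) hI.
  move=> /(_ _)/wrap[|h2].
    by apply: (ae_imp2 _ aeG aeG) => t h _ tI; have := near_w t tI (h tI); rewrite ler_norml => /andP[? _]; lra.
  by rewrite ler_norml; apply/andP; split; move: h1 h2; rewrite expr2; lra.
Qed.

End LipschitzDensity.

Lemma shape_sq_growth (R : realType) (h h' : R -> R) (q e : R) :
  potential_shape h h' -> (forall s t : R, 0 <= s -> s < t -> h s < h t) -> 0 <= q -> 0 < e ->
  exists2 r, 0 < r & forall p1 p2, 0 <= p1 -> p1 <= p2 -> `|p1 - q| < r -> `|p2 - q| < r ->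
    h (p2 ^+ 2) - h (p1 ^+ 2) <= (2 * (h' (q ^+ 2) * q) + e) * (p2 - p1).
Proof.
move=> hP hmono q0 e0.
have H0 : 0 <= h' (q ^+ 2) by apply: (shape_deriv_ge0 hP hmono); exact: sqr_ge0.
have q1 : 0 < q + 1 by rewrite ltr_wpDl.
have e1 : 0 < e / (4 * (q + 1)) by rewrite divr_gt0// mulr_gt0.
have [r1 r10 r1P] := shape_deriv_cont hP (sqr_ge0 q) e1.
(* The last bound keeps p^2 within [r1] of q^2. Half of [e] pays for the oscillation of [h'], the
   other half for replacing p1 + p2 by 2q. *)
pose r := Num.min 1 (Num.min (e / (4 * (h' (q ^+ 2) + 1))) (r1 / (2 * q + 1))).
have r0 : 0 < r.
  by rewrite !lt_min ltr01 !divr_gt0// ?mulr_gt0 ?ltr_wpDl ?mulr_ge0.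
exists r => // p1 p2 p10; rewrite le_eqVlt => /orP[/eqP -> _ _|p12 h1 h2].
  by rewrite !subrr mulr0.
have p120 : p1 ^+ 2 < p2 ^+ 2 by rewrite ltr_sqr ?nnegrE// ltW// (le_lt_trans p10).
have [c /andP[c1 c2] ->] := shape_MVT hP (sqr_ge0 p1) p120.
have c0 : 0 <= c by apply: le_trans (ltW c1); exact: sqr_ge0.
have near p : 0 <= p -> `|p - q| < r -> `|p ^+ 2 - q ^+ 2| < r1 /\ p <= q + r.
  move=> p0 pq; have := pq; rewrite !lt_min => /and3P[pq1 _].
  rewrite ltr_pdivlMr ?ltr_wpDl ?mulr_ge0// => pq2.
  move: pq1; rewrite ltr_norml => /andP[_ pq1]; move: pq; rewrite ltr_norml => /andP[_ pq].
  split; last by move: pq; lra.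
  rewrite subr_sqr normrM (le_lt_trans _ pq2)// ler_wpM2l// ger0_norm ?addr_ge0//.
  by move: pq1; lra.
have [n1 _] := near p1 p10 h1.
have [n2 b2] := near p2 (le_trans p10 (ltW p12)) h2.
have hc : h' c <= h' (q ^+ 2) + e / (4 * (q + 1)).
  have := r1P c c0; rewrite ltr_norml => /(_ _)/wrap[|].
    move: n1 n2; rewrite !ltr_norml => /andP[? ?] /andP[? ?]; apply/andP; split; lra.
  by rewrite ltr_norml => /andP[_ ?]; lra.
have hc0 : 0 <= h' c by exact: (shape_deriv_ge0 hP hmono).
rewrite subr_sqr mulrCA mulrC ler_pM2r ?subr_gt0//.
apply: le_trans (_ : (h' (q ^+ 2) + e / (4 * (q + 1))) * (2 * (q + r)) <= _).
  by apply: ler_pM => //; rewrite ?addr_ge0// ?(le_trans p10 (ltW p12))//; move: b2 p12; lra.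
have rr1 : r <= 1 by rewrite ge_min lexx.
have : r <= e / (4 * (h' (q ^+ 2) + 1)) by rewrite !ge_min lexx orbT.
rewrite ler_pdivlMr ?mulr_gt0 ?ltr_wpDl// => rr2.
have : e / (4 * (q + 1)) * (2 * (q + r)) <= e / 2.
  have -> : e / 2 = e / (4 * (q + 1)) * (2 * (q + 1)) by field; rewrite lt0r_neq0.
  by rewrite ler_wpM2l ?(ltW e1)// ler_wpM2l// lerD2l.
have : 0 <= r * 1 by rewrite mulr1 ltW.
by move: rr2; lra.
Qed.

(** * Second differences of a minimizer inside one potential zone *)

Section Smoothness.
Variables (R : realType) (d : nat) (K : seq 'rV[R]_d) (h h' : R -> R).
Hypotheses (K0 : K != [::]) (Ku : uniq K).
Hypotheses (hP : potential_shape h h') (hmono : forall s t : R, 0 <= s -> s < t -> h s < h t).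
Notation V := 'rV[R]_d.
Notation mu := (@lebesgue_measure R).
Notation L := (pot K h).
Notation hs p := (h (p ^+ 2)).
Variables (delta : R) (g : R -> V) (kk pp : R -> R -> R) (rho : R).
Hypotheses (en : energies K h delta g kk pp) (gac : abs_cont 0 delta g) (rho0 : 0 < rho).
Hypothesis cmp : compare_prop K h delta g kk pp rho.
Variables (a b : R) (e : V).
Hypotheses (a0 : 0 <= a) (ab : a < b) (bd : b <= delta).
Hypothesis zone : forall r, a < r < b -> etaK K (g r) = e.

Let delta0 : 0 <= delta.
Proof. exact: le_trans a0 (le_trans (ltW ab) bd). Qed.

(** The cell is closed, so it also contains the path at the end times, where [eta] may differ from
    [e]. *)
Lemma zone_cell t : a <= t <= b -> cell K e (g t).
Proof.
move=> /andP[at_ tb].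
have cz r : a < r < b -> cell K e (g r) by move=> /zone <-; exact: etaK_conv.
have [|clC _] := @cell_closed_convex _ _ K K0 Ku (g ((a + b) / 2)) e.
  by apply: cz; apply/andP; split; move: ab; lra.
apply: clC => B /nbhs_enormP[e0 e00 eB].
have [r r0 rP] := abs_cont_unif delta0 gac e00.
have [s [s1 s2 s3]] : exists s, [/\ a < s, s < b & `|s - t| < r].
  pose w := Num.min (r / 2) ((b - a) / 4).
  have w0 : 0 < w by rewrite lt_min !divr_gt0// subr_gt0.
  have wr : w <= r / 2 by rewrite ge_min lexx.
  have wb : w <= (b - a) / 4 by rewrite ge_min lexx orbT.
  have [tm|tm] := leP t ((a + b) / 2).
    exists (t + w); split; [|move: wb ab tm|rewrite addrAC subrr add0r gtr0_norm//; move: wr r0]; last 2 first.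
    - by lra.
    - by lra.
    by rewrite (le_lt_trans at_)// ltrDl.
  exists (t - w); split; [move: wb ab tm; lra|rewrite (lt_le_trans _ tb)// gtrBl//|].
  by rewrite addrAC subrr add0r normrN gtr0_norm//; move: wr r0; lra.
exists (g s); split; first by apply: cz; rewrite s1.
apply: eB; apply: rP => //; rewrite ?at_ ?tb.
  by rewrite (le_trans a0 (ltW s1)) (le_trans (ltW s2) bd).
by rewrite (le_trans a0 at_) (le_trans tb bd).
Qed.

(** Only increases of the distance matter: a competitor in the cell is bounded from above by
    [pot_le_cell]. *)
Definition growth (N eta0 x y : R) := forall r, x < r < y -> forall p : R,
  enorm (g r - e) <= p -> p <= enorm (g r - e) + eta0 ->
  hs p - hs (enorm (g r - e)) <= N * (p - enorm (g r - e)).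

(* The competitor is the projection on the cell of [g] translated along a trapezoidal profile. *)
Lemma second_difference (s t tau N eta0 : R) : a <= s -> 0 < tau -> s + tau <= t -> t + tau <= b ->
  0 <= N -> 0 < eta0 -> growth N eta0 s (t + tau) ->
  enorm ((g (t + tau) - g t) - (g (s + tau) - g s)) <= N / 2 * tau * (t + tau - s).
Proof.
move=> as_ tau0 st tb N0 eta00 gr; set X := g (s + tau) - g s; set Y := g (t + tau) - g t.
pose v := Y - X; rewrite -/v leNgt; apply/negP => big.
have v0 : 0 < enorm v.
  apply: le_lt_trans big; rewrite !mulr_ge0// ?(ltW tau0)//; move: st tau0; lra.
set l := t + tau - s in big.
pose gap := 2 * enorm v - N * tau * l.
have gap0 : 0 < gap by rewrite subr_gt0; move: big; lra.
(* In order: the term quadratic in [eps] takes at most half of [gap], the displacement stays within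
   the range of [growth], and it stays below [rho]. *)
pose eps := Num.min (gap / (4 * (tau * enorm v))) (Num.min (eta0 / (tau * enorm v)) (rho / 2 / (tau * enorm v))).
have tv0 : 0 < tau * enorm v by rewrite mulr_gt0.
have eps0 : 0 < eps by rewrite !lt_min !divr_gt0// mulr_gt0.
have eps1 : eps * (4 * (tau * enorm v)) <= gap by rewrite -ler_pdivlMr ?mulr_gt0// ge_min lexx.
have eps2 : eps * (tau * enorm v) <= eta0 by rewrite -ler_pdivlMr// !ge_min lexx orbT.
have eps3 : eps * (tau * enorm v) < rho.
  apply: (@le_lt_trans _ _ (rho / 2)); last by move: rho0; lra.
  by rewrite -ler_pdivlMr// !ge_min lexx !orbT.
(* The trapezoid as a minimum of three functions, with slopes 1, 0 and -1 on the three pieces. *)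
pose phi r := Num.min (r - s) (Num.min tau (t + tau - r)).
have phi1 r : s <= r <= s + tau -> phi r = r - s.
  by move=> /andP[r1 r2]; rewrite /phi min_l// le_min; apply/andP; split; move: r2 st; lra.
have phi2 r : s + tau <= r <= t -> phi r = tau.
  move=> /andP[r1 r2]; rewrite /phi [Num.min tau _]min_l; last by move: r2; lra.
  by rewrite min_r//; move: r1; lra.
have phi3 r : t <= r <= t + tau -> phi r = t + tau - r.
  move=> /andP[r1 r2]; rewrite /phi [Num.min tau _]min_r; last by move: r1; lra.
  by rewrite min_r//; move: r1 st; lra.
have phiI r : s <= r <= t + tau -> 0 <= phi r <= tau.
  move=> /andP[r1 r2]; rewrite /phi !le_min !ge_min lexx orbT andbT !subr_ge0 r1 r2 (ltW tau0)//.
have sle : s <= t + tau by move: st tau0; lra.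
have tb' : t <= b by move: tb tau0; lra.
have cell_s r : s <= r <= t + tau -> cell K e (g r).
  by move=> /andP[r1 r2]; apply: zone_cell; rewrite (le_trans as_ r1) (le_trans r2 tb).
have [clC cC] := cell_closed_convex K0 Ku (zone_cell (t := a) (introT andP (conj (lexx a) (ltW ab)))).
have ne : cell K e !=set0 by exists (g s); apply: cell_s; rewrite lexx.
pose Pr y := xget 0 [set p | is_proj (cell K e) y p].
have PrP y : is_proj (cell K e) y (Pr y).
  have [p pP] := is_proj_exists y clC cC ne.
  by rewrite /Pr; case: xgetP => [q _ //|/(_ p)].
pose sg r := if (s <= r) && (r <= t + tau) then Pr (g r + (eps * phi r) *: v) else g r.
have sgE r : s <= r <= t + tau -> sg r = Pr (g r + (eps * phi r) *: v) by rewrite /sg => ->.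
have dist r : s <= r <= t + tau -> enorm (sg r - g r) <= eps * (tau * enorm v).
  move=> rI; have /andP[f1 f2] := phiI r rI.
  rewrite sgE//; apply: le_trans (is_proj_dist (PrP _) (is_proj_id (cell_s r rI))) _.
  rewrite addrAC subrr add0r enormZ ger0_norm ?mulr_ge0 ?(ltW eps0)// -mulrA.
  by rewrite ler_pM2l// ler_wpM2r ?enorm_ge0.
pose w := N * (eps * (tau * enorm v)).
have Lw r : s < r < t + tau -> L (sg r) <= 1 * L (g r) + w.
  move=> /andP[r1 r2]; have rI : s <= r <= t + tau by rewrite !ltW.
  rewrite mul1r [L (g r)](potE h K0 Ku) zone; last first.
    by rewrite (le_lt_trans as_ r1) (lt_le_trans r2 tb).
  have cs : cell K e (sg r) by rewrite sgE//; case: (PrP (g r + (eps * phi r) *: v)).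
  apply: le_trans (pot_le_cell K0 Ku hmono cs) _.
  set q := enorm (g r - e); have q0 : 0 <= q by exact: enorm_ge0.
  have sq : enorm (sg r - e) <= q + eps * (tau * enorm v).
    by apply: le_trans (ler_enormB _ (g r) _) _; rewrite addrC lerD2l dist.
  have m0 : 0 <= eps * (tau * enorm v) by rewrite mulr_ge0 ?ltW.
  apply: le_trans (_ : hs (q + eps * (tau * enorm v)) <= _).
    by apply: (shape_le hmono); rewrite ?sqr_ge0// ler_sqr ?nnegrE ?enorm_ge0 ?addr_ge0.
  have := gr r _ (q + eps * (tau * enorm v)); rewrite r1 r2 -/q lerDl lerD2l => /(_ isT m0 eps2).
  by rewrite [X in N * X]addrAC subrr add0r -/w; lra.
have dom u x y : s <= x -> y <= t + tau ->
    (forall r r', x <= r <= y -> x <= r' <= y -> (eps * (phi r - phi r')) *: v = (r - r') *: u) ->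
    piece_dom K h g sg 1 1 w u x y.
  move=> sx yt hu; have sub r : x <= r <= y -> s <= r <= t + tau.
    by move=> /andP[r1 r2]; rewrite (le_trans sx r1) (le_trans r2 yt).
  split=> [r r' rI r'I|r /andP[r1 r2]]; last by apply: Lw; rewrite (le_lt_trans sx r1) (lt_le_trans r2 yt).
  rewrite scale1r !sgE ?sub//; apply: le_trans (is_proj_dist (PrP _) (PrP _)) _.
  rewrite -hu// le_eqVlt; apply/orP; left; apply/eqP; congr enorm.
  by apply/rowP => i; rewrite !mxE; ring.
have end_s : phi s = 0 by rewrite phi1 ?subrr// lexx lerDl ltW.
have end_t : phi (t + tau) = 0 by rewrite phi3 ?subrr// lexx lerDl ltW.
have sg_end r : s <= r <= t + tau -> phi r = 0 -> sg r = g r.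
  move=> rI f0; rewrite sgE// f0 mulr0 scale0r addr0.
  exact: is_proj_unique (PrP _) (is_proj_id (cell_s r rI)).
have := @cmp sg s (s + tau) t (t + tau) 1 1 w w w (eps *: v) 0 (- (eps *: v)).
move=> /(_ (le_trans a0 as_) _ st _ (le_trans tb bd) _ _ _ _ _)/wrap[].
- by rewrite lerDl ltW.
- by rewrite lerDl ltW.
- move=> r _ rI; have [h1|h1] := boolP ((s <= r) && (r <= t + tau)); last by rewrite /sg (negPf h1).
  have [r1 r2] := andP h1; case: rI => r3; apply: sg_end => //.
    by have -> : r = s by apply/le_anti; rewrite r1 r3.
  by have -> : r = t + tau by apply/le_anti; rewrite r2 r3.
- by move=> r rI; apply: le_lt_trans eps3; exact: dist.
- apply: dom => //; first by move: st tau0; lra.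
  by move=> r r' rI r'I; rewrite !phi1// scalerA; congr (_ *: _); ring.
- apply: dom; [by rewrite lerDl ltW|by rewrite lerDl ltW|].
  by move=> r r' rI r'I; rewrite !phi2// subrr mulr0 scale0r scaler0.
- apply: dom => //; first by move: st tau0; lra.
  by move=> r r' rI r'I; rewrite !phi3// scalerN -scaleNr scalerA; congr (_ *: _); ring.
have [_ kc pc _] := en.
have s0 := le_trans a0 as_; have sst : s <= s + tau by rewrite lerDl ltW.
have tt : t <= t + tau by rewrite lerDl ltW.
have td := le_trans tb bd.
rewrite /piece_cost sqnN sqnZ dotpNl !dotpZl !expr1n /(sqn 0) !dotp0l.
rewrite (kc s (s + tau) (t + tau))// ?(kc (s + tau) t (t + tau))//; first last.
- by move: s0 sst; lra.
- by move: st tt; lra.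
rewrite (pc s (s + tau) (t + tau))// ?(pc (s + tau) t (t + tau))//; first last.
- by move: s0 sst; lra.
- by move: st tt; lra.
rewrite -/X -/Y => cost.
have vv : dotp v Y - dotp v X = enorm v ^+ 2 by rewrite enorm_sqr -dotpNr -dotpDr.
(* To first order the rising ramp contributes [2 * eps * dotp v X] and the falling one
   [- 2 * eps * dotp v Y]; their sum is a kinetic gain of 2 eps |v|^2. *)
have cost2 : 2 * eps * (enorm v ^+ 2) <= 2 * eps ^+ 2 * enorm v ^+ 2 * tau + w * l.
  rewrite -{1}vv enorm_sqr /l; move: cost; lra.
have : eps * enorm v * gap <= eps * enorm v * (2 * (eps * (tau * enorm v))).
  by move: cost2; rewrite /gap /w; lra.
rewrite ler_pM2l ?mulr_gt0// => h1; suff : (0 : R) < 0 by rewrite ltxx.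
by move: h1 eps1 gap0; lra.
Qed.

(** Divide [second_difference] by [tau] and let [tau] tend to 0. *)
Lemma derive_difference (a1 b1 s t N eta0 : R) (v w : V) : a <= a1 -> b1 <= b -> a1 < s -> s < t -> t < b1 ->
  0 <= N -> 0 < eta0 -> growth N eta0 a1 b1 ->
  is_derive s 1 g v -> is_derive t 1 g w -> enorm (w - v) <= N / 2 * (t - s).
Proof.
move=> aa bb as_ st tb N0 eta00 gr ds dt; apply/ler_addgt0Pr => e' e'0.
have e3 : 0 < e' / 3 by rewrite divr_gt0.
have [r1 r10 r1P] := is_derive_quotient ds e3.
have [r2 r20 r2P] := is_derive_quotient dt e3.
pose tau := Num.min (Num.min (r1 / 2) (r2 / 2)) (Num.min (Num.min (b1 - t) (t - s)) (e' / 3 / (N + 1))).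
have tau0 : 0 < tau by rewrite !lt_min !subr_gt0 tb st !divr_gt0// ltr_wpDl.
have [t1 t2 t3 t4] : [/\ tau <= r1 / 2, tau <= r2 / 2, tau <= b1 - t & tau <= t - s].
  by rewrite /tau !ge_min !lexx !orbT.
have : tau <= e' / 3 / (N + 1) by rewrite /tau !ge_min lexx !orbT.
rewrite ler_pdivlMr ?ltr_wpDl// => t5.
have h1 : enorm (tau^-1 *: (g (s + tau) - g s) - v) < e' / 3.
  by apply: r1P; rewrite ?lt0r_neq0// gtr0_norm//; move: t1 r10; lra.
have h2 : enorm (tau^-1 *: (g (t + tau) - g t) - w) < e' / 3.
  by apply: r2P; rewrite ?lt0r_neq0// gtr0_norm//; move: t2 r20; lra.
have := @second_difference s t tau N eta0 _ tau0 _ _ N0 eta00 _.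
move=> /(_ _ _ _ _)/wrap[].
- exact: le_trans aa (ltW as_).
- by move: t4; lra.
- by apply: le_trans bb; move: t3; lra.
- move=> r /andP[r1' r2']; apply: gr; rewrite (lt_trans as_ r1') (lt_le_trans r2')//.
  by move: t3; lra.
set X := g (t + tau) - g t in h2 *; set Y := g (s + tau) - g s in h1 *.
move=> h3; have : enorm (tau^-1 *: (X - Y)) <= N / 2 * (t + tau - s).
  rewrite enormZ gtr0_norm ?invr_gt0// mulrC ler_pdivrMr//; apply: le_trans h3 _.
  by rewrite le_eqVlt; apply/orP; left; apply/eqP; ring.
have : enorm (w - v) <= enorm (tau^-1 *: X - w) + enorm (tau^-1 *: (X - Y)) + enorm (tau^-1 *: Y - v).
  have -> : w - v = - (tau^-1 *: X - w) + tau^-1 *: (X - Y) + (tau^-1 *: Y - v).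
    by apply/rowP => i; rewrite !mxE; ring.
  rewrite (le_trans (ler_enormD _ _))// lerD2r (le_trans (ler_enormD _ _))// enormN//.
move=> h4 h5; move: h1 h2 h4 h5 t5 tau0 e'0; move: (enorm _) (enorm _) (enorm _) (enorm _) => x1 x2 x3 x4.
by move=> *; lra.
Qed.

Lemma zone_bounded : exists2 B, 0 <= B & forall t, a <= t <= b -> enorm (g t - e) <= B.
Proof.
suff [B BP] : exists B, forall t, a <= t <= b -> enorm (g t - e) <= B.
  exists B => //; apply: le_trans (enorm_ge0 (g a - e)) _.
  by apply: BP; rewrite lexx ltW.
have [r r0 rP] := abs_cont_unif delta0 gac ltr01.
apply: (@cousin R a b (fun x y => exists B, forall t, x <= t <= y -> enorm (g t - e) <= B) (ltW ab)).
  move=> x y z _ _ _ _ [B1 B1P] [B2 B2P]; exists (Num.max B1 B2) => t /andP[xt tz].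
  by rewrite le_max; have [ty|/ltW ty] := leP t y; [rewrite B1P// xt ty|rewrite B2P ?orbT// ty].
move=> t tI; exists r => // x y ax xt ty yb xr yr.
exists (enorm (g t - e) + 1) => s /andP[xs sy]; apply: le_trans (ler_enormB _ (g t) _) _.
rewrite addrC lerD2l ltW//; apply: rP.
- by move: a0 bd => *; apply/andP; split; lra.
- by move: tI a0 bd => /andP[? ?] *; apply/andP; split; lra.
- by rewrite ltr_norml; apply/andP; split; lra.
Qed.

Lemma zone_growth : exists2 N, 0 <= N & growth N 1 a b.
Proof.
have [B B0 BP] := zone_bounded.
have B1 : 0 <= B + 1 by rewrite addr_ge0.
have [M M0 MP] := shape_sq_lip hP B1; exists M; first exact: ltW.
move=> r /andP[r1 r2] p pq p1; have q0 := enorm_ge0 (g r - e).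
have := BP r; rewrite (ltW r1) (ltW r2) => /(_ isT) qB.
have := MP p (enorm (g r - e)); rewrite q0 (le_trans q0 pq) /= => /(_ _ _)/wrap[||hM].
- by move: qB p1; lra.
- by move: qB; lra.
by apply: le_trans (ler_norm _) _; apply: le_trans hM _; rewrite ger0_norm// subr_ge0.
Qed.

(** The derivative of p -> h(p^2) is 2 p h'(p^2); the factor 1/2 in [second_difference] turns this
    rate into the announced constant. *)
Lemma local_growth r0 eps : a < r0 < b -> 0 < eps -> exists2 r, 0 < r &
  growth (2 * (h' (enorm (g r0 - e) ^+ 2) * enorm (g r0 - e)) + eps) r (r0 - r) (r0 + r) /\
  a <= r0 - r /\ r0 + r <= b.
Proof.
move=> /andP[ar rb] eps0.
have [w w0 wP] := shape_sq_growth hP hmono (enorm_ge0 (g r0 - e)) eps0.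
have w2 : 0 < w / 2 by rewrite divr_gt0.
have [r r_0 rP] := abs_cont_unif delta0 gac w2.
exists (Num.min (Num.min r (w / 2)) (Num.min (r0 - a) (b - r0))).
  by rewrite !lt_min !subr_gt0 ar rb r_0 w2.
set m := Num.min _ _.
have [m1 m2 m3 m4] : [/\ m <= r, m <= w / 2, m <= r0 - a & m <= b - r0].
  by rewrite /m !ge_min !lexx !orbT.
split; last by split; [move: m3; lra|move: m4; lra].
move=> s /andP[s1 s2] p pq pm.
have : `|enorm (g s - e) - enorm (g r0 - e)| < w / 2.
  apply: le_lt_trans (ler_enorm_dist _ _) _; rewrite opprB addrA subrK; apply: rP.
  - by apply/andP; split; move: a0 bd m3 m4 s1 s2; lra.
  - by apply/andP; split; move: a0 bd ar rb; lra.
  - by rewrite ltr_norml; apply/andP; split; move: m1 s1 s2; lra.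
rewrite ltr_norml => /andP[h1 h2]; apply: wP => //; first exact: enorm_ge0.
  by rewrite ltr_norml; apply/andP; split; move: h1 h2 w0; lra.
by rewrite ltr_norml; apply/andP; split; move: h1 h2 w0 pq pm m2; lra.
Qed.

(** The crude rate [N], valid on the whole interval, already makes the derivative Lipschitz on the
    set where it exists. *)
Lemma zone_taylor : exists (g' : R -> V) (C D : R), [/\ 0 <= C, 0 <= D,
  forall s t, enorm (g' s - g' t) <= D * `|s - t| & taylor_on a b g g' C].
Proof.
have [N N0 gN] := zone_growth.
have gab : abs_cont a b g by exact: abs_cont_sub a0 (ltW ab) bd gac.
have [f [fI fD]] := abs_cont_density ab gab.
pose G := [set t | a < t < b /\ is_derive t 1 g (f t)].
have N2 : 0 <= N / 2 by rewrite divr_ge0.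
have := @lipschitz_density_taylor R d a b g f G (N / 2) N2 (ltW ab) fI.
move=> /(_ _ _)/wrap[|s t [/andP[s1 s2] ds] [/andP[t1 t2] dt]|[g' [lip _ tay]]].
- by apply: (ae_imp2 _ fD fD) => t ht _ tI; split => //; exact: ht.
- have [st|ts|->] := ltgtP s t; last by rewrite !subrr enorm0 normr0 mulr0.
    rewrite enormB distrC gtr0_norm ?subr_gt0//.
    by apply: (derive_difference (lexx a) (lexx b) s1 st t2 N0 ltr01 gN ds dt).
  rewrite gtr0_norm ?subr_gt0//.
  by apply: (derive_difference (lexx a) (lexx b) t1 ts s2 N0 ltr01 gN dt ds).
by exists g', (d%:R * (N / 2)), (d%:R * (N / 2)); split; rewrite ?mulr_ge0 ?divr_ge0.
Qed.

Lemma zone_C11 : C11_on a b g.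
Proof.
by have [g' [C [D [C0 D0 lip tay]]]] := zone_taylor; exact: taylor_C11 C0 tay lip.
Qed.

Lemma zone_second_derivative : {ae mu, forall r, a < r < b ->
  derivable ('D_1 g) r 1 /\
  enorm ('D_1 ('D_1 g) r) <= h' (sqn (g r - e)) * enorm (g r - e)}.
Proof.
have [g' [C [D [C0 D0 lip tay]]]] := zone_taylor.
have dg t : a < t < b -> is_derive t 1 g (g' t) by exact: taylor_is_derive C0 tay.
have gab : abs_cont a b g by exact: abs_cont_sub a0 (ltW ab) bd gac.
have g'ac : abs_cont a b g'.
  apply: (abs_cont_dominated (g := g) (C := 0) (M := D)) => //; first exact: ltW.
  by move=> x y _ _; rewrite mul0r add0r.
have [f [_ fD]] := abs_cont_density ab g'ac.
apply: (ae_imp2 _ fD fD) => r hr _ rI; have {}hr := hr rI.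
have /andP[ar rb] := rI.
(* ['D_1 g] and the Lipschitz representative agree near [r], so differentiability of the latter at
   [r] passes to the former. *)
have near_g' : \near r, g' r = 'D_1 g r.
  have w0 : 0 < Num.min (r - a) (b - r) by rewrite lt_min !subr_gt0 ar.
  apply/nbhs_ballP; exists (Num.min (r - a) (b - r)) => // t.
  rewrite /ball/= lt_min !ltr_norml => /andP[/andP[? ?] /andP[? ?]].
  by have [] : is_derive t 1 g (g' t) by apply: dg; apply/andP; split; lra.
have [dD eD] := near_eq_is_derive near_g' hr.
split => //; rewrite eD -enorm_sqr.
set q := enorm (g r - e).
apply/ler_addgt0Pr => eps eps0.
have [w w0 [gw [aw wb]]] := local_growth rI eps0.
have e2 : 0 < eps / 2 by rewrite divr_gt0.
have [w' w'0 w'P] := is_derive_quotient hr e2.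
pose s := Num.min (w / 2) (w' / 2).
have s0 : 0 < s by rewrite lt_min !divr_gt0.
have [sw sw'] : s <= w / 2 /\ s <= w' / 2 by rewrite /s !ge_min !lexx !orbT.
have := w'P s (lt0r_neq0 s0); rewrite gtr0_norm// => /(_ _)/wrap[|h1]; first by move: sw' w'0; lra.
set N := 2 * _ + eps in gw.
have N0 : 0 <= N.
  by rewrite addr_ge0 ?(ltW eps0)// !mulr_ge0 ?enorm_ge0// (shape_deriv_ge0 hP hmono)// sqr_ge0.
have h2 : enorm (g' (r + s) - g' r) <= N / 2 * (r + s - r).
  apply: (@derive_difference (r - w) (r + w) r (r + s) N w _ _ aw wb _ _ _ N0 w0 gw (dg r rI)).
  - by rewrite gtrBl.
  - by rewrite ltrDl.
  - by rewrite ltrD2l; move: sw w0; lra.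
  - by apply: dg; apply/andP; split; move: sw w0 wb ar s0; lra.
rewrite addrAC subrr add0r in h2.
have h3 : enorm (s^-1 *: (g' (r + s) - g' r)) <= N / 2.
  by rewrite enormZ gtr0_norm ?invr_gt0// mulrC ler_pdivrMr.
have := ler_enormB (f r) (s^-1 *: (g' (r + s) - g' r)) 0.
rewrite !subr0 enormB => h4; move: h1 h3 h4; rewrite /N -/q; lra.
Qed.

End Smoothness.

(** * Finiteness of the shocks *)

Section Shocks.
Variables (R : realType) (d : nat) (K : seq 'rV[R]_d) (h h' : R -> R).
Hypotheses (K0 : K != [::]) (Ku : uniq K).
Hypotheses (hP : potential_shape h h') (hmono : forall s t : R, 0 <= s -> s < t -> h s < h t).
Notation V := 'rV[R]_d.
Variables (delta : R) (g : R -> V) (kk pp : R -> R -> R) (rho : R).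
Hypotheses (delta0 : 0 < delta) (en : energies K h delta g kk pp) (gac : abs_cont 0 delta g) (rho0 : 0 < rho).
Hypothesis cmp : compare_prop K h delta g kk pp rho.
Notation shock := (nds K delta g).

Lemma not_shock t : 0 <= t <= delta -> ~ shock t -> exists2 r, 0 < r &
  forall s1 s2, 0 <= s1 <= delta -> 0 <= s2 <= delta -> `|s1 - t| < r -> `|s2 - t| < r ->
    etaK K (g s1) = etaK K (g s2).
Proof.
move=> tI nt; apply: contrapT => no; apply: nt; split => // eps eps0.
apply: contrapT => no2; apply: no; exists eps => // s1 s2 s1I s2I s1t s2t.
by apply: contrapT => /eqP ne; apply: no2; exists s1, s2.
Qed.

(** [eta] is constant on each punctured side of [t0], with possibly different constants; only [t0]
    itself may be a shock. *)
Lemma shock_isolated t0 : 0 <= t0 <= delta -> exists2 r, 0 < r &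
  forall t, 0 <= t <= delta -> `|t - t0| < r -> t != t0 -> ~ shock t.
Proof.
move=> /andP[t00 t0d].
have [r1 r10 r1P] : exists2 r, 0 < r & exists e, forall t, t0 < t -> t < t0 + r -> t <= delta -> etaK K (g t) = e.
  move: t0d; rewrite le_eqVlt => /orP[/eqP td|td].
    exists 1 => //; exists 0 => t t1 _ t2; suff : (0 : R) < 0 by rewrite ltxx.
    by move: t1 t2; rewrite td; lra.
  have T0 : 0 < delta - t0 by rewrite subr_gt0.
  have os := one_sided_right t00 (ltW td) en gac cmp.
  have [e [r [r0 rT rP]]] := one_sided_constant K0 Ku hP hmono os T0 rho0.
  exists r => //; exists e => t t1 t2 _; have := rP (t - t0); rewrite [t0 + _]addrC subrK; apply.
  by rewrite subr_gt0 t1/= lerBlDl ltW.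
have [r2 r20 r2P] : exists2 r, 0 < r & exists e, forall t, t < t0 -> t0 - r < t -> 0 <= t -> etaK K (g t) = e.
  move: t00; rewrite le_eqVlt => /orP[/eqP td|td].
    exists 1 => //; exists 0 => t t1 _ t2; suff : (0 : R) < 0 by rewrite ltxx.
    by move: t1 t2; rewrite -td; lra.
  have os := one_sided_left (ltW td) t0d en gac cmp.
  have [e [r [r0 rT rP]]] := one_sided_constant K0 Ku hP hmono os td rho0.
  exists r => //; exists e => t t1 t2 _; have := rP (t0 - t).
  have -> : t0 - (t0 - t) = t by ring.
  apply.
  by rewrite subr_gt0 t1/= lerBlDr addrC -lerBlDr ltW.
have [e1 e1P] := r1P; have [e2 e2P] := r2P.
exists (Num.min r1 r2) => [|t /andP[t1 t2]]; first by rewrite lt_min r10.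
rewrite lt_min !ltr_norml => /andP[/andP[? t3] /andP[t4 ?]].
(* This radius keeps all neighbours of [t] on its side of [t0] and inside the window of
   constancy. *)
rewrite neq_lt => /orP[tt|tt] [_] /(_ (Num.min `|t - t0| (Num.min (r1 - `|t - t0|) (r2 - `|t - t0|)))).
  rewrite ltr0_norm ?subr_lt0// opprB !lt_min !subr_gt0 tt => /(_ _)/wrap[|].
    by apply/andP; split; lra.
  move=> [s1 [s2 [/andP[a1 a2] /andP[b1 b2]]]]; rewrite !lt_min !ltr_norml.
  move=> /and3P[/andP[? ?] _ /andP[? ?]] /and3P[/andP[? ?] _ /andP[? ?]] /eqP; apply.
  by rewrite !e2P//; lra.
rewrite gtr0_norm ?subr_gt0// !lt_min !subr_gt0 tt => /(_ _)/wrap[|].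
  by apply/andP; split; lra.
move=> [s1 [s2 [/andP[a1 a2] /andP[b1 b2]]]]; rewrite !lt_min !ltr_norml.
move=> /and3P[/andP[? ?] /andP[? ?] _] /and3P[/andP[? ?] /andP[? ?] _] /eqP; apply.
by rewrite !e1P//; lra.
Qed.

Lemma shock_finite : finite_set shock.
Proof.
have -> : shock = shock `&` [set t | 0 <= t <= delta].
  by apply/seteqP; split=> [t nt|t []//]; split => //; case: nt.
apply: (@cousin R 0 delta (fun x y => finite_set (shock `&` [set t | x <= t <= y])) (ltW delta0)).
  move=> x y z _ _ _ _ f1 f2.
  apply: (@sub_finite_set _ _ ((shock `&` [set t | x <= t <= y]) `|` (shock `&` [set t | y <= t <= z]))).
    by move=> t /= [nt /andP[xt tz]]; have [ty|/ltW ty] := leP t y; [left|right]; rewrite ?xt ?ty.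
  by rewrite finite_setU.
move=> t /shock_isolated[r r0 rP]; exists r => // x y x0 xt ty yd xr yr.
apply: (@sub_finite_set _ _ [set t]) => [s [/= ns /andP[xs sy]]|]; last exact: finite_set1.
apply: contrapT => st; apply: (rP s _ _ _ ns).
- by rewrite (le_trans x0 xs) (le_trans sy yd).
- by rewrite ltr_norml; apply/andP; split; lra.
- exact/eqP.
Qed.

Lemma no_shock_constant x y : 0 <= x -> x <= y -> y <= delta ->
  (forall t, x <= t <= y -> ~ shock t) -> etaK K (g x) = etaK K (g y).
Proof.
move=> x0 xy yd no.
apply: (@cousin R x y (fun s t => etaK K (g s) = etaK K (g t)) xy).
  by move=> ? ? ? _ _ _ _ ->.
move=> t /[dup] tI /andP[xt ty].
have tI' : 0 <= t <= delta by rewrite (le_trans x0 xt) (le_trans ty yd).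
have [r r0 rP] := not_shock tI' (no t tI); exists r => // s1 s2 xs st ts sy sr tr.
apply: rP.
- by apply/andP; split; lra.
- by apply/andP; split; lra.
- by rewrite ltr_norml; apply/andP; split; lra.
- by rewrite ltr_norml; apply/andP; split; lra.
Qed.

End Shocks.

(** Needed when 0 or [delta] is itself a shock; the filter of difference quotients is then
    trivial. *)
Lemma C11_on_degenerate (R : realType) (d : nat) (a : R) (g : R -> 'rV[R]_d) : C11_on a a g.
Proof.
exists (fun=> 0), 0; split => [s t _ _|t /andP[at_ ta]].
  by rewrite subrr enorm0 mul0r.
apply/cvgrPdist_lt => e e0; rewrite near_withinE; near=> s => -[st /andP[as_ sa]].
case/eqP: st; apply/le_anti; rewrite (le_trans sa at_) (le_trans ta as_)//.
Unshelve. all: by end_near. Qed.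

Lemma sorted_gap (R : realType) (ts : seq R) (delta : R) i u : sorted <%R ts ->
  all (fun t => 0 <= t <= delta) ts -> 0 <= delta -> (i <= size ts)%N ->
  let a := nth 0 (0 :: rcons ts delta) i in
  let b := nth 0 (0 :: rcons ts delta) i.+1 in
  [/\ 0 <= a, a <= b, b <= delta & u \in ts -> u <= a \/ b <= u].
Proof.
move=> st at_ d0 i_s a b.
have s1 : sorted <=%R (0 :: rcons ts delta).
  rewrite /= rcons_path; apply/andP; split.
    rewrite path_min_sorted; last by apply/allP => t /(allP at_)/andP[].
    by apply: sub_sorted st => x y /ltW.
  by have := mem_last 0 ts; rewrite inE => /orP[/eqP ->//|/(allP at_)/andP[]].
have sz : size (0 :: rcons ts delta) = (size ts).+2 by rewrite /= size_rcons.
have nthS (j k : nat) : (j <= k)%N -> (k < (size ts).+2)%N ->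
    nth 0 (0 :: rcons ts delta) j <= nth 0 (0 :: rcons ts delta) k.
  move=> jk ks; apply: (sorted_leq_nth le_trans lexx 0 s1); rewrite ?inE ?sz//.
  exact: leq_ltn_trans ks.
split.
- by apply: (nthS 0%N i); rewrite // ltnS leqW.
- exact: nthS.
- have := nthS i.+1 (size ts).+1 i_s (leqnn _).
  by rewrite [X in _ <= X]/= nth_rcons ltnn eqxx.
- move=> ut; have -> : u = nth 0 (0 :: rcons ts delta) (index u ts).+1.
    by rewrite /= nth_rcons index_mem ut nth_index.
  have us : (index u ts < size ts)%N by rewrite index_mem.
  have [h1|h1] := leqP (index u ts).+1 i; [left|right]; apply: nthS => //.
  all: by rewrite ltnS leqW.
Qed.

Theorem theorem3p11 (R : realType) (d : nat) (K : seq 'rV[R]_d)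
  (h h' : R -> R) (delta : R) (x0 xd : 'rV[R]_d) (gamma : R -> 'rV[R]_d) :
  K != [::] -> uniq K ->
  potential_shape h h' ->
  (forall s t, 0 <= s -> s < t -> h s < h t) ->
  0 < delta ->
  local_minimizer h K delta x0 xd gamma ->
  (* (i) *)
  finite_set (nds K delta gamma) /\
  exists ts : seq R,
    [/\ sorted <%R ts, all (fun t => 0 <= t <= delta) ts,
        (forall t, nds K delta gamma t <-> t \in ts) &
        forall i : nat, (i <= size ts)%N ->
          let a := nth 0 (0 :: rcons ts delta) i in
          let b := nth 0 (0 :: rcons ts delta) i.+1 in
          (* eta(gamma) constant on the connected component between a and b *)
          (forall s t, a <= s <= b -> a <= t <= b -> s \notin ts -> t \notin ts ->
             etaK K (gamma s) = etaK K (gamma t)) /\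
          (* (ii) *)
          C11_on a b gamma /\
          (forall e : 'rV[R]_d,
             (forall r, a < r < b -> Qzone K e (gamma r)) ->
             {ae @lebesgue_measure R, forall r, a < r < b ->
                derivable ('D_1 gamma) r 1 /\
                enorm ('D_1 ('D_1 gamma) r) <=
                  h' (sqn (gamma r - e)) * enorm (gamma r - e)})].
Proof.
move=> K0 Ku hP hmono delta0 lm.
have [gac [kk [pp [rho [en rho0 cmp]]]]] := local_minimizer_compare K0 Ku hP hmono delta0 lm.
have fin := shock_finite K0 Ku hP hmono delta0 en gac rho0 cmp.
split => //; have [s0 s0E] := (finite_seqP _).1 fin.
pose ts := sort <=%R (undup s0).
have tsE t : nds K delta gamma t <-> t \in ts.
  by rewrite mem_sort mem_undup s0E.
have tsI : all (fun t => 0 <= t <= delta) ts by apply/allP => t /tsE[].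
have tsS : sorted <%R ts.
  by rewrite lt_sorted_uniq_le sort_uniq undup_uniq/= sort_le_sorted.
exists ts; split => // i i_s a b.
have gap u : [/\ 0 <= a, a <= b, b <= delta & u \in ts -> u <= a \/ b <= u].
  exact: sorted_gap tsS tsI (ltW delta0) i_s.
have [a0 ab bd _] := gap 0.
have cst s t : a <= s <= b -> a <= t <= b -> s \notin ts -> t \notin ts ->
    etaK K (gamma s) = etaK K (gamma t).
  have main s' t' : a <= s' -> s' <= t' -> t' <= b -> s' \notin ts -> t' \notin ts ->
      etaK K (gamma s') = etaK K (gamma t').
    move=> as_ st tb sts tts; apply: (no_shock_constant (delta := delta)) => //.
    - exact: le_trans a0 as_.
    - exact: le_trans tb bd.
    move=> u /andP[su ut] /tsE uts; have [_ _ _ /(_ uts)[ua|bu]] := gap u.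
      move: sts; rewrite (_ : s' = u) ?uts//; apply/le_anti.
      by rewrite su (le_trans ua as_).
    move: tts; rewrite (_ : t' = u) ?uts//; apply/le_anti.
    by rewrite ut (le_trans tb bu).
  move=> /andP[? ?] /andP[? ?] ? ?; have [st|/ltW ts'] := leP s t; first exact: main.
  by apply/esym; exact: main.
have inner t : a < t < b -> t \notin ts.
  move=> /andP[at_ tb]; apply/negP => tts; have [_ _ _ /(_ tts)[ta|bt]] := gap t.
    by have := le_lt_trans ta at_; rewrite ltxx.
  by have := lt_le_trans tb bt; rewrite ltxx.
split; first exact: cst.
move: ab; rewrite le_eqVlt => /orP[/eqP ab|ab].
  split; first by rewrite -ab; exact: C11_on_degenerate.
  move=> e _; apply: (ae_imp2 _ (ae_neq a) (ae_neq a)) => r _ _ /andP[ar].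
  by rewrite -ab => /(lt_trans ar); rewrite ltxx.
split; last first.
  by move=> e zone; exact: (zone_second_derivative K0 Ku hP hmono en gac rho0 cmp a0 ab bd zone).
(* For the regularity claim the zone is not given; it is read off at the midpoint. *)
have midI : a < (a + b) / 2 < b by apply/andP; split; lra.
apply: (zone_C11 K0 Ku hP hmono en gac rho0 cmp a0 ab bd (e := etaK K (gamma ((a + b) / 2)))).
move=> r rI; apply: cst; rewrite ?inner//.
  by case/andP: rI => /ltW -> /ltW ->.
by case/andP: midI => /ltW -> /ltW ->.
Qed.
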